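(* Schur's exponent conjecture (the assertion that if $G$ is a finite group, then $\exp(H_2(G,\mathbb{Z}))$ divides $\exp(G)$) holds for the following classes of groups: (i) a group $G$ with $\exp(G/Z(G)) = p$ and $p\in\{2,3\}$; (ii) a finitely generated group $G$ such that $\exp(G/Z(G)) = 6$; (iii) an odd $p$-group (that is, a $p$-group with $p$ an odd prime) with an abelian Frattini subgroup; (iv) a $p$-group $G$ such that the commutator subgroup of $G$ is cyclic. That is, $\exp(H_2(G,\mathbb{Z}))$ divides $\exp(G)$ for the groups $G$ in these classes.
   Context: $Z(G)$ is the center of $G$, the commutator subgroup of $G$ is $G'=[G,G]$, the Frattini subgroup of $G$ is the intersection of its maximal subgroups, $\exp(X)$ is the exponent of the group $X$ (the least positive integer $n$ with $x^n=1$ for all $x\in X$), and $H_2(G,\mathbb{Z})$ is the second homology group of $G$ with integral coefficients (the Schur multiplier). Schur's exponent conjecture is stated for finite groups. *)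

(* Defs.v *)
From HB Require Import structures.
From mathcomp Require Import all_boot all_order all_algebra.
From mathcomp Require Import all_fingroup all_solvable.
From mathcomp Require Import ssrAC generic_quotient ring_quotient.
From mathcomp Require Import boolp.
From mathcomp.multinomials Require Import freeg.

Set Implicit Arguments.
Unset Strict Implicit.
Unset Printing Implicit Defensive.

Import GRing.Theory.

(* The least positive n such that P n, or 0 if there is none: the value 0
   stands for an infinite exponent, which is consistent with divisibility
   since every natural number divides 0. *)
Definition least_pos (P : nat -> Prop) : nat :=
  if pselect (exists n, (0 < n)%N && `[< P n >]) is left exP
  then ex_minn exP else 0%N.

Definition group_exp (G : groupType) : nat :=
  least_pos (fun n => forall x : G, (x ^+ n = 1)%g).

Definition zmod_exp (A : zmodType) : nat :=
  least_pos (fun n => forall a : A, (a *+ n = 0)%R).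

Definition finitely_generated (G : groupType) : Prop :=
  exists s : seq G, forall S : {pred G},
    group_closed S -> {subset s <= S} -> forall x, x \in S.

(* The quotient G / Z(G) of a possibly infinite group; the notations 'Z(_) and
   _ / _ of MathComp are restricted to subgroups of a finGroupType. *)
Section CentralQuotient.
Local Open Scope group_scope.
Local Open Scope quotient_scope.
Variable G : groupType.
Implicit Types x y z : G.

Definition centerg : pred G := [pred z | `[< forall x, commute z x >]].

Lemma centergP z : reflect (forall x, z * x = x * z) (z \in centerg).
Proof. by rewrite inE; apply: asboolP. Qed.

Lemma centerg_closed : group_closed centerg.
Proof.
split=> [|u v /centergP Zu /centergP Zv]; apply/centergP=> x.
  by rewrite mul1g mulg1.
have Zv' : v^-1 * x = x * v^-1.
  by apply: (mulgI v); rewrite mulKVg mulgA Zv mulgK.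
by rewrite -mulgA Zv' !mulgA Zu.
Qed.

Definition centerg_equiv x y := x^-1 * y \in centerg.

Lemma centerg_equiv_class : equiv_class_of centerg_equiv.
Proof.
have [Z1 ZF] := centerg_closed; rewrite /centerg_equiv.
have ZV := group_closedV centerg_closed.
have ZM := group_closedM centerg_closed.
split=> [x|x y|y x z].
- by rewrite mulVg.
- by apply/idP/idP=> /ZV; rewrite invgM invgK.
- by move=> Zxy Zyz; rewrite -[z](mulKVg y) mulgA ZM.
Qed.

Canonical centerg_equiv_rel := EquivRelPack centerg_equiv_class.
Canonical centerg_encModRel := defaultEncModRel centerg_equiv.

Definition central_quot := {eq_quot centerg_equiv}.

HB.instance Definition _ : EqQuotient G centerg_equiv central_quot :=
  EqQuotient.on central_quot.
HB.instance Definition _ := Choice.on central_quot.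

Definition cq_one : central_quot := lift_cst central_quot 1.
Definition cq_inv := lift_op1 central_quot (fun x => x^-1).
Definition cq_mul := lift_op2 central_quot (fun x y => x * y).

Canonical pi_cq_one := PiConst cq_one.

Lemma centerg_eqE x y : (x == y %[mod central_quot]) = (x^-1 * y \in centerg).
Proof. by rewrite piE. Qed.

Lemma pi_cq_mul : {morph \pi_central_quot : x y / x * y >-> cq_mul x y}.
Proof.
move=> x y; unlock cq_mul; apply/eqP; rewrite centerg_eqE /=.
have: x^-1 * repr (\pi_central_quot x) \in centerg by rewrite -centerg_eqE reprK.
have: y^-1 * repr (\pi_central_quot y) \in centerg by rewrite -centerg_eqE reprK.
set y' := repr _; set x' := repr _ => Zy Zx.
have -> : (x * y)^-1 * (x' * y') = (x^-1 * x') * (y^-1 * y').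
  rewrite invgM !mulgA; have /centergP Zx' := Zx.
  by rewrite -[_ * x']mulgA -Zx' -!mulgA.
exact: (group_closedM centerg_closed).
Qed.
Canonical pi_cq_mul_morph := PiMorph2 pi_cq_mul.

Lemma pi_cq_inv : {morph \pi_central_quot : x / x^-1 >-> cq_inv x}.
Proof.
move=> x; unlock cq_inv; apply/eqP; rewrite centerg_eqE /=.
have: x^-1 * repr (\pi_central_quot x) \in centerg by rewrite -centerg_eqE reprK.
set x' := repr _ => Zx; have /centergP Zx' := Zx.
have -> : x^-1^-1 * x'^-1 = (x^-1 * x')^-1.
  apply: (mulIg (x^-1 * x')); rewrite mulVg invgK -mulgA -Zx'.
  by rewrite mulgK mulgV.
exact: (group_closedV centerg_closed).
Qed.
Canonical pi_cq_inv_morph := PiMorph1 pi_cq_inv.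

Lemma cq_mulA : associative cq_mul.
Proof. by move=> x y z; rewrite -[x]reprK -[y]reprK -[z]reprK !piE mulgA. Qed.

Lemma cq_mul1 : left_id cq_one cq_mul.
Proof. by move=> x; rewrite -[x]reprK !piE mul1g. Qed.

Lemma cq_mulr1 : right_id cq_one cq_mul.
Proof. by move=> x; rewrite -[x]reprK !piE mulg1. Qed.

Lemma cq_mulV : left_inverse cq_one cq_inv cq_mul.
Proof. by move=> x; rewrite -[x]reprK !piE mulVg. Qed.

Lemma cq_mulrV : right_inverse cq_one cq_inv cq_mul.
Proof. by move=> x; rewrite -[x]reprK !piE mulgV. Qed.

HB.instance Definition _ :=
  isGroup.Build central_quot cq_mulA cq_mul1 cq_mulr1 cq_mulV cq_mulrV.

End CentralQuotient.

(* H_2(G, Z) is the degree 2 homology of the (inhomogeneous, unnormalised) bar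
   complex of G with trivial coefficients Z,
     ... -> Z[G^3] -> Z[G^2] -> Z[G] -> ...
     d3 [g|h|k] = [h|k] - [gh|k] + [g|hk] - [g|h],
     d2 [g|h]   = [h] - [gh] + [g]. *)
Section SecondHomology.
Local Open Scope ring_scope.
Variable G : groupType.

Definition bar2 (u : G * G) : {freeg G} :=
  let: (g, h) := u in << h >> - << (g * h)%g >> + << g >>.

Definition bar3 (u : G * G * G) : {freeg (G * G)} :=
  let: (g, h, k) := u in
  << (h, k) >> - << ((g * h)%g, k) >> + << (g, (h * k)%g) >> - << (g, h) >>.

Definition d2 : {freeg (G * G)} -> {freeg G} := fglift bar2.
Definition d3 : {freeg (G * G * G)} -> {freeg (G * G)} := fglift bar3.

Lemma d2_is_zmod_morphism : zmod_morphism d2.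
Proof. exact: lift_is_additive. Qed.
HB.instance Definition _ := GRing.isZmodMorphism.Build
  {freeg (G * G)} {freeg G} d2 d2_is_zmod_morphism.

Lemma d3_is_zmod_morphism : zmod_morphism d3.
Proof. exact: lift_is_additive. Qed.
HB.instance Definition _ := GRing.isZmodMorphism.Build
  {freeg (G * G * G)} {freeg (G * G)} d3 d3_is_zmod_morphism.

Lemma d2U k u : d2 << k *g u >> = k *: bar2 u.
Proof. exact: liftU. Qed.

Lemma d3U k u : d3 << k *g u >> = k *: bar3 u.
Proof. exact: liftU. Qed.

Lemma d2_d3 w : d2 (d3 w) = 0.
Proof.
rewrite -[w]freeg_sumE !raddf_sum big1 // => -[[g h] k] _ /=.
rewrite d3U -[coeff _ _]intz scaler_int raddfMz /=.
rewrite /bar3 raddfB raddfD raddfB /= !d2U !scale1r /= mulgA.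
move: << k >> << (h * k)%g >> << (g * h * k)%g >> << (g * h)%g >> << h >> << g >>.
move=> a b c d e f; rewrite [X in X *~ _](_ : _ = 0) ?mul0rz //.
rewrite ?opprD ?opprB ?opprK ?addrA.
by rewrite (ACl ((1*4)*(7*2)*(3*10)*(5*8)*(11*6)*(9*12))%AC) /= !subrr !addr0.
Qed.

Definition cycle2 : {pred {freeg (G * G)}} := [pred z | d2 z == 0].

Lemma cycle2_closed : zmod_closed cycle2.
Proof.
split=> [|x y]; rewrite !inE ?raddf0 //.
by move=> /eqP x0 /eqP y0; rewrite raddfB /= x0 y0 subrr.
Qed.

HB.instance Definition _ :=
  GRing.isZmodClosed.Build {freeg (G * G)} cycle2 cycle2_closed.

Record Z2 := MkZ2 { z2val :> {freeg (G * G)}; _ : z2val \in cycle2 }.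

HB.instance Definition _ := [isSub for z2val].
HB.instance Definition _ := [Choice of Z2 by <:].
HB.instance Definition _ := [SubChoice_isSubZmodule of Z2 by <:].

Definition B2 : {pred Z2} := [pred z | `[< exists w, z2val z = d3 w >]].

Lemma B2_closed : zmod_closed B2.
Proof.
split=> [|x y]; rewrite !inE.
  by apply/asboolP; exists 0; rewrite raddf0.
move=> /asboolP[u xu] /asboolP[v yv]; apply/asboolP; exists (u - v).
by rewrite raddfB /= -xu -yv.
Qed.

HB.instance Definition _ := GRing.isZmodClosed.Build Z2 B2 B2_closed.

Definition H2 : zmodType := Quotient.quot B2.

End SecondHomology.

(* Main.v *)
(** Let A = C_2/B_2 in the bar complex of G. The symbols [g|h] form a 2-cocycle
with values in A, hence a central extension E of G by A, and a cycle z of C_2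
lies in [E, E] (its image in the abelianisation of E factors through d_2 z).
If n = exp G then x^n is central in E for every x, and it suffices to show that
every element of [E, E] has order dividing n.

(i) If G/Z(G) has exponent 2 or 3, then [E, E] has class at most 2; expanding
(x [x, y])^n = (x^n)^y = x^n gives [x, y]^n up to terms [x, y, x] and
[x, y, x, x] of order dividing the small prime, which vanish for divisibility
reasons, or after replacing x and y by their parts of prime order.

(ii) Groups of exponent 6 are locally finite (M. Hall), so G is finite, and
transfer to the preimages in E of the Sylow subgroups reduces the claim to (i).

(iii) Write n = p m and S_r = [x^r, y]. In the module Phi(G) the sum of the S_r
over r < p is killed by m, because m times the norm of y kills Phi(G) and
(x^b y)^n = 1 for all b. In E, conjugation by x maps the product of the S_r to
itself times [x, y]^-p up to factors of m-th power 1 and central commutators;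
comparing the ascending and the descending product gives [x, y]^n = 1.

(iv) The group [E, E] is abelian, and with c = [x, y] and d = [c, x] one has
d^x = d^l, l = 1 mod p, and 1 = [x^n, y] = c^n d^D with D the sum of
1 + l + ... + l^(i-1) over i < n. For odd p, n divides D. For p = 2, D is n/2
times an odd number, and one compares the pairs (x, y), (y, x) and (xy, x). *)

Require Import Defs.
From HB Require Import structures.
From mathcomp Require Import all_boot all_order all_algebra.
From mathcomp Require Import all_fingroup all_solvable.
From mathcomp Require Import zify.
From mathcomp Require Import ssrAC generic_quotient ring_quotient boolp.
From mathcomp.multinomials Require Import freeg.

Set Implicit Arguments.
Unset Strict Implicit.
Unset Printing Implicit Defensive.

Local Open Scope group_scope.

(** * Words and commutators *)

Section Words.
Variable G : groupType.
Implicit Types a b u v x y z : G.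

(** All bounds on [[E, E]] are deduced from a morphism [f : E -> G] with central kernel and from the
    exponent of [G]. Elements with central image in [G] lie in the second centre of [E], hence
    commute with [[E, E]]; this is the source of the class bounds in (i). The passage to parts of
    order [p] there is forced by binomial coefficients: if [p] divides [n], then ['C(n, p)] is prime
    to [p] exactly when [p ^ 2] does not divide [n], and in that case Bezout splits off the part of
    order [p]. Local finiteness in exponent 6 rests on one fact about involutions: that a product
    has order dividing 3 is a transitive relation. It comes from the plane triangle group of type
    (3,3,3), whose translations commute. In (iii) the obstacle is that a product of commutators in
    [E] depends on the order of its factors. One order leaves an undetermined central factor;
    together with the reversed order it yields only the square of the claim, and the oddness of [p]
    removes the square. *)

Lemma expg3E x : x ^+ 3 = x * x * x.
Proof. by rewrite !expgS expg0 mulg1 mulgA. Qed.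

Lemma sqrg_inv x : x ^+ 2 = 1 -> x^-1 = x.
Proof. by rewrite expg2 => /mulg1_eq. Qed.

Lemma cube_sqr x : x ^+ 3 = 1 -> x * x = x^-1.
Proof. by rewrite expg3E => x3; rewrite -[LHS](mulgK x) x3 mul1g. Qed.

Lemma cube_sqrA x t : x ^+ 3 = 1 -> t * x * x = t * x^-1.
Proof. by move/cube_sqr <-; rewrite mulgA. Qed.

Lemma conjg_exp1 x y n : ((x ^ y) ^+ n == 1) = (x ^+ n == 1).
Proof. by rewrite -conjXg conjg_eq1. Qed.

Lemma expgC_eq1 x y n : ((x * y) ^+ n == 1) = ((y * x) ^+ n == 1).
Proof. by rewrite -(conjg_exp1 (x * y) x) /conjg !mulgA mulVg mul1g. Qed.

Lemma expgC1 x y n : (x * y) ^+ n = 1 -> (y * x) ^+ n = 1.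
Proof. by move/eqP; rewrite expgC_eq1 => /eqP. Qed.

Lemma expgJ1 x y n : x ^+ n = 1 -> (x ^ y) ^+ n = 1.
Proof. by move=> xn; rewrite -conjXg xn conj1g. Qed.

Lemma expgV1 x n : x ^+ n = 1 -> x^-1 ^+ n = 1.
Proof. by move=> xn; rewrite expVgn xn invg1. Qed.

Lemma commute_J x y z : commute x y -> commute (x ^ z) (y ^ z).
Proof. by rewrite /commute => e; rewrite -!conjMg e. Qed.

(* The four cubes [u^3], [v^3], [(uv)^3], [(u v^-1)^3] present the free group of exponent 3 on
  [u], [v]. *)
Lemma cubes_commuteJ u v : u ^+ 3 = 1 -> v ^+ 3 = 1 ->
  (u * v) ^+ 3 = 1 -> (u * v^-1) ^+ 3 = 1 -> commute u (u ^ v).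
Proof.
move=> u3 v3 uv3 uV3; have [uu vv] := (cube_sqr u3, cube_sqr v3).
have uvu : u * v * u = v^-1 * u^-1 * v^-1.
  apply: (mulIg (v * u * v)); rewrite !gnorm.
  by move: uv3; rewrite expg3E !mulgA.
have vuv : v^-1 * u * v^-1 = u^-1 * v * u^-1.
  apply: (mulgI u); apply: (mulIg (u * v^-1)); rewrite !gnorm.
  by move: uV3; rewrite expg3E !mulgA.
rewrite /commute /conjg.
have -> : u * (v^-1 * (u * v)) = u * (v^-1 * u * v^-1) * (v * v).
  by rewrite !gnorm.
rewrite vuv vv !gnorm.
have -> : v^-1 * u * v * u = v^-1 * (u * v * u) by rewrite !mulgA.
by rewrite uvu !mulgA -invgM vv invgK.
Qed.

Lemma cubes_commuteRl u v : u ^+ 3 = 1 -> v ^+ 3 = 1 ->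
  (u * v) ^+ 3 = 1 -> (u * v^-1) ^+ 3 = 1 -> commute u [~ u, v].
Proof.
move=> u3 v3 uv3 uV3; rewrite commgEl; apply: commuteM.
  exact/commuteV/commute_refl.
exact: cubes_commuteJ.
Qed.

Lemma cubes_commuteRr u v : u ^+ 3 = 1 -> v ^+ 3 = 1 ->
  (u * v) ^+ 3 = 1 -> (u * v^-1) ^+ 3 = 1 -> commute v [~ u, v].
Proof.
move=> u3 v3 uv3 uV3; rewrite -invgR; apply: commuteV.
apply: cubes_commuteRl => //; first exact: expgC1.
by rewrite -[v * u^-1]invgK invgF expgV1.
Qed.
End Words.

(** * Relations of the (3,3,3) triangle group *)

Section Triangle.
Variable G : groupType.
Implicit Types p q z : G.

(** If [p] and [q] are rotations generating the Euclidean (3,3,3) group, [p * q^-1] and [p^-1 * q]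
    are translations and commute. Here [(p * q) ^+ 3] need only commute with [p], and it measures
    the failure. *)
Lemma triangle_swap p q : p ^+ 3 = 1 -> q ^+ 3 = 1 -> commute ((p * q) ^+ 3) p ->
  p^-1 * q * (p * q^-1) = (p * q) ^+ 3 * (p * q^-1 * (p^-1 * q)).
Proof.
move=> p3 q3 zp; rewrite -[q^-1 in LHS](cube_sqr q3) -[p^-1 in LHS](cube_sqr p3).
rewrite -!(mulgA p q^-1) !(mulgA (_ ^+ 3)) zp expg3E !gnorm.
by [].
Qed.

(** The translation [X = p * q^-1] and its conjugates by [q] and [q * q] have product 1, and the
    hypothesis on [p * q^-1 * (p^-1 * q)] makes [X ^+ 3] invariant under [q]. Hence [X ^+ 9 = 1],
    and [X ^+ 6 = 1] leaves [X ^+ 3 = 1]. *)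
Lemma triangle_cube p q : p ^+ 3 = 1 -> q ^+ 3 = 1 -> (p * q) ^+ 3 = 1 ->
  (p * q^-1 * (p^-1 * q)) ^+ 3 = 1 -> (p * q^-1) ^+ 6 = 1 -> (p * q^-1) ^+ 3 = 1.
Proof.
move=> p3 q3 pq3 XY3 X6.
have := triangle_swap p3 q3; rewrite pq3 => /(_ (commute_sym (commute1 p))).
rewrite mul1g => cYX; set X := p * q^-1 in XY3 X6 cYX *.
have XqE : X ^ q = (p^-1 * q)^-1 by rewrite /X /conjg !gnorm.
have pqE : p * q = X * q^-1 by rewrite /X -!mulgA -invgM cube_sqr // invgK.
have Xe : X = p * q^-1 by []. clearbody X.
have cXXq : commute X (X ^ q) by rewrite XqE; apply: commuteV.
have X3q : X ^+ 3 = (X ^+ 3) ^ q.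
  rewrite conjXg XqE expVgn; apply: (mulIg ((p^-1 * q) ^+ 3)).
  by rewrite -expgMn // XY3 mulVg.
have prodX : X * X ^ q * X ^ (q * q) = 1.
  rewrite -pq3 pqE (cube_sqr q3) expg3E /conjg !gnorm.
  by rewrite (cube_sqrA _ q3).
have X9 : X ^+ 9 = 1.
  have E : (X ^ (q * q)) ^+ 3 = X ^+ 3 by rewrite -conjXg conjgM -!X3q.
  have := congr1 (fun t => t ^+ 3) prodX; rewrite expg1n => <-.
  rewrite [RHS]expgMn; last first.
    have X3 : X ^ (q * q) = (X * X ^ q)^-1.
      by apply: (mulgI (X * X ^ q)); rewrite mulgV.
    by rewrite X3; apply/commuteV/commute_refl.
  by rewrite (@expgMn _ X) // E -(conjXg X) -X3q -!expgnDr.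
by move: X9; rewrite -[9]/(6 + 3)%N expgnDr X6 mul1g.
Qed.

(* Here (pq)^3 = z is a central involution. *)
Lemma triangle_center p q z : p ^+ 3 = 1 -> q ^+ 3 = 1 -> (p * q) ^+ 3 = z ->
  commute z p -> commute z q -> z ^+ 2 = 1 ->
  (p * q^-1 * (p^-1 * q)) ^+ 3 = 1 -> z = 1.
Proof.
move=> p3 q3 pq3 zp zq z2 XY3; have zz : z * z = 1 by rewrite -expg2.
have := triangle_swap p3 q3; rewrite pq3 => /(_ zp).
have zX : commute z (p * q^-1) by apply: commuteM => //; apply: commuteV.
have zY : commute z (p^-1 * q) by apply: commuteM => //; apply: commuteV.
move: XY3 zX zY; move: (p * q^-1) (p^-1 * q) => X Y XY3 zX zY YX.
have Xz t : t * X * z = t * z * X by rewrite -mulgA -zX mulgA.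
have Yz t : t * Y * z = t * z * Y by rewrite -mulgA -zY mulgA.
have zl := (Xz, Yz, esym zX, esym zY); have zzl t : t * z * z = t.
  by rewrite -mulgA zz mulg1.
have YXl t : t * Y * X = t * z * X * Y by rewrite -mulgA YX !mulgA.
(* Three interchanges [Y * X = z * (X * Y)] give the factor [z ^+ 3 = z]. It follows that [Y ^+ 3]
   commutes with [X], although moving [X] across [Y ^+ 3] again costs [z ^+ 3 = z]. *)
have E : (X * Y) ^+ 3 = z * (X ^+ 3 * Y ^+ 3).
  by rewrite !expg3E !mulgA !YXl !zl !YXl !zl zz mul1g.
move: XY3; rewrite E => E1.
have Y3 : Y ^+ 3 = X ^- 3 * z^-1.
  by apply: (mulgI (z * X ^+ 3)); rewrite -mulgA E1 mulgA mulgK mulgV.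
have cXY3 : commute X (Y ^+ 3).
  rewrite Y3; apply: commuteM; apply: commuteV; last exact: commute_sym.
  exact/commuteX/commute_refl.
have : Y ^+ 3 * X = z * (X * Y ^+ 3).
  by rewrite expg3E !mulgA YXl !zl YXl !zl zz mul1g YX !mulgA.
by rewrite -cXY3 -[LHS]mul1g => /mulIg.
Qed.
End Triangle.

(** * Involutions in groups of exponent six *)

Section Exp6.
Variable G : groupType.
Hypothesis exp6 : forall x : G, x ^+ 6 = 1.
Implicit Types a b c e f u v x y z : G.

Lemma expg6E x : x ^+ 6 = (x ^+ 2) ^+ 3.
Proof. by rewrite -expgnA. Qed.

Lemma exp6_sqr x : (x ^+ 2) ^+ 3 = 1. Proof. by rewrite -expg6E. Qed.

Lemma mulgg_inv x y : x ^+ 2 = 1 -> y * x * x = y.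
Proof. by rewrite expg2 -mulgA => ->; rewrite mulg1. Qed.

Lemma inv_braid x y : x ^+ 2 = 1 -> y ^+ 2 = 1 -> (x * y) ^+ 3 = 1 -> x ^ y = y ^ x.
Proof.
move=> x2 y2 xy3; have xV := sqrg_inv x2; have yV := sqrg_inv y2.
by apply: (mulIg (x ^ y)^-1); rewrite mulgV -xy3 /conjg expg3E !gnorm xV yV.
Qed.

(** Think of reflections in the sides of an equilateral triangle. For the rotations [p = a * b] and
    [q = b * e], the translation [p * q^-1] is [a * e ^ b], and [p * q^-1 * (p^-1 * q)] is the
    square of the glide reflection [a * b * e], so exponent 6 kills its cube. *)
Lemma inv_plane_cube a b e : a ^+ 2 = 1 -> b ^+ 2 = 1 -> e ^+ 2 = 1 ->
  (a * b) ^+ 3 = 1 -> (b * e) ^+ 3 = 1 -> (a * e) ^+ 3 = 1 ->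
  (a * e ^ b) ^+ 3 = 1.
Proof.
move=> a2 b2 e2 ab3 be3 ae3.
have aV := sqrg_inv a2; have bV := sqrg_inv b2; have eV := sqrg_inv e2.
have -> : a * e ^ b = a * b * (b * e)^-1 by rewrite /conjg !gnorm bV eV.
apply: triangle_cube => //; first by rewrite !gnorm mulgg_inv.
have -> : a * b * (b * e)^-1 * ((a * b)^-1 * (b * e)) = (a * b * e) ^+ 2.
  by rewrite expg2 !gnorm aV bV eV !(mulgg_inv _ b2).
exact: exp6_sqr.
Qed.

(** The obstruction [z = (a * c) ^+ 3] commutes with [a] and [c]. The involution [b] is replaced by
    [f = (b ^ z) ^ b], whose products with [a] and [c] still have cube 1 and which also commutes
    with [z]; then [triangle_center] applies. *)
Lemma inv_cube_trans a b c : a ^+ 2 = 1 -> b ^+ 2 = 1 -> c ^+ 2 = 1 ->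
  (a * b) ^+ 3 = 1 -> (b * c) ^+ 3 = 1 -> (a * c) ^+ 3 = 1.
Proof.
move=> a2 b2 c2 ab3 bc3.
have aV := sqrg_inv a2; have bV := sqrg_inv b2; have cV := sqrg_inv c2.
have [z zE] : exists z, z = (a * c) ^+ 3 by eexists.
have acz : commute (a * c) z by rewrite zE; apply/commuteX/commute_refl.
have z2 : z ^+ 2 = 1 by rewrite zE -expgnA.
have zV := sqrg_inv z2.
have za : commute z a.
  apply/commgP/conjg_fixP; rewrite {1}zE conjXg.
  have -> : (a * c) ^ a = (a * c)^-1 by rewrite /conjg !gnorm aV cV.
  by rewrite expVgn -zE zV.
have zc : commute z c.
  have -> : c = a * (a * c) by rewrite mulgA -expg2 a2 mul1g.
  by apply: commuteM => //; apply: commute_sym.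
set e := b ^ z; set f := e ^ b.
have e2 : e ^+ 2 = 1 by apply: expgJ1.
have f2 : f ^+ 2 = 1 by apply: expgJ1.
have fV := sqrg_inv f2.
have be3 : (b * e) ^+ 3 = 1.
  have -> : b * e = (b * z) ^+ 2 by rewrite /e /conjg zV expg2 !mulgA.
  exact: exp6_sqr.
have fix_z x : commute z x -> x ^ z = x by move=> /commute_sym/commgP/conjg_fixP.
have ae3 : (a * e) ^+ 3 = 1 by rewrite -{1}(fix_z a za) -conjMg expgJ1.
have ec3 : (e * c) ^+ 3 = 1 by rewrite -{1}(fix_z c zc) -conjMg expgJ1.
have fa3 : (f * a) ^+ 3 = 1 by apply/expgC1/inv_plane_cube.
have fc3 : (f * c) ^+ 3 = 1.
  by apply/expgC1/inv_plane_cube => //; apply: expgC1.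
(* [z] interchanges [b] and [e], and the braid relation gives [e ^ b = b ^ e]. *)
have fz : commute z f.
  apply/commute_sym/commgP/conjg_fixP; rewrite /f conjJg.
  have -> : e ^ z = b by rewrite /e -conjgM -expg2 z2 conjg1.
  exact: inv_braid.
clearbody f e; have z3 : z ^+ 3 = z by rewrite (expgnDr z 2 1) z2 mul1g.
have zcz : commute z (c * z) by apply: commuteM.
have zfa : commute z (f * a) by apply: commuteM.
have zacz : commute z (a * (c * z)) by apply: commuteM.
(* The extra [z] in the second generator makes its cube [(a * c) ^+ 3 * z ^+ 3 = 1] and moves the
   obstruction to the product [f * (c * z)], whose cube is [z]. *)
rewrite -zE; apply: (@triangle_center _ (f * a) (a * (c * z)) z) => //.
- by rewrite mulgA expgMn // z3 -zE -expg2.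
- rewrite !mulgA (mulgg_inv _ a2) expgMn ?fc3 ?mul1g //.
  by apply/commute_sym/commuteM.
have -> : f * a * (a * (c * z))^-1 * ((f * a)^-1 * (a * (c * z))) = (f * a * (c * z)) ^+ 2.
  have cz2 : (c * z)^-1 = c * z by rewrite invgM zV cV zc.
  move: (c * z) cz2 {zcz zacz} => d dV.
  by rewrite expg2 !invgM dV fV aV !mulgA (mulgg_inv _ a2).
exact: exp6_sqr.
Qed.
End Exp6.

Section Commutators.
Variable G : groupType.
Implicit Types a b c s t u v x y z : G.

Lemma commuteR x y z : commute x y -> commute x z -> commute x [~ y, z].
Proof.
by move=> xy xz; do !apply: commuteM => //; apply: commuteV.
Qed.

Lemma commuteJ x y z : commute x y -> commute x z -> commute x (y ^ z).
Proof. by move=> xy xz; do !apply: commuteM => //; apply: commuteV. Qed.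

Lemma conjg_id x y : commute x y -> x ^ y = x.
Proof. by move=> /commgP/conjg_fixP. Qed.

Lemma commg_mulR x y z : [~ x, y * z] = [~ x, z] * [~ x, y] ^ z.
Proof. by rewrite /commg /conjg !gnorm. Qed.

Lemma commg_mulL x y z : [~ x * y, z] = [~ x, z] ^ y * [~ y, z].
Proof. by rewrite /commg /conjg !gnorm. Qed.

Lemma conjg_mulR x y : x ^ y = x * [~ x, y].
Proof. by rewrite commgEl mulVKg. Qed.

Lemma commgX x y n : commute x [~ x, y] -> [~ x ^+ n, y] = [~ x, y] ^+ n.
Proof.
by move=> cx; rewrite commgEl conjXg conjg_mulR expgMn // mulKg.
Qed.

Lemma commg_cube x y : x ^+ 3 = 1 -> commute x [~ x, y] -> [~ x, y] ^+ 3 = 1.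
Proof. by move=> x3 cx; rewrite -commgX // x3 comm1g. Qed.

Lemma commVg x y : commute x [~ x, y] -> [~ x^-1, y] = [~ x, y]^-1.
Proof.
move=> cx; rewrite commgEl invgK conjVg conjg_mulR invgM mulgA.
by rewrite (commuteV cx) mulgK.
Qed.

Lemma commg_eq1 x y : commute x y -> [~ x, y] = 1.
Proof. by move=> /commgP/eqP. Qed.

Lemma commuteA x y t : commute x y -> t * x * y = t * y * x.
Proof. by move=> xy; rewrite -mulgA xy mulgA. Qed.

Lemma commute_R x y t : commute t x -> commute [~ t, y] x -> commute [~ t, y] y ->
  commute t [~ x, y].
Proof.
move=> tx Ax Ay; apply: commuteM; first exact: commuteV.
have := commute_J y tx; rewrite (conjg_mulR t y) => tA.
have Axy : commute (x ^ y) [~ t, y]^-1 by apply/commuteV/commute_sym/commuteJ.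
have := commuteM (commute_sym tA) Axy.
by rewrite mulgK => /commute_sym.
Qed.

Lemma sqr_cube1 x : x ^+ 2 = 1 -> x ^+ 3 = 1 -> x = 1.
Proof. by move=> x2; rewrite (expgnDr x 2 1) x2 mul1g. Qed.

End Commutators.

(** * Vanishing of four-fold commutators of elements of order three *)

Section Class3.
Variables (G : groupType) (S : G -> Prop).
Implicit Types x y z u : G.
Hypothesis S3 : forall x, S x -> x ^+ 3 = 1.
Hypothesis SRl : forall x y, S x -> S y -> commute x [~ x, y].
Hypothesis SRr : forall x y, S x -> S y -> commute y [~ x, y].
Hypothesis Striple : forall x y, S x -> S y -> S (x * y * x).
Hypothesis SR3 : forall x y z, S x -> S y -> S z -> S [~ x, y, z].
Hypothesis SR3x : forall x y z, S x -> S y -> S z -> commute x [~ x, y, z].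
Hypothesis SR3y : forall x y z, S x -> S y -> S z -> commute y [~ x, y, z].
Hypothesis SR3z : forall x y z, S x -> S y -> S z -> commute z [~ x, y, z].

Lemma S_R3u x y z u : S x -> S y -> S z -> S u -> commute u [~ x, y, z, u].
Proof. by move=> Sx Sy Sz Su; apply: SRr => //; apply: SR3. Qed.

(* A member [w] of [S] commuting with [x] also has [[w, u]] commuting with [x]. *)
Lemma S_commR w x u : S w -> S x -> S u -> commute w x -> commute x [~ w, u].
Proof.
move=> Sw Sx Su wx.
have Ss := Striple Sx Su.
have E : [~ w, x * u * x] = [~ w, u] ^ x.
  by rewrite !commg_mulR !(commg_eq1 wx) conj1g mulg1 mul1g.
have := SRr Sw Ss; rewrite E => /(commute_J x^-1); rewrite conjgK.
have -> : (x * u * x) ^ x^-1 = x * x * u by rewrite /conjg !gnorm.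
rewrite (cube_sqr (S3 Sx)) => c1; have c2 := SRr Sw Su.
have: commute [~ w, u] (x^-1 * u * u^-1).
  by apply: commuteM; [apply: commute_sym|apply: commuteV; apply: commute_sym].
by rewrite mulgK => /commuteV; rewrite invgK => /commute_sym.
Qed.

Section Fixed.
Variables x y z u : G.
Hypotheses (Sx : S x) (Sy : S y) (Sz : S z) (Su : S u).

Lemma S_R4x : commute x [~ x, y, z, u].
Proof. by apply: S_commR => //; [exact: SR3|apply/commute_sym/SR3x]. Qed.
Lemma S_R4y : commute y [~ x, y, z, u].
Proof. by apply: S_commR => //; [exact: SR3|apply/commute_sym/SR3y]. Qed.
Lemma S_R4z : commute z [~ x, y, z, u].
Proof. by apply: S_commR => //; [exact: SR3|apply/commute_sym/SR3z]. Qed.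
Lemma S_R4u : commute u [~ x, y, z, u].
Proof. exact: S_R3u. Qed.
Lemma S_R4_cube : [~ x, y, z, u] ^+ 3 = 1.
Proof.
by apply: commg_cube; [exact/S3/SR3|apply: SRl => //; apply: SR3].
Qed.
End Fixed.

Lemma S_R3_swapl x y z : S x -> S y -> S z -> [~ y, x, z] = [~ x, y, z]^-1.
Proof.
move=> Sx Sy Sz; rewrite -[[~ y, x]]invgR; apply: commVg.
by apply/commute_sym/commuteR; apply: commute_sym; [exact: SR3x|exact: SR3y].
Qed.

(** [y * z * y] lies in [S], hence commutes with [[~ x, y * z * y]]. Expanding this commutator shows
    that conjugation by [y * z * y] multiplies it by [([~ x, z, y] * [~ x, y, z]) ^+ 2], which must
    be 1; the product also has cube 1. *)
Lemma S_R3_swapr x y z : S x -> S y -> S z -> [~ x, z, y] = [~ x, y, z]^-1.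
Proof.
move=> Sx Sy Sz; set c := [~ x, y]; set e := [~ x, z].
have Ss := Striple Sy Sz.
have := SRr Sx Ss; set v := [~ x, _] => cv.
have w3 := S3 (SR3 Sx Sy Sz); have w'3 := S3 (SR3 Sx Sz Sy).
have wx := SR3x Sx Sy Sz; have wy := SR3y Sx Sy Sz; have wz := SR3z Sx Sy Sz.
have w'x := SR3x Sx Sz Sy; have w'y := SR3z Sx Sz Sy; have w'z := SR3y Sx Sz Sy.
have cy : commute y c by apply: SRr.
have ez : commute z e by apply: SRr.
have cJz : c ^ z = c * [~ x, y, z] by rewrite conjg_mulR.
have eJy : e ^ y = e * [~ x, z, y] by rewrite conjg_mulR.
have vE : v = c * (e * [~ x, z, y] * (c * [~ x, y, z])).
  rewrite /v !commg_mulR -/c -/e cJz conjMg eJy conjMg.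
  by rewrite (conjg_id (commute_sym cy)) (conjg_id (commute_sym wy)).
have wc : commute [~ x, y, z] c by apply: commuteR; apply: commute_sym.
have w'c : commute [~ x, z, y] c by apply: commuteR; apply: commute_sym.
have we : commute [~ x, y, z] e by apply: commuteR; apply: commute_sym.
have w'e : commute [~ x, z, y] e by apply: commuteR; apply: commute_sym.
have ww' : commute [~ x, y, z] [~ x, z, y].
  by apply: commuteR; apply: commute_sym.
move: w3 w'3 wx wy wz w'x w'y w'z cJz eJy vE wc w'c we w'e ww'.
move: [~ x, y, z] [~ x, z, y] => w w' w3 w'3 wx wy wz w'x w'y w'z cJz eJy vE wc w'c we w'e ww';
  clearbody c e v.
have cJ : c ^ (y * z * y) = c * w.
  by rewrite !conjgM (conjg_id (commute_sym cy)) cJz conjMg (conjg_id (commute_sym cy))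
    (conjg_id (commute_sym wy)).
have eJ : e ^ (y * z * y) = e * w' * w'.
  rewrite !conjgM eJy (conjMg e) (conjg_id (commute_sym ez)) (conjg_id (commute_sym w'z)).
  by rewrite (conjMg e) eJy (conjg_id (commute_sym w'y)).
have wJ : w ^ (y * z * y) = w by rewrite conjg_id //; do !apply: commuteM; apply: commute_sym.
have w'J : w' ^ (y * z * y) = w' by rewrite conjg_id //; do !apply: commuteM; apply: commute_sym.
have : v ^ (y * z * y) = v by rewrite conjg_id //; exact: commute_sym.
rewrite vE !conjMg cJ eJ wJ w'J => /eqP.
have -> : c * w * (e * w' * w' * w' * (c * w * w)) = 
          c * (e * w' * (c * w)) * ((w' * w) ^+ 2).
  have mc t := @commuteA _ w c t wc; have me t := @commuteA _ w e t we.
  have m'c t := @commuteA _ w' c t w'c; have m'e t := @commuteA _ w' e t w'e.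
  have mm t := @commuteA _ w w' t ww'.
  by rewrite expg2 !mulgA !(mc, me, m'c, m'e, mm).
rewrite -[X in _ == X]mulg1 => /eqP/mulgI ww2.
apply/esym/mulg1_eq/sqr_cube1; last by rewrite expgMn ?w3 ?w'3 ?mulg1.
by rewrite ww'.
Qed.
Section FourFold.
Variables x y z u : G.
Hypotheses (Sx : S x) (Sy : S y) (Sz : S z) (Su : S u).

(** The argument of [S_R3_swapr] with [[~ x, y]] in place of [x]; the commutation with [z * u * z]
    now comes from [SR3z]. *)
Lemma S_R4_swapr : [~ x, y, u, z] = [~ x, y, z, u]^-1.
Proof.
have Ss := Striple Sz Su.
have := SR3z Sx Sy Ss.
have A13 := S_R4_cube Sx Sy Sz Su; have A23 := S_R4_cube Sx Sy Su Sz.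
have A1x := S_R4x Sx Sy Sz Su; have A1y := S_R4y Sx Sy Sz Su.
have A1z := S_R4z Sx Sy Sz Su; have A1u := S_R4u Sx Sy Sz Su.
have A2x := S_R4x Sx Sy Su Sz; have A2y := S_R4y Sx Sy Su Sz.
have A2u := S_R4z Sx Sy Su Sz; have A2z := S_R4u Sx Sy Su Sz.
have wzz := SR3z Sx Sy Sz; have wuu := SR3z Sx Sy Su.
have A1wz : commute [~ x, y, z, u] [~ x, y, z].
  by apply: commuteR; [apply: commuteR|]; apply: commute_sym.
have A1wu : commute [~ x, y, z, u] [~ x, y, u].
  by apply: commuteR; [apply: commuteR|]; apply: commute_sym.
have A2wz : commute [~ x, y, u, z] [~ x, y, z].
  by apply: commuteR; [apply: commuteR|]; apply: commute_sym.
have A2wu : commute [~ x, y, u, z] [~ x, y, u].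
  by apply: commuteR; [apply: commuteR|]; apply: commute_sym.
have A12 : commute [~ x, y, z, u] [~ x, y, u, z].
  by apply: commuteR => //; exact: commute_sym.
have wzu := conjg_mulR [~ x, y, z] u; have wuz := conjg_mulR [~ x, y, u] z.
rewrite !commg_mulR; move: {Ss} A13 A23 A1x A1y A1z A1u A2x A2y A2u A2z wzz wuu A1wz A1wu A2wz
  A2wu A12 wzu wuz.
move: [~ x, y, z, u] [~ x, y, u, z] => A1 A2; move: [~ x, y, z] [~ x, y, u] => wz wu.
move=> A13 A23 A1x A1y A1z A1u A2x A2y A2u A2z wzz wuu A1wz A1wu A2wz A2wu A12 wzu wuz.
have wzJ : wz ^ (z * u * z) = wz * A1.
  by rewrite !conjgM (conjg_id (commute_sym wzz)) wzu (conjMg wz) (conjg_id (commute_sym wzz))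
    (conjg_id (commute_sym A1z)).
have wuJ : wu ^ (z * u * z) = wu * A2 * A2.
  by rewrite !conjgM wuz (conjMg wu) (conjg_id (commute_sym wuu)) (conjg_id (commute_sym A2u))
    (conjMg wu) wuz (conjg_id (commute_sym A2z)).
have A1J : A1 ^ (z * u * z) = A1 by rewrite conjg_id //; do !apply: commuteM; apply: commute_sym.
have A2J : A2 ^ (z * u * z) = A2 by rewrite conjg_id //; do !apply: commuteM; apply: commute_sym.
rewrite wzu !(conjMg wu) (conjMg wz) wuz (conjg_id (commute_sym wzz)) (conjg_id (commute_sym
  A1z)).
move=> /commute_sym/conjg_id; rewrite !(conjMg wz) !(conjMg (wu * _)) !(conjMg wu).
rewrite !(conjMg wz) wzJ wuJ A1J A2J => /eqP.
have m t := (@commuteA _ A1 wz t A1wz, @commuteA _ A1 wu t A1wu, @commuteA _ A2 wz t A2wz,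
  @commuteA _ A2 wu t A2wu, @commuteA _ A2 A1 t (commute_sym A12)).
have -> : wz * A1 * (wu * A2 * A2 * A2 * (wz * A1 * A1)) = wz * (wu * A2 * (wz * A1)) * (A1 *
  A2) ^+ 2.
  by rewrite expg2 !mulgA !(m _).
rewrite -[X in _ == X]mulg1 => /eqP/mulgI A2E.
apply/esym/mulg1_eq/sqr_cube1 => //; by rewrite expgMn ?A13 ?A23 ?mulg1.
Qed.

(** Expanding [[~ x, y]] against both sides of [z * u = u * z * [~ z, u]] gives the value
    [A ^+ 2 = A^-1], where [A = [~ x, y, z, u]]. *)
Lemma S_R2R2 : [~ [~ x, y], [~ z, u]] = [~ x, y, z, u]^-1.
Proof.
have A13 := S_R4_cube Sx Sy Sz Su; have A2E := S_R4_swapr.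
have A1x := S_R4x Sx Sy Sz Su; have A1y := S_R4y Sx Sy Sz Su.
have A1z := S_R4z Sx Sy Sz Su; have A1u := S_R4u Sx Sy Sz Su.
have wzx := SR3x Sx Sy Sz; have wzy := SR3y Sx Sy Sz.
have wzz := SR3z Sx Sy Sz; have wuu := SR3z Sx Sy Su.
have wzu := conjg_mulR [~ x, y, z] u; have wuz := conjg_mulR [~ x, y, u] z.
have A1wz : commute [~ x, y, z, u] [~ x, y, z].
  by apply: commuteR; [apply: commuteR|]; apply: commute_sym.
have A1wu : commute [~ x, y, z, u] [~ x, y, u].
  by apply: commuteR; [apply: commuteR|]; apply: commute_sym.
have wze : commute [~ x, y, z] [~ z, u] by apply: commute_R => //; apply: commute_sym.
have wue : commute [~ x, y, u] [~ z, u].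
  rewrite -(invgR u z); apply/commuteV/commute_R; rewrite ?A2E; apply: commute_sym => //;
    exact: commuteV.
have A1e : commute [~ x, y, z, u] [~ z, u] by apply: commuteR; apply: commute_sym.
have wzwu : commute [~ x, y, z] [~ x, y, u].
  by apply: commute_R; [apply: commuteR|apply: commuteR|]; apply: commute_sym.
have E : [~ [~ x, y], z * u] = [~ [~ x, y], u * z * [~ z, u]] by rewrite -commgC.
move: E; rewrite (commg_mulR _ (u * z)) (commg_mulR [~ x, y] z u) (commg_mulR [~ x,
  y] u z) wzu wuz A2E.
have Ae := A1e; move: wze wue Ae wzwu A13 A1wu A1wz.
move: [~ x, y, z, u] => A; move: [~ x, y, z] [~ x, y, u] => wz wu.
move: [~ [~ x, y], [~ z, u]] => ce; move: [~ z, u] => e wze wue Ae wzwu A3 Awu Awz.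
rewrite (conjMg wz) (conjMg wu) (conjg_id wze) (conjg_id wue) (conjg_id (commute_sym (commuteV
  (commute_sym Ae)))).
rewrite !mulgA -wzwu -(mulgA ce) => E.
have cA : commute A (wz * wu) by apply: commuteM.
apply: (mulIg (wz * wu)); rewrite -[LHS](mulgK A^-1) invgK -E -mulgA cube_sqr //.
by apply/esym/commute_sym/commuteV/commute_sym.
Qed.

End FourFold.

(** Each transposition of neighbouring entries inverts the four-fold commutator, so the even
    permutation exchanging [(x, y)] with [(z, u)] fixes it. By [S_R2R2] the same exchange inverts
    it. So its square is 1, as is its cube. *)
Lemma S_R4_1 x y z u : S x -> S y -> S z -> S u -> [~ x, y, z, u] = 1.
Proof.
move=> Sx Sy Sz Su; apply: sqr_cube1; last exact: S_R4_cube.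
have swapl t x1 y1 z1 : S x1 -> S y1 -> S z1 -> S t -> [~ y1, x1, z1, t] = [~ x1, y1, z1, t]^-1.
  by move=> S1 S2 S4 St; rewrite (S_R3_swapl (x := x1)) // commVg //; apply: SRl => //;
    apply: SR3.
have swapm t x1 y1 z1 : S x1 -> S y1 -> S z1 -> S t -> [~ x1, z1, y1, t] = [~ x1, y1, z1, t]^-1.
  by move=> S1 S2 S4 St; rewrite (S_R3_swapr (x := x1) (y := y1)) // commVg //;
    apply: SRl => //; apply: SR3.
have := S_R2R2 Sz Su Sx Sy; rewrite -invgR S_R2R2 // invgK.
rewrite (swapm y z x u) // (@S_R4_swapr z x y u) // (swapl u x z y) //.
rewrite (swapm u x y z) // !invgK.
by rewrite expg2 => {2}->; rewrite mulgV.
Qed.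
End Class3.

Lemma commg_classV (G : groupType) (x y : G) : commute x [~ x, y] -> commute y [~ x, y] ->
  [~ x^-1, y^-1] = [~ x, y].
Proof.
move=> cx cy; have cy' : commute y [~ y, x] by rewrite -invgR; apply: commuteV.
have E : [~ x, y^-1] = [~ x, y]^-1 by rewrite -[LHS]invgR commVg // invgR invgR.
rewrite commVg E ?invgK //; exact: commuteV.
Qed.

(** * Elements of order three inverted by an involution *)

Section Inverted.
Variable G : groupType.
Hypothesis exp6 : forall x : G, x ^+ 6 = 1.
Implicit Types a c s t u v w x y z : G.

Definition inverted a s := s ^+ 3 = 1 /\ s ^ a = s^-1.

Lemma inverted_sqr a s : a ^+ 2 = 1 -> inverted a s -> (a * s) ^+ 2 = 1.
Proof.
move=> a2 [s3 sa]; rewrite expg2.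
have -> : a * s * (a * s) = s ^ a * s by rewrite /conjg (sqrg_inv a2) !mulgA.
by rewrite sa mulVg.
Qed.

Lemma invertedV a s : inverted a s -> inverted a s^-1.
Proof. by case=> s3 sa; split; [exact: expgV1|rewrite conjVg sa]. Qed.

Lemma inverted_fixJ a c s : commute c a -> inverted a s -> inverted a (s ^ c).
Proof.
move=> ca [s3 sa]; split; first exact: expgJ1.
by rewrite -conjgM ca conjgM sa conjVg.
Qed.

(** [s * t] is the product of the involutions [s * a] and [a * t], which are linked through [a] by
    [inv_cube_trans]. *)
Lemma inverted_mul3 a s t : a ^+ 2 = 1 -> inverted a s -> inverted a t ->
  (s * t) ^+ 3 = 1.
Proof.
move=> a2 Ss St; have [s3 _] := Ss; have [t3 _] := St.
have -> : s * t = s * a * (a * t) by rewrite !mulgA (mulgg_inv _ a2).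
apply: (@inv_cube_trans _ exp6 _ a) => //.
- have : (a * s) ^+ 2 = 1 by exact: inverted_sqr.
  exact: expgC1.
- exact: inverted_sqr.
- by rewrite (mulgg_inv _ a2).
- by rewrite mulgA -expg2 a2 mul1g.
Qed.

Lemma inverted_triple a s t : a ^+ 2 = 1 -> inverted a s -> inverted a t ->
  inverted a (s * t * s).
Proof.
move=> a2 Ss St; have [[s3 sa] [t3 ta]] := (Ss, St); split; last first.
  by rewrite !conjMg sa ta !invgM mulgA.
apply: expgC1; rewrite !mulgA cube_sqr //.
by apply: inverted_mul3 a2 _ St; exact: invertedV.
Qed.

Lemma inverted_commRl a s t : a ^+ 2 = 1 -> inverted a s -> inverted a t ->
  commute s [~ s, t].
Proof.
move=> a2 Ss St; have [[s3 sa] [t3 ta]] := (Ss, St).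
apply: cubes_commuteRl => //; first exact: inverted_mul3 St.
by apply: (inverted_mul3 a2) => //; exact: invertedV.
Qed.

Lemma inverted_commRr a s t : a ^+ 2 = 1 -> inverted a s -> inverted a t ->
  commute t [~ s, t].
Proof.
by move=> a2 Ss St; rewrite -invgR; apply/commuteV/(inverted_commRl a2).
Qed.

Section FixedElement.
Variables a c z : G.
Hypotheses (a2 : a ^+ 2 = 1) (c3 : c ^+ 3 = 1) (ca : commute c a) (Sz : inverted a z).
Let w := [~ c, z].
Let k := [~ w, z].
Let l := [~ c, w].

Lemma fixed_wE : w = (z ^ c)^-1 * z.
Proof. by rewrite /w commgEr conjVg. Qed.

Lemma fixed_w3 : w ^+ 3 = 1.
Proof.
rewrite fixed_wE; apply: (inverted_mul3 a2) => //.
exact/invertedV/inverted_fixJ.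
Qed.

(** [w * z = (z ^ c)^-1 * z^-1] is a product of two elements inverted by [a], and
    [w * z^-1 = (z ^ c)^-1]; so the four cubes needed for [w] and [z] are trivial. *)
Lemma fixed_kw : commute w k.
Proof.
have Szc := inverted_fixJ ca Sz; have [z3 _] := Sz.
apply: cubes_commuteRl => //; first exact: fixed_w3.
  rewrite fixed_wE -mulgA cube_sqr //.
  by apply: (inverted_mul3 a2); exact: invertedV.
by rewrite fixed_wE mulgK; case: (invertedV Szc).
Qed.

Lemma fixed_kz : commute z k.
Proof.
have Szc := inverted_fixJ ca Sz; have [z3 _] := Sz.
apply: cubes_commuteRr => //; first exact: fixed_w3.
  rewrite fixed_wE -mulgA cube_sqr //.
  by apply: (inverted_mul3 a2); exact: invertedV.
by rewrite fixed_wE mulgK; case: (invertedV Szc).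
Qed.

Lemma fixed_ccz : (c * c ^ z) ^+ 3 = 1.
Proof.
have -> : c ^ z = c ^ (a * z) by rewrite conjgM (conjg_id ca).
have -> : c * c ^ (a * z) = (c * (a * z)) ^+ 2.
  rewrite /conjg (sqrg_inv (inverted_sqr a2 Sz)) expg2; move: (a * z) => d.
  by rewrite !mulgA.
exact: exp6_sqr.
Qed.

Lemma fixed_cw3 : (c * w) ^+ 3 = 1.
Proof. by rewrite -conjg_mulR; exact: expgJ1. Qed.

Lemma fixed_cwV3 : (c * w^-1) ^+ 3 = 1.
Proof.
rewrite /w commgEl invgM invgK mulgA; apply: expgC1; rewrite mulgA cube_sqr //.
by rewrite -invgM; apply: expgV1; apply: expgC1; exact: fixed_ccz.
Qed.

Lemma fixed_lc : commute c l.
Proof.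
apply: cubes_commuteRl => //; first exact: fixed_w3.
  exact: fixed_cw3.
exact: fixed_cwV3.
Qed.

Lemma fixed_lw : commute w l.
Proof.
apply: cubes_commuteRr => //; first exact: fixed_w3.
  exact: fixed_cw3.
exact: fixed_cwV3.
Qed.

(** Exponent 6 makes the left side square to 1; the formula passes this on to [k * l]. *)
Lemma fixed_cz3 : (c * z) ^+ 3 = (k * l) ^ (w * c).
Proof.
have [z3 _] := Sz.
have cJ : c ^ z = c * w by exact: conjg_mulR.
have wJ : w ^ z = w * k by exact: conjg_mulR.
have czz : c ^ (z * z) = c * w * (w * k).
  by rewrite conjgM cJ (conjMg c w) cJ wJ.
have -> : (c * z) ^+ 3 = c * c ^ (z * z) * c ^ z.
  rewrite (cube_sqr z3) expg3E /conjg !gnorm.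
  by rewrite (cube_sqrA _ (expgV1 z3)) invgK.
rewrite czz cJ (conjMg k l) (conjg_id (commuteM (commute_sym fixed_lw) (commute_sym fixed_lc))).
have E : c * w = w * c * l by exact: commgC.
have w3 := fixed_w3; clear cJ wJ czz; clearbody l k; clearbody w.
have -> : k ^ (w * c) * l = c^-1 * w^-1 * k * (w * c * l).
  by rewrite /conjg invgM !mulgA.
by rewrite -E -[c^-1](cube_sqr c3) -[w^-1](cube_sqr w3) !mulgA.
Qed.

Lemma fixed_kl2 : (k * l) ^+ 2 = 1.
Proof.
apply: (@conjg_inj _ (w * c)); rewrite conj1g conjXg -fixed_cz3 -expgnA.
exact: exp6.
Qed.
End FixedElement.

(** The first three relations present the alternating group of degree 4, in which [k^-1 * l] has
    order 3; the fourth relation collapses it. *)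
Lemma commute_inverted_eq1 (k l : G) : k ^+ 3 = 1 -> l ^+ 3 = 1 ->
  (k * l) ^+ 2 = 1 -> (k^-1 * l) ^+ 2 = 1 -> k = 1.
Proof.
move=> k3 l3 kl2 kVl2.
have E1 : k * l * k = l^-1.
  by apply: (mulIg l); rewrite mulVg -kl2 expg2 !mulgA.
have E2 : k^-1 * l * k^-1 = l^-1.
  by apply: (mulIg l); rewrite mulVg -kVl2 expg2 !mulgA.
have lE : l = k^-1 * l^-1 * k^-1 by rewrite -E1; rewrite !gnorm.
have lE2 : k * l^-1 * k = l by rewrite -E2; rewrite !gnorm.
have lVl : l^-1 = l.
  have kVkV : k^-1 * k^-1 = k by rewrite -invgM (cube_sqr k3) invgK.
  rewrite -[LHS]E2 {1}lE !mulgA kVkV -!mulgA kVkV mulgA; exact: lE2.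
have l1 : l = 1 by apply: sqr_cube1 => //; rewrite expg2 -{1}lVl mulVg.
by apply: sqr_cube1 => //; move: kl2; rewrite l1 mulg1.
Qed.

Section FixedElement2.
Variables a c z : G.
Hypotheses (a2 : a ^+ 2 = 1) (c3 : c ^+ 3 = 1) (ca : commute c a) (Sz : inverted a z).
Let w := [~ c, z].
Let k := [~ w, z].
Let l := [~ c, w].

(** [fixed_kl2] applies to [c^-1] as well. Up to conjugation by [c], this replacement inverts [w]
    and [k] and keeps [l]. *)
Lemma fixed_kVl2 : (k^-1 * l) ^+ 2 = 1.
Proof.
have kw := fixed_kw a2 ca Sz; have kz := fixed_kz a2 ca Sz.
have lc := fixed_lc a2 c3 ca Sz; have lw := fixed_lw a2 c3 ca Sz.
have caV : commute c^-1 a by apply/commute_sym/commuteV/commute_sym.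
have := fixed_kl2 a2 (expgV1 c3) caV Sz.
have wE : [~ c^-1, z] ^ c = w^-1 by rewrite /w /commg /conjg !gnorm.
have zE : z ^ c = z * w^-1 by rewrite /w /commg /conjg !gnorm.
have lE : [~ c^-1, [~ c^-1, z]] ^ c = l.
  by rewrite conjRg wE (conjg_id (commute_sym (commuteV (commute_refl c)))) commg_classV.
have kE : [~ [~ c^-1, z], z] ^ c = k^-1.
  rewrite conjRg wE zE commg_mulR commgg mul1g commVg //.
  by rewrite conjg_id //; apply/commuteV/commute_sym/commuteV.
by move/(expgJ1 c); rewrite conjMg kE lE.
Qed.

Lemma fixed_commutes : commute z w.
Proof.
have kw := fixed_kw a2 ca Sz; have lc := fixed_lc a2 c3 ca Sz.
have w3 := fixed_w3 a2 ca Sz.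
have : k = 1.
  apply: commute_inverted_eq1 (fixed_kl2 a2 c3 ca Sz) fixed_kVl2; exact: commg_cube.
by move/eqP/commgP/commute_sym.
Qed.

Lemma inverted_fixR : inverted a w.
Proof.
split; first exact: fixed_w3 a2 ca Sz.
have zw := fixed_commutes; case: Sz => z3 za.
rewrite /w conjRg (conjg_id ca) za -[LHS]invgR -[in RHS]invgR; congr _^-1.
by rewrite commVg ?invgR // -invgR; apply: commuteV.
Qed.
End FixedElement2.

Section BaseChange.
Variables a c x z : G.
Hypotheses (a2 : a ^+ 2 = 1) (c3 : c ^+ 3 = 1) (ca : commute c a) (cx : commute c x).
Hypotheses (Sx : inverted a x) (Sz : inverted a z).

(* [a x] is an involution that also commutes with [c] and inverts [x^-1 z]. *)
Lemma fixed_commutes_base : commute x [~ c, z].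
Proof.
have [x3 xa] := Sx; have [z3 za] := Sz.
have Sb : inverted (a * x) (x^-1 * z).
  split; first by apply: (inverted_mul3 a2) => //; exact: invertedV.
  by rewrite conjgM (conjMg x^-1 z) conjVg xa za invgK /conjg !gnorm.
have := inverted_fixR (inverted_sqr a2 Sx) c3 (commuteM ca cx) Sb.
rewrite commg_mulR (commg_eq1 (commuteV cx)) conj1g mulg1 => -[_].
rewrite conjgM; case: (inverted_fixR a2 c3 ca Sz) => _ ->; rewrite conjVg.
by move/invg_inj/conjg_fixP/commgP/commute_sym.
Qed.
End BaseChange.

Section Triple.
Variables a x y z : G.
Hypotheses (a2 : a ^+ 2 = 1) (Sx : inverted a x) (Sy : inverted a y) (Sz : inverted a z).

Let c3 : [~ x, y] ^+ 3 = 1.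
Proof. by have [x3 _] := Sx; apply: commg_cube (inverted_commRl a2 Sx Sy). Qed.

Let ca : commute [~ x, y] a.
Proof.
apply/commgP/conjg_fixP; rewrite conjRg.
have [[_ ->] [_ ->]] := (Sx, Sy); apply: commg_classV.
  exact: inverted_commRl Sy.
exact: inverted_commRr Sy.
Qed.

(** [a] inverts [x] and [y], and [[~ x^-1, y^-1] = [~ x, y]] by [commg_classV]; so the results on a
    fixed element apply to [c = [~ x, y]]. *)
Lemma inverted_R3 : inverted a [~ x, y, z].
Proof. exact: inverted_fixR. Qed.

Lemma inverted_R3x : commute x [~ x, y, z].
Proof.
by apply: fixed_commutes_base Sz => //; apply/commute_sym/(inverted_commRl a2).
Qed.

Lemma inverted_R3y : commute y [~ x, y, z].
Proof.
by apply: fixed_commutes_base Sz => //; apply/commute_sym/(inverted_commRr a2).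
Qed.

Lemma inverted_R3z : commute z [~ x, y, z].
Proof. exact: fixed_commutes a2 c3 ca Sz. Qed.
End Triple.

Lemma inverted_R4 a x y z u : a ^+ 2 = 1 -> inverted a x -> inverted a y ->
  inverted a z -> inverted a u -> [~ x, y, z, u] = 1.
Proof.
move=> a2; apply: S_R4_1 => [s [] //|s t|s t|s t|r s t|r s t|r s t|r s t].
- exact: inverted_commRl.
- exact: inverted_commRr.
- exact: inverted_triple.
- exact: inverted_R3.
- exact: inverted_R3x.
- exact: inverted_R3y.
- exact: inverted_R3z.
Qed.
End Inverted.

Section Exp3.
Variable G : groupType.
Hypothesis e3 : forall t : G, t ^+ 3 = 1.
Implicit Types x y z u : G.

Lemma exp3_commRl x y : commute x [~ x, y].
Proof. exact: cubes_commuteRl. Qed.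

(** The theorem of Levi and van der Waerden on exponent 3: every element commutes with its
    conjugates, so the whole group can serve as [S]. *)
Lemma exp3_R4_R2R2 x y z u : [~ x, y, z, u] = 1 /\ [~ [~ x, y], [~ z, u]] = 1.
Proof.
have cJ (s t : G) : commute s (s ^ t) by apply: cubes_commuteJ.
have cRl (s t : G) : commute s [~ s, t] by apply: cubes_commuteRl.
have cRr (s t : G) : commute t [~ s, t] by apply: cubes_commuteRr.
have R3l (s t v : G) : commute s [~ s, t, v].
  rewrite [[~ s, t, v]]commgEl; apply: commuteM; first by apply: commuteV.
  rewrite commgEl conjMg conjVg -conjgM; apply: commuteM => //; exact: commuteV.
have R3r (s t v : G) : commute t [~ s, t, v].
  rewrite [[~ s, t, v]]commgEl; apply: commuteM; first by apply: commuteV.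
  rewrite commgEr conjMg -conjgM conjVg; apply: commuteM => //; exact: commuteV.
split; first by apply: (@S_R4_1 _ (fun=> True)).
rewrite (@S_R2R2 _ (fun=> True)) // (@S_R4_1 _ (fun=> True)) ?invg1 //.
Qed.

Lemma exp3_R4 x y z u : [~ x, y, z, u] = 1.
Proof. by have [] := exp3_R4_R2R2 x y z u. Qed.

Lemma exp3_R2R2 x y z u : [~ [~ x, y], [~ z, u]] = 1.
Proof. by have [] := exp3_R4_R2R2 x y z u. Qed.
End Exp3.

(** * Locally finite subgroups *)

Section Subgroups.
Variable G : groupType.
Implicit Types (x y z g h : G) (H M N X : G -> Prop) (s t : seq G).

Definition is_sub H := [/\ H 1, forall x y, H x -> H y -> H (x * y) & forall x, H x -> H x^-1].

Definition gen X : G -> Prop :=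
  fun g => forall H, is_sub H -> (forall x, X x -> H x) -> H g.

Definition normed N H := forall x h, N x -> H h -> N (x ^ h).

Lemma gen_sub X : is_sub (gen X).
Proof.
split=> [H [] //|x y gx gy H sH XH|x gx H sH XH]; case: (sH) => H1 HM HV.
  by apply: HM; [exact: gx|exact: gy].
by apply: HV; exact: gx.
Qed.

Lemma gen_in X x : X x -> gen X x. Proof. by move=> Xx H _; apply. Qed.

Lemma gen_min X H : is_sub H -> (forall x, X x -> H x) -> forall g, gen X g -> H g.
Proof. by move=> sH XH g; apply. Qed.

Lemma sub_X H x n : is_sub H -> H x -> H (x ^+ n).
Proof.
by move=> [H1 HM _] Hx; elim: n => [|n IHn]; rewrite ?expgS //; exact: HM.
Qed.

Lemma sub_J H x y : is_sub H -> H x -> H y -> H (x ^ y).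
Proof. by move=> [_ HM HV] Hx Hy; apply: (HM); [exact: HV|exact: HM]. Qed.

Lemma sub_R H x y : is_sub H -> H x -> H y -> H [~ x, y].
Proof. by move=> sH Hx Hy; case: (sH) => _ HM HV; apply: (HM); [exact: HV|exact: sub_J]. Qed.

Lemma normed_gen N X : is_sub N -> (forall x h, N x -> X h -> N (x ^ h)) ->
  (forall x h, N x -> X h -> N (x ^ h^-1)) -> normed N (gen X).
Proof.
move=> sN NX NXV x h Nx gh; move: (x) Nx.
suff [] : (forall x, N x -> N (x ^ h)) /\ (forall x, N x -> N (x ^ h^-1)) by [].
apply: (@gen_min X (fun h => (forall x, N x -> N (x ^ h)) /\ (forall x,
  N x -> N (x ^ h^-1)))) gh => [|g Xg]; last by split=> y Ny; [exact: NX|exact: NXV].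
split=> [|g g' [h1 h2] [h3 h4]|g [h1 h2]].
- by split=> y Ny; rewrite ?invg1 conjg1.
- by split=> y Ny; rewrite ?invgM conjgM; [apply/h3/h1|apply/h2/h4].
- by split=> y Ny; rewrite ?invgK; [apply: h2|apply: h1].
Qed.

Definition loc_finite H := forall s, (forall x, x \in s -> H x) ->
  exists t, forall g, gen (fun x => x \in s) g -> g \in t.

(* Schreier's argument: the elements [r x r'^-1] of [N], with [r],
  [r'] coset representatives and [x] a generator, generate a finite subgroup of [N]. *)
Lemma loc_finite_cover N s t : is_sub N -> loc_finite N ->
  (forall g, gen (fun x => x \in s) g -> exists2 r : G, r \in t & N (g * r^-1)) ->
  exists t', forall g, gen (fun x => x \in s) g -> g \in t'.
Proof.
move=> sN fN cov; set K := gen _ in cov *.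
have sK : is_sub K := gen_sub _.
have [N1 NM NV] := sN; have [K1 KM KV] := sK.
have [|rep repP] := @choice _ _
    (fun r r' => K r' /\ forall g, K g -> N (g * r^-1) -> N (g * r'^-1)).
  move=> r.
  have [[g0 [Kg0 Ng0]]|no] := pselect (exists g, K g /\ N (g * r^-1)); last first.
    by exists 1; split=> // g Kg Ng; case: no; exists g.
  exists g0; split=> // g Kg Ng; have := NM _ _ Ng (NV _ Ng0).
  by rewrite invgM invgK mulgA mulgVK.
pose t0 := 1 :: map rep t.
have t0K (r : G) : r \in t0 -> K r.
  by rewrite inE => /orP[/eqP-> //|/mapP[r' _ ->]]; case: (repP r').
have cov0 g : K g -> exists2 r : G, r \in t0 & N (g * r^-1).
  move=> Kg; have [r rt Ng] := cov _ Kg; exists (rep r).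
    by rewrite inE map_f ?orbT.
  by have [_] := repP r; apply.
pose s' := s ++ map inv s.
have s'K x : x \in s' -> K x.
  rewrite mem_cat => /orP[xs|/mapP[y ys ->]]; first exact: gen_in.
  by apply: KV; exact: gen_in.
pose U := [seq u : G <- [seq r' * r^-1 | r' : G <- [seq r * x | r : G <- t0, x : G <- s'],
  r : G <- t0] | `[< N u >]].
have [u uU|tU tUP] := fN U; first by move: uU; rewrite mem_filter => /andP[/asboolP].
pose P g := exists2 u, gen (fun u => u \in U) u & exists2 r : G, r \in t0 & g = u * r.
have [gU1 gUM _] := gen_sub (fun u => u \in U).
have Pstep g x : P g -> x \in s' -> P (g * x).
  move=> [u gu [r rt ->]] xs.
  have [r' r't Nr] := cov0 _ (KM _ _ (t0K _ rt) (s'K _ xs)).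
  exists (u * (r * x * r'^-1)); last by exists r'; rewrite // !mulgA mulgVK.
  apply: gUM => //; apply: gen_in; rewrite mem_filter; apply/andP; split; first exact/asboolP.
  by do 2!apply: allpairs_f => //.
have P1 : P 1 by exists 1 => //; exists 1; rewrite ?mulg1 // inE eqxx.
exists [seq u * r | u : G <- tU, r : G <- t0] => g Kg.
suff [u gu [r rt ->]] : P g by apply: allpairs_f => //; exact: tUP.
suff [Pg _] : (forall h, P h -> P (h * g)) /\ (forall h, P h -> P (h * g^-1)).
  by rewrite -[g]mul1g; exact: Pg.
apply: (@gen_min _ (fun g => (forall h, P h -> P (h * g)) /\ (forall h,
  P h -> P (h * g^-1)))) Kg => [|x xs].
  split=> [|x y [x1 x2] [y1 y2]|x [x1 x2]].
  - by split=> h; rewrite ?invg1 mulg1.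
  - by split=> h Ph; rewrite ?invgM mulgA; [apply/y1/x1|apply/x2/y2].
  - by split=> h Ph; rewrite ?invgK; [apply: x2|apply: x1].
split=> h Ph; apply: Pstep => //; rewrite mem_cat ?xs //.
by rewrite map_f ?orbT.
Qed.

Definition mulset N M : G -> Prop := fun g => exists2 n, N n & exists2 m, M m & g = n * m.

Lemma mulset_sub N M : is_sub N -> is_sub M -> normed N M -> is_sub (mulset N M).
Proof.
move=> [N1 NM NV] [M1 MM MV] nNM; split.
- by exists 1 => //; exists 1; rewrite ?mulg1.
- move=> _ _ [n Nn [m Mm ->]] [n' Nn' [m' Mm' ->]].
  exists (n * n' ^ m^-1); first by apply: NM => //; apply: nNM => //; exact: MV.
  by exists (m * m'); [exact: MM|rewrite /conjg !gnorm].
- move=> _ [n Nn [m Mm ->]]; exists (n^-1 ^ m); first by apply: nNM => //; exact: NV.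
  by exists m^-1; [exact: MV|rewrite /conjg !gnorm].
Qed.

(** The [M]-parts of the given generators generate a finite group, whose elements represent all
    cosets of [N] that occur; [loc_finite_cover] does the rest. *)
Lemma loc_finite_mul N M : is_sub N -> is_sub M -> normed N M ->
  loc_finite N -> loc_finite M -> loc_finite (mulset N M).
Proof.
move=> sN sM nNM fN fM s sNM; have [N1 NM NV] := sN; have [M1 MM MV] := sM.
have [|f fP] := @choice _ _ (fun x m => x \in s -> M m /\ N (x * m^-1)).
  move=> x.
  have [xs|] := boolP (x \in s); last by exists 1.
  by have [n Nn [m Mm ->]] := sNM x xs; exists m => _; rewrite mulgK.
have [x /mapP[y ys ->]|t tP] := fM (map f s); first by have [] := fP y ys.
apply: (loc_finite_cover (t := t) sN fN) => g.
pose P g := exists2 m, gen (fun x => x \in map f s) m & N (g * m^-1).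
suff /[apply] : gen (fun x => x \in s) g -> P g by case=> m /tP; exists m.
have gM m : gen (fun x => x \in map f s) m -> M m.
  by apply: gen_min => // x /mapP[y ys ->]; have [] := fP y ys.
have [gm1 gmM gmV] := gen_sub (fun x => x \in map f s).
apply: gen_min => [|x xs]; last first.
  by exists (f x); [apply: gen_in; exact: map_f|case: (fP x xs)].
split=> [|x y [m gm Nm] [m' gm' Nm']|x [m gm Nm]].
- by exists 1; rewrite // mulgV.
- exists (m * m'); first exact: gmM.
  have -> : x * y * (m * m')^-1 = (x * m^-1) * (y * m'^-1) ^ m^-1.
    by rewrite /conjg !gnorm.
  by apply: NM => //; apply: nNM => //; exact/MV/gM.
- exists m^-1; first exact: gmV.
  have -> : x^-1 * m^-1^-1 = ((x * m^-1)^-1) ^ m by rewrite /conjg !gnorm.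
  by apply: nNM; [exact: NV|exact: gM].
Qed.

Section BigProduct.
Variables (I : Type) (F : I -> G -> Prop) (H : G -> Prop).
Hypotheses (sF : forall i, is_sub (F i)) (fF : forall i, loc_finite (F i)).
Hypotheses (FH : forall i x, F i x -> H x) (nF : forall i, normed (F i) H).

Fixpoint prodF (l : seq I) : G -> Prop :=
  if l is i :: l' then mulset (F i) (prodF l') else fun g => g = 1.

Lemma prodF_spec l : is_sub H -> 
  [/\ is_sub (prodF l), loc_finite (prodF l) & forall x, prodF l x -> H x].
Proof.
move=> sH; elim: l => [|i l [sP fP PH]] /=.
  split=> [|s s1|x ->]; last by case: sH.
    by split=> [//|x y -> ->|x ->]; rewrite ?mulg1 ?invg1.
  exists [:: 1] => g gs; rewrite inE; apply/eqP.
  apply: (@gen_min _ (fun g => g = 1)) gs => //.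
  by split=> [//|x y -> ->|x ->]; rewrite ?mulg1 ?invg1.
have nP : normed (F i) (prodF l) by move=> x h Fx /PH; exact: nF.
split; first exact: mulset_sub.
  exact: loc_finite_mul.
by move=> _ [n /FH Hn [m /PH Hm ->]]; case: sH => _ HM _; exact: HM.
Qed.

Lemma prodF_cat l l' : is_sub H -> forall x, prodF (l ++ l') x <-> mulset (prodF l) (prodF l') x.
Proof.
move=> sH; elim: l => [|i l IHl] x /=.
  by split=> [Px|[n -> [m Pm ->]]]; rewrite ?mul1g //; exists 1; rewrite //; exists x;
    rewrite ?mul1g.
split=> [[n Fn [m /IHl[n' Pn' [m' Pm' ->]] ->]]|[_ [n Fn [m Pm ->]] [m' Pm' ->]]].
  by exists (n * n'); [exists n; rewrite //; exists n'|exists m'; rewrite ?mulgA].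
by exists n => //; exists (m * m'); rewrite ?mulgA //; apply/IHl; exists m => //; exists m'.
Qed.

Lemma loc_finite_gen : is_sub H -> loc_finite (gen (fun x => exists i, F i x)).
Proof.
move=> sH.
have catl l l' x : prodF l x -> prodF (l ++ l') x.
  move=> Px; apply/prodF_cat => //; exists x => //; exists 1; rewrite ?mulg1 //.
  by have [[]] := prodF_spec l' sH.
have catr l l' x : prodF l' x -> prodF (l ++ l') x.
  move=> Px; apply/prodF_cat => //; exists 1; first by have [[]] := prodF_spec l sH.
  by exists x; rewrite ?mul1g.
have genP g : gen (fun x => exists i, F i x) g -> exists l, prodF l g.
  apply: (@gen_min _ (fun g => exists l, prodF l g)) => [|x [i Fx]]; last by exists [:: i];
    exists x; rewrite //; exists 1; rewrite ?mulg1.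
  split=> [|x y [l Px] [l' Py]|x [l Px]]; first by exists [::].
    exists (l ++ l'); have [[_ PM _] _ _] := prodF_spec (l ++ l') sH.
    by apply: PM; [exact: catl|exact: catr].
  by exists l; have [[_ _ PV] _ _] := prodF_spec l sH; exact: PV.
move=> s sg; have [l lP] : exists l, forall x, x \in s -> prodF l x.
  elim: s sg => [|y s IHs] sg; first by exists [::].
  have [|l lP] := IHs; first by move=> x xs; apply: sg; rewrite inE xs orbT.
  have [l' l'P] := genP _ (sg y (mem_head _ _)).
  exists (l' ++ l) => x; rewrite inE => /orP[/eqP->|/lP]; [exact: catl|exact: catr].
by have [_ fP _] := prodF_spec l sH; exact: fP.
Qed.
End BigProduct.

(** Modulo [N] the group is abelian of exponent dividing [n], so ordered products of powers of the
    generators with exponents below [n] (the list [cov]) meet every coset in question. *)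
Lemma loc_finite_ext N H n : is_sub N -> is_sub H -> normed N H -> (0 < n)%N ->
  loc_finite N -> (forall x y, H x -> H y -> N [~ x, y]) ->
  (forall x, H x -> N (x ^+ n)) -> loc_finite H.
Proof.
move=> sN sH nNH n0 fN NR NX s sHs; have [N1 NM NV] := sN; have [H1 HM HV] := sH.
pose eqN x y := N (x * y^-1).
have eqNM x y x' y' : H x -> eqN x x' -> eqN y y' -> H x' -> eqN (x * y) (x' * y').
  move=> Hx Ex Ey Hx'; rewrite /eqN.
  have -> : x * y * (x' * y')^-1 = (y * y'^-1) ^ x^-1 * (x * x'^-1) by rewrite /conjg !gnorm.
  by apply: NM => //; apply: nNH => //; exact: HV.
have eqNT x y z : eqN x y -> eqN y z -> eqN x z.
  by rewrite /eqN => xy yz; have := NM _ _ xy yz; rewrite mulgA mulgVK.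
have eqNC x y : H x -> H y -> eqN (x * y) (y * x).
  move=> Hx Hy; rewrite /eqN.
  have -> : x * y * (y * x)^-1 = [~ x^-1, y^-1] by rewrite /commg /conjg !gnorm.
  by apply: NR; exact: HV.
have eqNr x : eqN x x by rewrite /eqN mulgV.
pose cov := foldr (fun x r => [seq x ^+ e * y | e <- iota 0 n, y : G <- r]) [:: 1].
have covH s' x : (forall x, x \in s' -> H x) -> x \in cov s' -> H x.
  elim: s' x => [|y s' IHs] x sH' /=; first by rewrite inE => /eqP->.
  case/allpairsP=> -[e r] [_ /= rs ->]; apply: HM; first by apply: sub_X => //;
    apply/sH'/mem_head.
  by apply: IHs => // z zs; apply: sH'; rewrite inE zs orbT.
have covM s' x y : (forall x, x \in s' -> H x) -> x \in cov s' -> y \in cov s' ->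
  exists2 z, z \in cov s' & eqN (x * y) z.
  elim: s' x y => [|w s' IHs] x y sH' /=.
    by rewrite !inE => /eqP-> /eqP->; exists 1; rewrite ?inE // mulg1.
  have Hw : H w by apply/sH'/mem_head.
  have sH'' v : v \in s' -> H v by move=> vs; apply: sH'; rewrite inE vs orbT.
  case/allpairsP=> -[e r] [/= eP rs ->] /allpairsP[[f r'] [/= fP r's ->]].
  have [z zs Ez] := IHs _ _ sH'' rs r's.
  exists (w ^+ ((e + f) %% n) * z).
    by apply: (@allpairs_f _ _ _ (fun e (y : G) => w ^+ e * y)); rewrite ?mem_iota ?ltn_mod.
  have [Hr Hr'] : H r /\ H r' by split; apply: covH; [exact: sH''|exact: rs|exact: sH''|].
  have He : H (w ^+ e) by exact: sub_X.
  have Hf : H (w ^+ f) by exact: sub_X.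
  apply: (eqNT _ (w ^+ e * w ^+ f * (r * r'))).
    rewrite -!mulgA; apply: (eqNM _ _ _ _ He (eqNr _) _ He); rewrite !mulgA.
    by apply: (eqNM _ _ _ _ _ _ (eqNr _)); [exact: HM|exact: eqNC|exact: HM].
  apply: (eqNM _ _ _ _ _ _ Ez); [exact: HM| |exact: sub_X].
  rewrite -expgnDr /eqN {1}(divn_eq (e + f) n) expgnDr mulgK mulnC expgnA.
  by apply: sub_X => //; apply: NX.
have cov1 s' : 1 \in cov s'.
  elim: s' => [|w s' IHs] /=; first by rewrite inE.
  by rewrite -[1]mulg1 -{1}(expg0 w); apply: allpairs_f; rewrite ?mem_iota.
have covX s' x k : (forall x, x \in s' -> H x) -> x \in cov s' ->
  exists2 z, z \in cov s' & eqN (x ^+ k) z.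
  move=> sH' xs; elim: k => [|k [z zs Ez]].
    by exists 1.
  have [z' z's Ez'] := covM s' _ _ sH' xs zs; exists z' => //.
  rewrite expgS; apply: eqNT Ez'; apply: (eqNM) => //; exact: covH xs.
apply: (loc_finite_cover (t := cov s) sN fN) => g.
pose P g := H g /\ exists2 r : G, r \in cov s & eqN g r.
suff /[apply] : gen (fun x => x \in s) g -> P g by case=> _ [r]; exists r.
apply: gen_min => [|x xs].
  split=> [|x y [Hx [r rs Er]] [Hy [r' rs' Er']]|x [Hx [r rs Er]]].
  - by split=> //; exists 1.
  - split; first exact: HM.
    have [z zs Ez] := covM s _ _ sHs rs rs'; exists z => //.
    by apply: eqNT Ez; apply: (eqNM) => //; exact: covH rs.
  - split; first exact: HV.
    (* Modulo [N], the inverse of [r] is [r ^+ n.-1]. *)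
    have [z zs Ez] := covX s _ n.-1 sHs rs; exists z => //.
    apply: eqNT Ez; rewrite /eqN -invgM; apply: NV.
    have Hr := covH _ _ sHs rs.
    have -> : r ^+ n.-1 * x = (x * r^-1) ^ (r ^- n.-1) * r ^+ n.
      by rewrite -{3}(prednK n0) expgSr /conjg !gnorm.
    by apply: NM; [apply: nNH => //; apply: HV; exact: sub_X|exact: NX].
split; first exact: sHs.
elim: (s) xs sHs => [|w s' IHs] //=; rewrite inE => /orP[/eqP->|xs] sHs'.
  exists (w ^+ (1 %% n) * 1).
    by apply: (@allpairs_f _ _ _ (fun e (y : G) => w ^+ e * y)); rewrite ?mem_iota ?ltn_mod.
  rewrite mulg1 /eqN -{1}[w]expg1 {1}(divn_eq 1 n) expgnDr mulgK mulnC expgnA.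
  by apply: sub_X => //; apply: NX; exact/sHs'/mem_head.
have [|r rs Er] := IHs xs; first by move=> z zs; apply: sHs'; rewrite inE zs orbT.
by exists r => //; rewrite -[r]mul1g -(expg0 w);
  apply: (@allpairs_f _ _ _ (fun e (y : G) => w ^+ e * y)); rewrite ?mem_iota.
Qed.
End Subgroups.

(** * Quotients of groups *)

Section CentralSeries.
Variables (G : groupType) (M N S : G -> Prop) (n : nat).
Implicit Types x y z g h : G.
Hypotheses (sM : is_sub M) (sN : is_sub N) (NM : forall x, N x -> M x) (nNM : normed N M).

(** The preimages in [M] of the upper central series of [M] modulo [N]. *)
Fixpoint zser k : G -> Prop :=
  if k is k'.+1 then fun x => M x /\ forall g, M g -> zser k' [~ x, g] else N.

Lemma zser_spec k : [/\ is_sub (zser k), normed (zser k) M & forall x, zser k x -> M x].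
Proof.
have [M1 MM MV] := sM; elim: k => [|k [[Z1 ZM ZV] nZ ZMk]] //=; split.
- split=> [|x y [Mx Zx] [My Zy]|x [Mx Zx]].
  + by split=> // g _; rewrite comm1g.
  + split=> [|g Mg]; first exact: MM.
    by rewrite commg_mulL; apply: ZM; [apply: nZ => //; exact: Zx|exact: Zy].
  + split=> [|g Mg]; first exact: MV.
    have -> : [~ x^-1, g] = ([~ x, g]^-1) ^ x^-1 by rewrite /commg /conjg !gnorm.
    by apply: nZ; [apply/ZV/Zx|exact: MV].
- move=> x h [Mx Zx] Mh; split=> [|g Mg]; first exact: sub_J.
  have -> : [~ x ^ h, g] = [~ x, g ^ h^-1] ^ h by rewrite conjRg conjgKV.
  by apply: nZ => //; apply: Zx; apply: sub_J => //; exact: MV.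
- by move=> x [].
Qed.

Lemma zser_finite k : (0 < n)%N -> (forall x, M x -> x ^+ n = 1) ->
  loc_finite N -> loc_finite (zser k).
Proof.
move=> n0 Mn fN; elim: k => [|k IHk] //.
have [sZ nZ ZM] := zser_spec k; have [sZ' nZ' ZM'] := zser_spec k.+1.
apply: (loc_finite_ext (N := zser k) (n := n)) =>
  // [x h Zx /ZM' Mh|x y [_ Zx] /ZM' My|x /ZM' Mx].
- exact: nZ.
- exact: Zx.
- by rewrite Mn //; case: sZ.
Qed.

Hypothesis gM : forall x, M x <-> gen S x.

Lemma zser_gen k x : M x -> (forall s, S s -> zser k [~ x, s]) -> zser k.+1 x.
Proof.
move=> Mx Sx; split=> // g Mg; have [[Z1 ZM ZV] nZ _] := zser_spec k.
have [M1 MM MV] := sM.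
suff [] : M g /\ zser k [~ x, g] by [].
apply: (@gen_min _ S (fun g => M g /\ zser k [~ x, g])) (iffLR (gM g) Mg); last first.
  by move=> s Ss; split; [apply/gM; exact: gen_in|exact: Sx].
split=> [|y z [My Zy] [Mz Zz]|y [My Zy]].
- by rewrite commg1.
- by split; [exact: MM|rewrite commg_mulR; apply: ZM => //; exact: nZ].
- split; first exact: MV.
  have -> : [~ x, y^-1] = ([~ x, y]^-1) ^ y^-1 by rewrite /commg /conjg !gnorm.
  by apply: nZ; [exact: ZV|exact: MV].
Qed.

(** Centrality may be tested on generators ([zser_gen]), so [zser 3] contains [S] and hence [M];
    each step of the series is an abelian extension of bounded exponent. *)
Lemma class3_finite : (0 < n)%N -> (forall x, M x -> x ^+ n = 1) -> loc_finite N ->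
  (forall x y z u, S x -> S y -> S z -> S u -> N [~ x, y, z, u]) -> loc_finite M.
Proof.
move=> n0 Mn fN SR.
have SM s : S s -> M s by move=> Ss; apply/gM; exact: gen_in.
have Z1 x y z : S x -> S y -> S z -> zser 1 [~ x, y, z].
  move=> Sx Sy Sz; apply: zser_gen => [|s Ss]; last exact: SR.
  by do !apply: sub_R => //; exact: SM.
have Z2 x y : S x -> S y -> zser 2 [~ x, y].
  move=> Sx Sy; apply: zser_gen => [|s Ss]; last exact: Z1.
  by do !apply: sub_R => //; exact: SM.
have Z3 x : S x -> zser 3 x.
  by move=> Sx; apply: zser_gen => [|s Ss]; [exact: SM|exact: Z2].
have [sZ _ _] := zser_spec 3.
move=> s sM'; apply: (zser_finite (k := 3)) => // x /sM' /gM.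
by apply: gen_min.
Qed.
End CentralSeries.

Record normal_sub (G : groupType) := NormalSub {
  normal_pred :> G -> Prop;
  normal_is_sub : is_sub normal_pred;
  normal_normed : forall x h, normal_pred x -> normal_pred (x ^ h) }.

Section Quotient.
Local Open Scope quotient_scope.
Variables (G : groupType) (N : normal_sub G).
Implicit Types x y z : G.

Definition quo_equiv x y := `[< N (x^-1 * y) >].

Lemma quo_equiv_class : equiv_class_of quo_equiv.
Proof.
have [N1 NM NV] := normal_is_sub N; split=> [x|x y|y x z].
- by apply/asboolP; rewrite mulVg.
- by apply/asboolP/asboolP=> /NV; rewrite invgM invgK.
- by move=> /asboolP Nxy /asboolP Nyz; apply/asboolP; rewrite -[z](mulKVg y) mulgA; exact: NM.
Qed.

Canonical quo_equiv_rel := EquivRelPack quo_equiv_class.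
Canonical quo_encModRel := defaultEncModRel quo_equiv.

Definition quo := {eq_quot quo_equiv}.

HB.instance Definition _ : EqQuotient G quo_equiv quo := EqQuotient.on quo.
HB.instance Definition _ := Choice.on quo.

Lemma quo_eqP x y : (\pi_quo x = \pi_quo y) <-> N (x^-1 * y).
Proof.
split=> [/eqP|Nxy]; first by rewrite eqmodE => /asboolP.
by apply/eqP; rewrite eqmodE; apply/asboolP.
Qed.

Definition quo_one : quo := \pi_quo 1.
Definition quo_inv (a : quo) : quo := \pi_quo (repr a)^-1.
Definition quo_mul (a b : quo) : quo := \pi_quo (repr a * repr b).

Lemma quo_piM x y : \pi_quo (x * y) = quo_mul (\pi_quo x) (\pi_quo y).
Proof.
have [N1 NM NV] := normal_is_sub N; apply/quo_eqP.
have /quo_eqP Nx : \pi_quo x = \pi_quo (repr (\pi_quo x)) by rewrite reprK.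
have /quo_eqP Ny : \pi_quo y = \pi_quo (repr (\pi_quo y)) by rewrite reprK.
move: (repr _) (repr _) Nx Ny => y' x' Nx Ny.
have -> : (x * y)^-1 * (x' * y') = (x^-1 * x') ^ y * (y^-1 * y').
  by rewrite /conjg !gnorm.
by apply: NM => //; exact: normal_normed.
Qed.

Lemma quo_piV x : \pi_quo x^-1 = quo_inv (\pi_quo x).
Proof.
have [N1 NM NV] := normal_is_sub N; apply/quo_eqP.
have /quo_eqP Nx : \pi_quo x = \pi_quo (repr (\pi_quo x)) by rewrite reprK.
move: (repr _) Nx => x' Nx.
have -> : x^-1^-1 * x'^-1 = ((x^-1 * x')^-1) ^ x^-1 by rewrite /conjg !gnorm.
exact/normal_normed/NV.
Qed.

Lemma quo_mulA : associative quo_mul.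
Proof.
move=> a b c; rewrite -[a]reprK -[b]reprK -[c]reprK; move: (repr a) (repr b) (repr c) => x y z.
by rewrite -(quo_piM y z) -(quo_piM x y) -(quo_piM x (y * z)) -(quo_piM (x * y) z) mulgA.
Qed.
Lemma quo_mul1 : left_id quo_one quo_mul.
Proof. by move=> a; rewrite -[a]reprK; move: (repr a) => x; rewrite -!quo_piM mul1g. Qed.
Lemma quo_mulr1 : right_id quo_one quo_mul.
Proof. by move=> a; rewrite -[a]reprK; move: (repr a) => x; rewrite -!quo_piM mulg1. Qed.
Lemma quo_mulV : left_inverse quo_one quo_inv quo_mul.
Proof. by move=> a; rewrite -[a]reprK; move: (repr a) => x; rewrite -quo_piV -quo_piM mulVg. Qed.
Lemma quo_mulrV : right_inverse quo_one quo_inv quo_mul.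
Proof. by move=> a; rewrite -[a]reprK; move: (repr a) => x; rewrite -quo_piV -quo_piM mulgV. Qed.

HB.instance Definition _ :=
  isGroup.Build quo quo_mulA quo_mul1 quo_mulr1 quo_mulV quo_mulrV.

Lemma quo_pi1 x : \pi_quo x = 1 <-> N x.
Proof.
have [N1 NM NV] := normal_is_sub N.
rewrite -[1]/(\pi_quo 1) quo_eqP mulg1; split=> [/NV|/NV //]; by rewrite invgK.
Qed.

Lemma quo_pi_morph x y : \pi_quo (x * y) = \pi_quo x * \pi_quo y :> quo.
Proof. exact: quo_piM. Qed.
End Quotient.

Lemma exists_quotient (G : groupType) (N : normal_sub G) :
  exists (Q : groupType) (f : G -> Q), [/\ {morph f : x y / x * y}, forall q, exists x,
    q = f x & forall x, f x = 1 <-> N x].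
Proof.
exists (quo N), (\pi_(quo N)%qT); split; first exact: quo_pi_morph.
  by move=> q; exists (repr q); rewrite reprK.
exact: quo_pi1.
Qed.

(** * Groups of exponent six *)

Section Morphism.
Variables (G Q : groupType) (f : G -> Q).
Hypothesis fM : {morph f : x y / x * y}.

Lemma mor1 : f 1 = 1.
Proof. by apply: (mulgI (f 1)); rewrite -fM !mulg1. Qed.

Lemma morV x : f x^-1 = (f x)^-1.
Proof. by apply/esym/mulg1_eq; rewrite -fM mulgV mor1. Qed.

Lemma morX x n : f (x ^+ n) = f x ^+ n.
Proof. by elim: n => [|n IHn]; rewrite ?mor1 // !expgS fM IHn. Qed.

Lemma morR x y : f [~ x, y] = [~ f x, f y].
Proof. by rewrite /commg /conjg !fM !morV. Qed.
End Morphism.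

Section SubgroupsMore.
Variable G : groupType.
Implicit Types (x y z g h : G) (H K M N X : G -> Prop).

Lemma loc_finite1 : loc_finite (fun x : G => x = 1).
Proof.
move=> s s1; exists [:: 1] => g gs; rewrite inE; apply/eqP.
apply: (@gen_min _ _ (fun g => g = 1)) gs => //.
by split=> [//|x y -> ->|x ->]; rewrite ?mulg1 ?invg1.
Qed.

Lemma gen_J X K h : is_sub K -> (forall x, X x -> K (x ^ h)) -> forall x, gen X x -> K (x ^ h).
Proof.
move=> [K1 KM KV] XK; apply: gen_min => //; split=> [|x y Kx Ky|x Kx].
- by rewrite conj1g.
- by rewrite conjMg; exact: KM.
- by rewrite conjVg; exact: KV.
Qed.

Lemma gen_commg X K : is_sub K -> normed K (gen X) -> (forall x y, X x -> X y -> K [~ x, y]) ->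
  forall x y, gen X x -> gen X y -> K [~ x, y].
Proof.
move=> sK nK XK; have [K1 KM KV] := sK; have [g1 gM gV] := gen_sub X.
have subR x : is_sub (fun y => gen X y /\ K [~ x, y]).
  split=> [|y z [gy Ky] [gz Kz]|y [gy Ky]].
  - by rewrite commg1.
  - by split; [exact: gM|rewrite commg_mulR; apply: KM => //; exact: nK].
  - split; first exact: gV.
    have -> : [~ x, y^-1] = ([~ x, y]^-1) ^ y^-1 by rewrite /commg /conjg !gnorm.
    by apply: nK; [exact: KV|exact: gV].
have XgK x y : X x -> gen X y -> K [~ x, y].
  move=> Xx gy; suff [] : gen X y /\ K [~ x, y] by [].
  by apply: (@gen_min _ X (fun y => gen X y /\ K [~ x, y])) gy => // z Xz; split;
    [exact: gen_in|exact: XK].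
move=> x y gx gy; rewrite -invgR; apply: (KV).
suff [] : gen X x /\ K [~ y, x] by [].
apply: (@gen_min _ X (fun x => gen X x /\ K [~ y, x])) gx => // z Xz; split; first exact: gen_in.
by rewrite -invgR; apply: KV; exact: XgK.
Qed.
End SubgroupsMore.

Section HallSix.
Variable G : groupType.
Hypothesis exp6 : forall x : G, x ^+ 6 = 1.
Implicit Types a b s t u x y : G.

Let M a := gen (inverted a).
Let J := gen (fun a => a ^+ 2 = 1).

Lemma inverted_mul a b : a ^+ 2 = 1 -> b ^+ 2 = 1 -> (a * b) ^+ 3 = 1 -> inverted a (a * b).
Proof.
move=> a2 b2 ab3; split => //; rewrite /conjg invgM (sqrg_inv a2) (sqrg_inv b2) !mulgA.
by rewrite -expg2 a2 mul1g.
Qed.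

Lemma mulJ_cube a u : a ^+ 2 = 1 -> u ^+ 2 = 1 -> (a * a ^ u) ^+ 3 = 1.
Proof.
move=> a2 u2; have -> : a * a ^ u = (a * u) ^+ 2; last exact: exp6_sqr.
by rewrite /conjg (sqrg_inv u2) expg2 !mulgA.
Qed.

(** [s] is a quotient of [a * b] and [a * (b * s)]. Both are inverted by [a], since [b * s] is an
    involution linked to [a] through [b]. *)
Lemma inverted_class a b s : a ^+ 2 = 1 -> b ^+ 2 = 1 -> (a * b) ^+ 3 = 1 ->
  inverted b s -> M a s.
Proof.
move=> a2 b2 ab3 Ss; have [s3 _] := Ss.
have bs2 : (b * s) ^+ 2 = 1 by exact: inverted_sqr.
have bbs : b * (b * s) = s by rewrite mulgA -expg2 b2 mul1g.
have abs3 : (a * (b * s)) ^+ 3 = 1 by apply: (@inv_cube_trans _ exp6 _ b) => //; rewrite bbs.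
have -> : s = (a * b)^-1 * (a * (b * s)).
  by rewrite invgM (sqrg_inv a2) (sqrg_inv b2) !mulgA (mulgg_inv _ a2) -expg2 b2 mul1g.
have [_ gM gV] := gen_sub (inverted a).
by apply: gM; [apply: gV|]; apply: gen_in; exact: inverted_mul.
Qed.

(** An involution [u] carries elements inverted by [a] to elements inverted by [a ^ u], and
    [a * a ^ u = (a * u) ^+ 2] has cube 1, so [inverted_class] brings them back into [M a]. *)
Lemma inverted_gen_normed a : a ^+ 2 = 1 -> normed (M a) J.
Proof.
move=> a2; have sM := gen_sub (inverted a).
have nM u x : u ^+ 2 = 1 -> M a x -> M a (x ^ u).
  move=> u2; apply: gen_J => // s [s3 sa].
  apply: (@inverted_class a (a ^ u)) => //; first exact: expgJ1.
    exact: mulJ_cube.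
  by split; [exact: expgJ1|rewrite -conjJg sa conjVg].
apply: normed_gen => // x u Mx u2; last rewrite (sqrg_inv u2); exact: nM.
Qed.

Lemma inverted_gen_J a x : a ^+ 2 = 1 -> M a x -> J x.
Proof.
move=> a2; have sJ := gen_sub (fun a : G => a ^+ 2 = 1); have [_ JM _] := sJ.
apply: gen_min => // s Ss; have -> : s = a * (a * s) by rewrite mulgA -expg2 a2 mul1g.
by apply: JM; apply: gen_in => //; exact: inverted_sqr.
Qed.

Lemma inverted_gen_finite a : a ^+ 2 = 1 -> loc_finite (M a).
Proof.
move=> a2; have sM := gen_sub (inverted a); have [M1 _ _] := sM.
apply: (@class3_finite _ (M a) (fun x => x = 1) (inverted a) 6) => //.
- by split=> [//|x y -> ->|x ->]; rewrite ?mulg1 ?invg1.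
- by move=> x ->.
- by move=> x h -> _; rewrite conj1g.
- exact: loc_finite1.
- move=> x y z u; exact: inverted_R4.
Qed.

Lemma involutions_finite : loc_finite J.
Proof.
pose I := {a : G | a ^+ 2 = 1}; pose F (i : I) := M (proj1_sig i).
have sJ := gen_sub (fun a : G => a ^+ 2 = 1).
have sF i : is_sub (F i) by exact: gen_sub.
have fF i : loc_finite (F i) by case: i => a a2; exact: inverted_gen_finite.
have FJ i x : F i x -> J x by case: i => a a2; exact: inverted_gen_J.
have nF i : normed (F i) J by case: i => a a2; exact: inverted_gen_normed.
have fK := loc_finite_gen sF fF FJ nF sJ.
set K := gen _ in fK; have sK : is_sub K := gen_sub _.
have FK i x : F i x -> K x by move=> Fx; apply: gen_in; exists i.
have nK : normed K J.
  move=> x h Kx Jh; apply: gen_J Kx => // y [i Fy]; apply: (FK i); exact: nF.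
apply: (@loc_finite_ext _ K J 6) => //; last by move=> x _; rewrite exp6; case: sK.
apply: gen_commg => // a b a2 b2.
apply: (FK (exist _ a a2)); apply: gen_in; rewrite commgEl (sqrg_inv a2).
by apply: inverted_mul => //; [exact: expgJ1|exact: mulJ_cube].
Qed.

(* M. Hall's theorem. For an involution [a], the elements of order 3 inverted by [a]
   generate a normal subgroup of class 3 of the group [J] generated by all involutions.
   Products of these subgroups contain [[J, J]], and the quotient by [J] has exponent 3. *)
Theorem exp6_finite : loc_finite (fun _ : G => True).
Proof.
have sJ := gen_sub (fun a : G => a ^+ 2 = 1).
have nJ x h : J x -> J (x ^ h).
  apply: gen_J => // a a2; apply: gen_in; exact: expgJ1.
have [Q [f [fM fS /= f1]]] := exists_quotient (NormalSub sJ nJ).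
have nJT : normed J (fun=> True) by move=> x h Jx _; exact: nJ.
apply: (@class3_finite _ (fun=> True) J (fun=> True) 6) => //.
- by move=> x; split=> // _; exact: gen_in.
- exact: involutions_finite.
- move=> x y z u _ _ _ _; apply/f1; rewrite !(morR fM); apply: exp3_R4 => q.
  have [v ->] := fS q; rewrite -(morX fM); rewrite f1.
  by apply: gen_in; rewrite -expgnA.
Qed.
End HallSix.

(** * Central quotients of exponent two and three *)

Section Powers.
Variable G : groupType.
Implicit Types x y z c f g : G.

Lemma expMg_class2 x y n : commute x [~ y, x] -> commute y [~ y, x] ->
  (x * y) ^+ n = x ^+ n * y ^+ n * [~ y, x] ^+ 'C(n, 2).
Proof.
move=> cx cy; elim: n => [|n IHn]; first by rewrite !mulg1.
have zx a t : t * [~ y, x] ^+ a * x = t * x * [~ y, x] ^+ a.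
  by apply/commuteA/commute_sym/commuteX.
have zy a t : t * [~ y, x] ^+ a * y = t * y * [~ y, x] ^+ a.
  by apply/commuteA/commute_sym/commuteX.
have yx t : t * y ^+ n * x = t * x * y ^+ n * [~ y, x] ^+ n.
  by rewrite -mulgA (commgC (y ^+ n)) commgX // !mulgA.
rewrite [LHS]expgSr IHn !mulgA zx yx !zy -(mulgA _ ([~ _, _] ^+ n)) -expgnDr.
by rewrite (binS n 1) bin1 (addnC n) (expgSr x) (expgSr y) !mulgA.
Qed.

Lemma expMg_class3 x c f g n : [~ c, x] = f -> [~ f, x] = g -> commute f c ->
  commute g x -> commute g c -> commute g f ->
  (x * c) ^+ n = x ^+ n * c ^+ n * f ^+ 'C(n, 2) * g ^+ 'C(n, 3).
Proof.
move=> fE gE fc gx gc gf; elim: n => [|n IHn]; first by rewrite !mulg1.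
have cx t : t * c ^+ n * x = t * x * c ^+ n * f ^+ n.
  by rewrite -mulgA (commgC (c ^+ n)) commgX fE ?mulgA //; apply: commute_sym.
have fx t a : t * f ^+ a * x = t * x * f ^+ a * g ^+ a.
  by rewrite -mulgA (commgC (f ^+ a)) commgX gE ?mulgA //; apply: commute_sym.
have gx' t a : t * g ^+ a * x = t * x * g ^+ a by apply/commuteA/commute_sym/commuteX/commute_sym.
have gc' t a : t * g ^+ a * c = t * c * g ^+ a by apply/commuteA/commute_sym/commuteX/commute_sym.
have fc' t a : t * f ^+ a * c = t * c * f ^+ a by apply/commuteA/commute_sym/commuteX/commute_sym.
have gf' t a b : t * g ^+ a * f ^+ b = t * f ^+ b * g ^+ a.
  by apply/commuteA/commuteX/commute_sym/commuteX/commute_sym.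
rewrite [LHS]expgSr IHn !mulgA !(gx', fx, cx, gc', fc').
rewrite -(mulgA _ (f ^+ n)) -expgnDr -(mulgA _ (g ^+ _)) -expgnDr.
by rewrite (binS n 1) (binS n 2) bin1 (addnC n 'C(n, 2)) (addnC 'C(n, 2) 'C(n,
  3)) (expgSr x) (expgSr c) !mulgA.
Qed.
End Powers.

Section DerivedExponent.
Variable G : groupType.
Implicit Types x y c d g : G.

Definition derived : G -> Prop := gen (fun g => exists x y, g = [~ x, y]).

Lemma derivedR x y : derived [~ x, y]. Proof. by apply: gen_in; exists x, y. Qed.

Lemma derived_sub : is_sub derived. Proof. exact: gen_sub. Qed.

(** Under the first two hypotheses the [n]-th power map is multiplicative on elements of exponent
    [n], so single commutators suffice. *)
Lemma derived_exp n : (forall c d, derived c -> derived d -> commute c [~ d, c]) ->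
  (forall c d, derived c -> derived d -> [~ d, c] ^+ 'C(n, 2) = 1) ->
  (forall x y, [~ x, y] ^+ n = 1) -> forall g, derived g -> g ^+ n = 1.
Proof.
move=> cl2 clB Rn; have [D1 DM DV] := derived_sub => g Dg.
suff [] : derived g /\ g ^+ n = 1 by [].
apply: (@gen_min _ _ (fun g => derived g /\ g ^+ n = 1)) Dg; last first.
  by move=> _ [x [y ->]]; split; [exact: derivedR|exact: Rn].
split=> [|x y [Dx xn] [Dy yn]|x [Dx xn]].
- by rewrite expg1n.
- split; first exact: DM.
  rewrite expMg_class2 ?xn ?yn ?clB ?mulg1 //; first exact: cl2.
  by rewrite -invgR; apply/commuteV/cl2.
- by split; [exact: DV|exact: expgV1].
Qed.
End DerivedExponent.

Section CentralExtension.
Variables (E G : groupType) (f : E -> G) (n : nat).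
Hypotheses (fM : {morph f : x y / x * y}) (n0 : (0 < n)%N) (Gn : forall g : G, g ^+ n = 1).
Hypothesis kerC : forall x, f x = 1 -> forall y, commute x y.
Implicit Types x y z c d u v : E.

Definition fcentral z := forall g : G, commute (f z) g.

Lemma fcentral_R z x y : fcentral z -> commute [~ z, x] y.
Proof. by move=> fz; apply: kerC; rewrite (morR fM) commg_eq1. Qed.

(** The commutators [[~ z, w]] are central, so conjugating [z] by [u * v] and by [v * u] has the
    same effect: the second centre centralises commutators. *)
Lemma fcentral_commute z x y : fcentral z -> commute z [~ x, y].
Proof.
move=> fz.
have main u v : z ^ (u * v) = z ^ (v * u).
  have zJ w t : (z ^ w) ^ t = z * [~ z, t] * [~ z, w].
    by rewrite (conjg_mulR z w) conjMg (conjg_mulR z t) (conjg_id (fcentral_R w t fz)).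
  by rewrite !conjgM !zJ; apply: commuteA; exact: fcentral_R.
apply/commgP/conjg_fixP.
have -> : [~ x, y] = x^-1 * y^-1 * (y^-1 * x^-1)^-1 by rewrite /commg /conjg !gnorm.
by rewrite conjgM main conjgK.
Qed.

Lemma fcentral_derived z g : fcentral z -> derived g -> commute z g.
Proof.
move=> fz; apply: (@gen_min _ _ (fun g => commute z g)) => [|_ [x [y ->]]];
  last exact: fcentral_commute.
split=> [|x y|x]; [exact: commute1|exact: commuteM|exact: commuteV].
Qed.

Lemma central_power x y : commute (x ^+ n) y.
Proof. by apply: kerC; rewrite (morX fM) Gn. Qed.

Lemma conj_power_n x y : (x * [~ x, y]) ^+ n = x ^+ n.
Proof. by rewrite -conjg_mulR -conjXg conjg_id //; exact: central_power. Qed.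

Lemma derived_exp_abelian : (forall g h : G, commute g h) ->
  forall g : E, derived g -> g ^+ n = 1.
Proof.
move=> abG; have cR x y z : commute [~ x, y] z by apply: fcentral_R => g; exact: abG.
have cD x z : derived x -> commute x z.
  move=> Dx; apply/commute_sym; apply: (@gen_min _ _ (fun x => commute z x)) Dx =>
    [|_ [u [v ->]]].
    split=> [|u v|u]; [exact: commute1|exact: commuteM|exact: commuteV].
  exact/commute_sym.
apply: derived_exp => [c d Dc Dd|c d Dc Dd|x y].
- exact: cD.
- by rewrite commg_eq1 ?expg1n //; exact: cD.
- rewrite -commgX; last exact: commute_sym (cR _ _ _).
  by apply: commg_eq1; exact: central_power.
Qed.

Lemma coprime_central p (g : G) : coprime p n -> (forall h, commute (g ^+ p) h) ->
  forall h, commute g h.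
Proof.
move=> co gp h; have [p0|p0] := posnP p.
  move: co; rewrite p0 /coprime gcd0n => /eqP n1.
  by move: (Gn g); rewrite n1 expg1 => ->; apply/commute_sym/commute1.
case: (egcdnP n p0) => u v; move: co; rewrite /coprime => /eqP-> uv _.
have gE : (g ^+ p) ^+ u = g.
  by rewrite -expgnA (mulnC p) uv expgnDr (mulnC v) expgnA Gn expg1n mul1g.
rewrite -gE; apply: commute_sym; apply: commuteX; apply: commute_sym; exact: gp.
Qed.

(** Bezout: [k * (n %/ p) = p * j + 1]. The power of [x] with exponent [k * (n %/ p)] has image of
    order dividing [p], and the complementary factor is a [p]-th power, hence central in [G]. *)
Lemma fcentral_reduce p x : (forall g h : G, commute (g ^+ p) h) -> coprime (n %/ p) p ->
  p %| n -> exists u z, [/\ x = u * z, fcentral z & f u ^+ p = 1].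
Proof.
move=> Gp co pn; have m0 : (0 < n %/ p)%N by rewrite divn_gt0 ?(dvdn_gt0 n0 pn) // (dvdn_leq n0
  pn).
case: (egcdnP p m0) => k j; move: co; rewrite /coprime => /eqP-> kE _.
exists (x ^+ (k * (n %/ p))), (x ^- (p * j)); split.
- by rewrite kE (addnC _ 1%N) expgnDr expg1 (mulnC j) mulgK.
- by move=> g; rewrite (morV fM) (morX fM) expgnA; apply: commute_sym; apply: commuteV;
  apply: commuteX; apply: commute_sym; exact: Gp.
- by rewrite (morX fM) -expgnA -mulnA divnK // (mulnC k) expgnA Gn expg1n.
Qed.

Lemma commg_fcentralR x y u z v z' : x = u * z -> y = v * z' -> fcentral z -> fcentral z' ->
  [~ x, y, x] = [~ u, v, u] /\ [~ x, y, x, x] = [~ u, v, u, u].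
Proof.
move=> -> -> fz fz'.
have Rz c d : [~ c, d, z] = 1 by apply/commg_eq1/commute_sym/fcentral_commute.
have RzJ c d : [~ c, d] ^ z = [~ c, d] by apply/conjg_id/commute_sym/fcentral_commute.
have cu w : commute [~ u, z'] w.
  by rewrite -(invgR z' u); apply: commute_sym; apply: commuteV; exact/commute_sym/fcentral_R.
have uvE : [~ u * z, v * z'] = [~ u, v] * ([~ u, z'] * [~ z, v * z']).
  rewrite commg_mulL RzJ (commg_mulR u) (conjg_id (commute_sym (fcentral_commute u v fz'))).
  by rewrite (mulgA [~ u, v]) (cu [~ u, v]).
have cR w : commute ([~ u, z'] * [~ z, v * z']) w.
  by apply: commute_sym; apply: commuteM; apply: commute_sym; [exact: cu|exact: fcentral_R].
have R2 w : [~ [~ u * z, v * z'], w] = [~ u, v, w].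
  rewrite uvE commg_mulL (commg_eq1 (cR w)) mulg1 conjg_id //; exact/commute_sym/cR.
have zK c d : [~ c, d, u * z] = [~ c, d, u].
  by rewrite (commg_mulR [~ c, d] u z) Rz mul1g RzJ.
have E1 : [~ u * z, v * z', u * z] = [~ u, v, u] by rewrite R2 zK.
by split=> //; rewrite E1 zK.
Qed.

Lemma derived_exp2 : (forall g h : G, commute (g ^+ 2) h) ->
  forall g : E, derived g -> g ^+ n = 1.
Proof.
move=> G2; have [co|] := boolP (coprime 2 n).
  by apply: derived_exp_abelian => g; apply: (coprime_central co).
rewrite coprime2n => n_even; have {}n_even : ~~ odd n by [].
have sqC x : fcentral (x ^+ 2) by move=> g; rewrite (morX fM); exact: G2.
have GR (g h : G) t : commute [~ g, h] t.
  have -> : [~ g, h] = (g^-1) ^+ 2 * (g * h^-1) ^+ 2 * h ^+ 2.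
    by rewrite !expg2 /commg /conjg !gnorm.
  by apply: commute_sym; apply: commuteM; [apply: commuteM|]; apply: commute_sym; exact: G2.
have RC x y : fcentral [~ x, y] by move=> g; rewrite (morR fM); exact: GR.
have cD c d : derived c -> derived d -> commute c d.
  move=> Dc Dd; apply/commute_sym; apply: (@gen_min _ _ (fun c => commute d c)) Dc =>
    [|_ [x [y ->]]].
    split=> [|x y|x]; [exact: commute1|exact: commuteM|exact: commuteV].
  by apply/commute_sym; apply: fcentral_derived Dd.
(* [[~ x, y] ^+ 2] maps to [[~ f x ^+ 2, f y] = 1], so it is central. *)
have RR x y : [~ x, y, x] ^+ 2 = 1.
  have cR : commute [~ x, y] [~ x, y, x] by exact/commute_sym/fcentral_R.
  rewrite -commgX //; apply: commg_eq1; apply: kerC; rewrite (morX fM) (morR fM).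
  have cg (g h : G) : commute g [~ g, h] by exact: commute_sym (GR _ _ _).
  by rewrite -commgX //; apply: commg_eq1; exact: G2.
have RXE x y k : [~ x ^+ k, y] = [~ x, y] ^+ k * [~ x, y, x] ^+ 'C(k, 2).
  rewrite commgEl conjXg conjg_mulR expMg_class2; first by rewrite -mulgA mulKg.
    by apply/commute_sym/fcentral_R.
  by apply/commute_sym/fcentral_R.
have Rn x y : [~ x, y] ^+ n = [~ x, y, x] ^- 'C(n, 2).
  apply: (mulIg ([~ x, y, x] ^+ 'C(n, 2))); rewrite mulVg -RXE.
  by apply: commg_eq1; exact: central_power.
apply: derived_exp => [c d Dc Dd|c d Dc Dd|x y].
- by rewrite (commg_eq1 (cD _ _ Dd Dc)); exact: commute1.
- by rewrite (commg_eq1 (cD _ _ Dd Dc)) expg1n.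
rewrite Rn; have [n4|] := boolP (4 %| n).
  have -> : 'C(n, 2) = (2 * (n %/ 4 * n.-1))%N.
    by rewrite bin2 -{1}(divnK n4); lia.
  by rewrite expgnA RR expg1n invg1.
move=> n4; set m := n./2.
have nE : n = (2 * m)%N by rewrite /m; lia.
have m_odd : odd m by rewrite /m; lia.
suff -> : [~ x, y, x] = 1 by rewrite expg1n invg1.
have co : coprime (n %/ 2) 2 by rewrite coprimen2 divn2.
have d2 : 2 %| n by rewrite nE dvdn_mulr.
have [u [z [xE fz u2]]] := fcentral_reduce x G2 co d2.
have [v [z' [yE fz' v2]]] := fcentral_reduce y G2 co d2.
have [-> _] := commg_fcentralR xE yE fz fz'.
apply: commg_eq1; apply: kerC; rewrite (morR fM).
(* As a square, [[~ f u, f v]] is killed by [m = n./2]; it is also killed by 2, and [m] is odd. *)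
have RE : [~ f u, f v] = (f u * f v) ^+ 2.
  by rewrite /commg /conjg expg2 (sqrg_inv u2) (sqrg_inv v2) !mulgA.
have R2 : [~ f u, f v] ^+ 2 = 1.
  by rewrite -commgX ?u2 ?comm1g //; exact: commute_sym (GR _ _ _).
have Rm : [~ f u, f v] ^+ m = 1 by rewrite RE -expgnA -nE Gn.
have mE : m = (2 * m./2 + 1)%N by lia.
by rewrite -Rm [in RHS]mE expgnDr expgnA R2 expg1n mul1g expg1.
Qed.
End CentralExtension.

Lemma odd_dvd_bin2 d n : odd d -> d %| n -> d %| 'C(n, 2).
Proof.
move=> odd_d dn; rewrite -(@Gauss_dvdr d 2) ?coprimen2 //.
by rewrite -mul_bin_diag dvdn_mulr.
Qed.

Section CentralCubes.
Variable G : groupType.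
Hypothesis cube_central : forall g h : G, commute (g ^+ 3) h.
Implicit Types x y z t u c d : G.

Lemma center_sub : is_sub (fun z : G => forall t, commute z t).
Proof.
split=> [t|x y cx cy t|x cx t]; apply: commute_sym.
- exact: commute1.
- by apply: commuteM; apply: commute_sym.
- by apply: commuteV; apply: commute_sym.
Qed.

Lemma center_normed z h : (forall t, commute z t) -> forall t, commute (z ^ h) t.
Proof. by move=> cz t; rewrite conjg_id. Qed.

Lemma cube_central_R x y z u : (forall t, commute [~ x, y, x] t) /\
  (forall t, commute [~ [~ x, y], [~ z, u]] t).
Proof.
have [Q [f [fM fS /= f1]]] := exists_quotient (NormalSub center_sub center_normed).
have Q3 (q : Q) : q ^+ 3 = 1.
  by have [v ->] := fS q; rewrite -(morX fM); apply/f1; exact: cube_central.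
split; apply/f1; rewrite !(morR fM); last exact: exp3_R2R2.
by apply: commg_eq1; apply: commute_sym; exact: exp3_commRl.
Qed.

Lemma cube_central_Rl x y t : commute [~ x, y, x] t.
Proof. by have [] := cube_central_R x y 1 1. Qed.

Lemma cube_central_Rr x y t : commute [~ x, y, y] t.
Proof.
have -> : [~ x, y, y] = ([~ y, x, y]^-1) ^ [~ x, y].
  by rewrite -(invgR y x) /commg /conjg !gnorm.
rewrite conjVg conjg_id; last exact: cube_central_Rl.
by apply: commute_sym; apply: commuteV; apply: commute_sym; exact: cube_central_Rl.
Qed.

Lemma cube_central_R_cube u d : u ^+ 3 = 1 ->
  [~ u, d, u] ^+ 3 = 1 /\ [~ u, d] ^+ 3 = 1.
Proof.
move=> u3; set c := [~ u, d].
have f3 : [~ c, u] ^+ 3 = 1.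
  rewrite -commgX; last exact: commute_sym (cube_central_Rl _ _ _).
  by apply: commg_eq1; exact: cube_central.
split=> //.
have : (u * c) ^+ 3 = 1 by rewrite -conjg_mulR -conjXg u3 conj1g.
rewrite expMg_class2; try exact: commute_sym (cube_central_Rl _ _ _).
by rewrite u3 mul1g f3 mulg1.
Qed.

Lemma mul_cube_central u d : u ^+ 3 = 1 -> d ^+ 3 = 1 ->
  (u * d^-1) ^+ 3 = [~ u, d, u] * [~ u, d, d].
Proof.
move=> u3 d3; have [f3 c3] := cube_central_R_cube d u3.
have cf t : commute [~ u, d, u] t := cube_central_Rl u d t.
have ce t : commute [~ u, d, d] t := cube_central_Rr u d t.
have uJ : u ^ d = u * [~ u, d] := conjg_mulR u d.
have cJ : [~ u, d] ^ d = [~ u, d] * [~ u, d, d] := conjg_mulR _ d.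
have cJu : [~ u, d] ^ u = [~ u, d] * [~ u, d, u] := conjg_mulR _ u.
have -> : (u * d^-1) ^+ 3 = u * u ^ d * (u ^ d) ^ d.
  by rewrite expg3E /conjg !gnorm (cube_sqrA _ d3).
move: cJ cJu cf ce c3; rewrite uJ; move: [~ u, d, u] [~ u, d, d] => F e.
move: [~ u, d] uJ => c uJ cJ cJu cf ce c3.
rewrite (conjMg u c) uJ cJ.
have cu t : t * c * u = t * u * c * F by rewrite -mulgA (conjgC c u) cJu !mulgA.
have Fc t : t * F * c = t * c * F by exact/commuteA/cf.
rewrite !mulgA cu !Fc -expg3E u3 mul1g; congr (_ * _).
by rewrite -[RHS]mul1g -c3 expg3E.
Qed.

(** [[~ u, d, u] * [~ u, d, d]] is the cube of [u * d^-1], so it is killed by both 3 and [k].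
    Replacing [d] by [d^-1] inverts the first factor and keeps the second, so the first has square 1
    as well as cube 1. *)
Lemma cube_central_coprime k u d : coprime k 3 -> u ^+ 3 = 1 -> d ^+ 3 = 1 ->
  (forall g : G, g ^+ (3 * k) = 1) -> [~ u, d, u] = 1.
Proof.
move=> co u3 d3 G3k.
have k0 : (0 < k)%N by case: k co {G3k}.
have cop (g : G) : g ^+ 3 = 1 -> g ^+ k = 1 -> g = 1.
  move=> g3 gk; case: (egcdnP 3 k0) => i j; move: co; rewrite /coprime => /eqP-> ij _.
  have : g ^+ (i * k) = 1 by rewrite mulnC expgnA gk expg1n.
  by rewrite ij expgnDr (mulnC j) expgnA g3 expg1n mul1g.
have fe (v : G) : v ^+ 3 = 1 -> [~ u, v, u] * [~ u, v, v] = 1.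
  move=> v3; apply: cop; last by rewrite -mul_cube_central // -expgnA G3k.
  have [f3 c3] := cube_central_R_cube v u3.
  rewrite expgMn ?f3; last exact: cube_central_Rl.
  rewrite mul1g -commgX; last exact: commute_sym (cube_central_Rr _ _ _).
  by rewrite c3 comm1g.
have [f3 c3] := cube_central_R_cube d u3.
have cf t : commute [~ u, d, u] t := cube_central_Rl u d t.
have ce t : commute [~ u, d, d] t := cube_central_Rr u d t.
have cE : [~ u, d^-1] = [~ u, d]^-1 * [~ u, d, d].
  have -> : [~ u, d^-1] = ([~ u, d] ^ d^-1)^-1 by rewrite /commg /conjg !gnorm.
  have : ([~ u, d] * [~ u, d, d]) ^ d^-1 = [~ u, d] by rewrite -conjg_mulR conjgK.
  rewrite conjMg (conjg_id (ce _)) => {2}<-.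
  move: ([~ u, d] ^ d^-1) [~ u, d, d] ce => X e ce.
  by rewrite invgM -mulgA -(ce X^-1) mulgA mulVg mul1g.
have cR t : [~ [~ u, d]^-1 * [~ u, d, d], t] = [~ [~ u, d]^-1, t].
  by rewrite commg_mulL (commg_eq1 (ce _)) mulg1 conjg_id //; exact: commute_sym.
have := fe _ (expgV1 d3); rewrite cE !cR commVg; last exact: commute_sym (cf _).
rewrite (@commg_classV _ [~ u, d] d); try exact: commute_sym (ce _).
have := fe _ d3; move: [~ u, d, u] f3 [~ u, d, d] => F f3 e Fe FVe.
apply: sqr_cube1 => //; apply: (mulIg e); rewrite expg2 -mulgA Fe mulg1 mul1g.
by rewrite -(mulKVg F e) FVe mulg1.
Qed.
End CentralCubes.

Section Exp3Extension.
Variables (E G : groupType) (f : E -> G) (n : nat).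
Hypotheses (fM : {morph f : x y / x * y}).
Hypotheses (n0 : (0 < n)%N) (Gn : forall g : G, g ^+ n = 1).
Hypothesis kerC : forall x, f x = 1 -> forall y, commute x y.
Hypothesis cube_central_G : forall g h : G, commute (g ^+ 3) h.
Implicit Types x y z c d u v : E.

Lemma derived_exp3 (g : E) : derived g -> g ^+ n = 1.
Proof.
have [co|nco] := boolP (coprime 3 n).
  by apply: (derived_exp_abelian fM) => // h; apply: (coprime_central _ co).
have n3 : 3 %| n by move: nco; rewrite prime_coprime // negbK.
have cubeC x : fcentral f (x ^+ 3) by move=> h; rewrite (morX fM); exact: cube_central_G.
have R3C x y : fcentral f [~ x, y, x] by move=> h; rewrite !(morR fM); exact: cube_central_Rl.
have DDC c d : derived c -> derived d -> fcentral f [~ c, d].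
  move=> Dc Dd h; move: h.
  have sK : is_sub (fun x => fcentral f x).
    have [C1 CM CV] := center_sub G; split=> [h|x y cx cy h|x cx h].
    - by rewrite (mor1 fM); exact: C1.
    - by rewrite fM; exact: CM.
    - by rewrite (morV fM); exact: CV.
  have nK h x : fcentral f x -> fcentral f (x ^ h).
    by move=> cx t; rewrite /conjg !fM (morV fM) (cx (f h)) mulKg.
  apply: (gen_commg sK) Dc Dd => [x h cx _|_ _ [x [y ->]] [z [u ->]] h]; first exact: nK.
  by rewrite !(morR fM); have [_] := cube_central_R cube_central_G (f x) (f y) (f z) (f u).
have C2_3 : exists k, 'C(n, 2) = (3 * k)%N.
  by have /dvdnP[k ->] := odd_dvd_bin2 (isT : odd 3) n3; exists k; rewrite mulnC.
have cZD := fcentral_derived fM kerC.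
apply: derived_exp => [c d Dc Dd|c d Dc Dd|x y].
- by apply: commute_sym; apply: cZD => //; exact: DDC.
- have [k ->] := C2_3; rewrite expgnA -commgX; last first.
    by apply: commute_sym; apply: cZD => //; exact: DDC.
  rewrite commg_eq1 ?expg1n //; apply: cZD => //; exact: cubeC.
set c := [~ x, y]; set F := [~ c, x]; set g' := [~ F, x].
have FC : fcentral f F by exact: R3C.
have Fc : commute F c by exact: (fcentral_commute fM kerC).
have gC t : commute g' t by exact: fcentral_R.
have F3C t : commute (F ^+ 3) t.
  by rewrite -commgX; [apply: fcentral_R => //; exact: cubeC|exact: commute_sym].
have g3 : g' ^+ 3 = 1.
  by rewrite -commgX; [apply: commg_eq1; exact: F3C|exact: commute_sym].
have eE : [~ x, c] = F^-1 by rewrite /F invgR.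
have eR : [~ [~ x, c], x] = g'^-1 by rewrite eE commVg //; exact: commute_sym.
(* [x ^+ 3] has central image, so conjugation by [c] fixes it; expanding the cube of [x ^ c]
   isolates [F ^+ 3]. *)
have F3 : F ^+ 3 = 1.
  have : (x * [~ x, c]) ^+ 3 = x ^+ 3.
    rewrite -conjg_mulR -conjXg conjg_id //.
    by apply: (fcentral_commute fM kerC); exact: cubeC.
  rewrite expMg_class2 eR; try by apply: commuteV; exact: commute_sym.
  rewrite expVgn g3 invg1 mulg1 eE -[RHS]mulg1 => /mulgI.
  by rewrite expVgn => /eqP; rewrite invg_eq1 => /eqP.
have : c ^+ n * F ^+ 'C(n, 2) * g' ^+ 'C(n, 3) = 1.
  apply: (mulgI (x ^+ n)); rewrite mulg1 !mulgA.
  rewrite -(@expMg_class3 _ x c F g' n) //; exact: (conj_power_n fM).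
have [k ->] := C2_3; rewrite expgnA F3 expg1n mulg1.
(* For [n] divisible by 3, ['C(n, 3)] is a multiple of 3 only when 9 divides [n]; otherwise [g']
   itself must vanish. *)
have [/dvdnP[j nE]|n9] := boolP (9 %| n).
  have /dvdnP[i ->] : 3 %| 'C(n, 3).
    rewrite -(@dvdn_pmul2l 3) // -mul_bin_diag nE; apply: dvdn_mulr.
    by apply/dvdnP; exists j.
  by rewrite mulnC expgnA g3 expg1n mulg1.
suff -> : g' = 1 by rewrite expg1n mulg1.
have co : coprime (n %/ 3) 3.
  rewrite coprime_sym prime_coprime //; apply: contra n9 => /dvdnP[j jE].
  by rewrite -(divnK n3) jE -mulnA dvdn_mull.
have [u [z [xE fz u3]]] := fcentral_reduce fM n0 Gn x cube_central_G co n3.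
have [v [z' [yE fz' v3]]] := fcentral_reduce fM n0 Gn y cube_central_G co n3.
rewrite /g' /F /c; have [_ ->] := commg_fcentralR fM kerC xE yE fz fz'.
apply: commg_eq1; apply: kerC; rewrite !(morR fM).
apply: (cube_central_coprime cube_central_G co) => // h.
by rewrite mulnC divnK.
Qed.
End Exp3Extension.

(** * Abelian Frattini subgroup *)

Import GRing.Theory.

Lemma sum_blocks (V : zmodType) (F : nat -> V) p m :
  (\sum_(i < p * m) F i = \sum_(r < p) \sum_(j < m) F (r + p * j)%N)%R.
Proof.
elim: m => [|m IHm].
  by rewrite muln0 big_ord0 big1 // => r _; rewrite big_ord0.
rewrite mulnS (addnC p) big_split_ord /= IHm -big_split /=.
by apply: eq_bigr => r _; rewrite big_ord_recr /= addnC.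
Qed.

Lemma sum_dilate (V : zmodType) (F : nat -> V) p r :
  prime p -> (0 < r < p)%N -> (forall k, F (k %% p)%N = F k) ->
  (\sum_(b < p) F (b * r)%N = \sum_(b < p) F b)%R.
Proof.
move=> pr_p /andP[r0 rp] Fp; have p0 := prime_gt0 pr_p.
pose h (b : 'I_p) := Ordinal (ltn_pmod (b * r) p0).
have h_inj : injective h.
  move=> b c /(congr1 val) /= bc; apply: val_inj => /=.
  wlog le_cb : b c bc / c <= b.
    by move=> W; case/orP: (leq_total b c) => ?; [symmetry|]; apply: W.
  move/eqP: bc; rewrite eqn_mod_dvd ?leq_mul2r ?le_cb ?orbT // -mulnBl.
  rewrite Euclid_dvdM // [p %| r]gtnNdvd // orbF => pbc.
  apply/eqP; rewrite eqn_leq le_cb andbT -subn_eq0.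
  move: pbc; have [//|sb pbc] := posnP (b - c); have := dvdn_leq sb pbc.
  by have := ltn_ord b; lia.
by rewrite [RHS](reindex_inj h_inj) /=; apply: eq_bigr => b _; rewrite Fp.
Qed.

Section AbelianFrattini.
Import FiniteModule.
Variables (gT : finGroupType) (U : {group gT}) (abU : abelian U) (p m : nat).
Hypotheses (pr_p : prime p) (odd_m : odd m) (nU : [set: gT] \subset 'N(U)).
Hypotheses (UR : forall g h : gT, [~ g, h] \in U) (UX : forall g : gT, g ^+ p \in U).
Hypothesis Gn : forall g : gT, g ^+ (p * m) = 1.
Implicit Types x y g h : gT.

Let nUg g : g \in 'N(U). Proof. by apply: (subsetP nU); rewrite inE. Qed.

Let act_id (u : fmod_of abU) h : h \in U -> (u ^@ h = u)%R.
Proof.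
move=> Uh; apply: val_inj; rewrite [LHS]fmvalJ //.
by apply: conjg_id; apply: (centsP abU) => //; exact: fmodP.
Qed.

Let actX (u : fmod_of abU) y r j : (u ^@ (y ^+ (r + p * j)) = u ^@ (y ^+ r))%R.
Proof. by rewrite expgnDr actrM // expgnA [LHS]act_id // groupX. Qed.

(** In the additive module [U] these form a cocycle along the powers of [x] ([sD]), on which
    [x ^+ p] acts trivially because it lies in the abelian group [U]. *)
Let s x y k : fmod_of abU := fmod abU [~ x ^+ k, y].

Let s0 x y : s x y 0 = 0%R.
Proof. by rewrite /s expg0 comm1g fmod1. Qed.

Let sD x y k l : (s x y (k + l) = s x y k ^@ (x ^+ l) + s x y l)%R.
Proof.
by rewrite /s -fmodJ // -fmodM ?UR ?memJ_norm ?UR // expgnDr commMgJ.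
Qed.

Let sM x y j : (s x y (p * j) = s x y p *+ j)%R.
Proof.
elim: j => [|j IHj]; first by rewrite muln0 s0.
by rewrite mulnS addnC sD IHj act_id // mulrSr.
Qed.

Let sp0 x y : (s x y p *+ m = 0)%R.
Proof. by rewrite -sM /s Gn comm1g fmod1. Qed.

Let sper x y r j : (s x y (r + p * j) = s x y r + s x y p *+ j)%R.
Proof. rewrite sD sM expgnA act_id. by []. exact: groupX. Qed.

Let sper_m x y k : (s x y (k %% p) *+ m = s x y k *+ m)%R.
Proof.
rewrite {2}(divn_eq k p) (addnC (_ * p)%N) (mulnC _ p) sper mulrnDl.
by rewrite -mulrnA mulnC mulrnA sp0 mul0rn addr0.
Qed.

(** This is the [U]-component of [(y * u) ^+ (p * m) = 1]: the powers of [y] act with period [p], so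
    the norm is repeated [m] times. *)
Let norm0 (u : fmod_of abU) y : ((\sum_(r < p) u ^@ (y ^+ r)) *+ m = 0)%R.
Proof.
have key k : (y * val u) ^+ k = y ^+ k * val (\sum_(i < k) u ^@ (y ^+ i))%R.
  elim: k => [|k IHk]; first by rewrite big_ord0 mulg1.
  have -> : (\sum_(i < k.+1) u ^@ (y ^+ i) = (\sum_(i < k) u ^@ (y ^+ i)) ^@ y + u)%R.
    rewrite big_ord_recl /= actr1 addrC actr_sum; congr (_ + _)%R.
    by apply: eq_bigr => i _; rewrite -actrM // -expgSr.
  rewrite expgSr IHk fmvalA fmvalJ // expgSr; move: (\sum_(i < k) _)%R => v.
  have swap (a b c : gT) : a * b * (y * c) = a * y * (b ^ y * c).
    by rewrite /conjg !gnorm.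
  exact: swap.
have := key (p * m)%N; rewrite !Gn mul1g (sum_blocks (fun i => u ^@ (y ^+ i))%R) => /esym v1.
apply: val_inj; rewrite fmval0 -[RHS]v1; congr val.
rewrite -sumrMnl; apply: eq_bigr => r _.
under eq_bigr => j _ do rewrite actX.
by rewrite sumr_const card_ord.
Qed.

(** The [U]-component of [(x ^+ b * y) ^+ (p * m) = 1], cut into [m] blocks of length [p]. The drift
    between blocks adds up to a multiple of ['C(m, 2)] times [s x y p], which vanishes because [m]
    is odd. *)
Let twisted0 x y b : (\sum_(r < p) (s x y (b * r) *+ m) ^@ (y ^+ r) = 0)%R.
Proof.
set X := x ^+ b.
have key k : (X * y) ^+ k =
    X ^+ k * (y ^+ k * (val (\sum_(i < k) s x y (b * i) ^@ (y ^+ i))%R)^-1).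
  elim: k => [|k IHk]; first by rewrite big_ord0 invg1 !mulg1.
  rewrite expgS IHk big_ord_recr /= fmvalA invgM fmvalJ // fmodK // expgnA -/X.
  have step (a d v : gT) : X * a = a * X -> y * d = d * y ->
      X * y * (a * (d * v)) = a * X * (d * y * (([~ a, y] ^ d)^-1 * v)).
    by move=> aX dY; rewrite -dY -aX -conjVg invgR /commg /conjg !gnorm.
  by rewrite (expgSr X) (expgSr y); apply: step; [rewrite -expgS expgSr|rewrite -expgS expgSr].
have := key (p * m)%N; rewrite !Gn !mul1g (sum_blocks (fun i =>
  s x y (b * i) ^@ (y ^+ i))%R) => /esym /(canRL invgK) v1.
apply: val_inj; rewrite fmval0 -[RHS](invg1 gT) -[RHS]v1; congr val.
apply: eq_bigr => r _; under eq_bigr => j _ do rewrite actX.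
rewrite -(actr_sum (y ^+ r)); congr (_ ^@ _)%R.
under eq_bigr => j _ do rewrite mulnDr mulnCA sper.
rewrite big_split /= sumr_const card_ord.
have -> : (\sum_(j < m) s x y p *+ (b * j) = 0)%R.
  under eq_bigr => j _ do rewrite mulrnA.
  rewrite sumrMnr -(big_mkord xpredT id) bin2_sum.
  have /dvdnP[c ->] := odd_dvd_bin2 odd_m (dvdnn m).
  by rewrite -mulrnA mulnA mulnC mulrnA sp0 mul0rn.
by rewrite addr0.
Qed.

(** Sum [twisted0] over [b]. For [r] nonzero modulo [p], [b * r] runs through all residues and gives
    the conjugate of [T] by [y ^+ r]; [r = 0] gives nothing. Subtracting this from the norm of [T],
    which is 0, leaves [T]. *)
Let sum_s0 x y : (\sum_(k < p) s x y k *+ m = 0)%R.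
Proof.
set T := LHS; have p0 := prime_gt0 pr_p.
have TE : T = ((\sum_(k < p) s x y k) *+ m)%R by rewrite /T sumrMnl.
have N0 : (\sum_(r < p) T ^@ (y ^+ r) = 0)%R.
  under eq_bigr => r _ do rewrite TE actZr.
  by rewrite sumrMnl; exact: norm0.
have : (\sum_(b < p) \sum_(r < p) (s x y (b * r) *+ m) ^@ (y ^+ r) = 0)%R.
  by rewrite big1 // => b _; exact: twisted0.
rewrite exchange_big /= (bigD1 (Ordinal p0)) //= big1 ?add0r => [|b _]; last first.
  by rewrite muln0 s0 mul0rn act0r.
rewrite (eq_bigr (fun r : 'I_p => T ^@ (y ^+ r))%R) => [|r r0].
  by move: N0; rewrite (bigD1 (Ordinal p0)) //= expg0 actr1 => + T0; rewrite T0 addr0.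
rewrite -(actr_sum (y ^+ r)); congr (_ ^@ _)%R.
apply: (sum_dilate (F := fun k => s x y k *+ m)%R) => //.
by rewrite ltn_ord andbT lt0n; exact: r0.
Qed.

(** The order [l] is left free because the lifts to the extension no longer commute, and there two
    orders are compared. *)
Lemma prod_commgX (x y : gT) (l : seq nat) : perm_eq l (iota 0 p) ->
  (\prod_(r <- l) [~ x ^+ r, y]) ^+ m = 1.
Proof.
move=> pl; have valE : \prod_(r <- l) [~ x ^+ r, y] = val (\sum_(r <- l) s x y r)%R.
  elim: l {pl} => [|r l IHl]; first by rewrite !big_nil.
  by rewrite !big_cons [RHS]fmvalA -IHl fmodK.
rewrite valE -fmvalZ -sumrMnl (perm_big _ pl) -{1}(subn0 p).
by rewrite [X in val X](_ : _ = 0%R) // -[RHS](sum_s0 x y) big_mkord.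
Qed.
End AbelianFrattini.

Section AlmostAbelian.
Variables (E : groupType) (M : E -> Prop) (p m : nat).
Hypotheses (sM : is_sub M) (MC : forall u v, M u -> M v -> forall t, commute [~ u, v] t).
Hypotheses (odd_n : odd (p * m)) (Mn : forall u, M u -> forall t, commute (u ^+ (p * m)) t).
Implicit Types u v t x c : E.

Let odd_m : odd m. Proof. by move: odd_n; rewrite oddM => /andP[]. Qed.

Let commgXr u v k : M u -> M v -> [~ u, v] ^+ k = [~ u, v ^+ k].
Proof.
move=> Mu Mv; rewrite -(invgR v u) -(invgR (v ^+ k) u) commgX ?expVgn //.
by apply: commute_sym; apply: MC.
Qed.

Let commgXl u v k : M u -> M v -> [~ u, v] ^+ k = [~ u ^+ k, v].
Proof. by move=> Mu Mv; rewrite commgX //; apply: commute_sym; apply: MC. Qed.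

Let expM u v : M u -> M v -> (forall t, commute (u ^+ m) t) ->
  (u * v) ^+ m = u ^+ m * v ^+ m.
Proof.
move=> Mu Mv um; rewrite expMg_class2; try by apply: commute_sym; apply: MC.
have /dvdnP[k ->] := odd_dvd_bin2 odd_m (dvdnn m).
rewrite mulnC expgnA commgXr // (commg_eq1 (commute_sym (um v))).
by rewrite expg1n mulg1.
Qed.

Variables (x c : E) (S : nat -> E).
Hypotheses (MS : forall k, M (S k)) (S0 : S 0 = 1) (S1 : S 1 = c).
Hypothesis SJ : forall k, S k ^ x = S k.+1 * c^-1.
Hypothesis Spm : S p ^+ m = 1.

Let Mc : M c. Proof. by rewrite -S1. Qed.

Let Qa k := \prod_(r <- iota 0 k) S r.
Let Qd k := \prod_(r <- rev (iota 0 k)) S r.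
Hypotheses (Qam : forall t, commute (Qa p ^+ m) t) (Qdm : forall t, commute (Qd p ^+ m) t).

Let QaS k : Qa k.+1 = Qa k * S k.
Proof. by rewrite /Qa -addn1 iotaD big_cat big_seq1. Qed.

Let QdS k : Qd k.+1 = S k * Qd k.
Proof. by rewrite /Qd -addn1 iotaD rev_cat big_cons. Qed.

Let MQa k : M (Qa k).
Proof.
have [M1 MM _] := sM; elim: k => [|k IHk]; first by rewrite /Qa big_nil.
by rewrite QaS; apply: MM.
Qed.

Let MQd k : M (Qd k).
Proof.
have [M1 MM _] := sM; elim: k => [|k IHk]; first by rewrite /Qd big_nil.
by rewrite QdS; apply: MM.
Qed.

(* Conjugation by [x] turns [S r] into [S r.+1 * c^-1]. Moving the factors [c^-1]
   to the right costs the central factors [za] in the ascending product [Qa] and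
   [zd] in the descending product [Qd]; [za * zd] is a single commutator power. *)
Let Fixpoint za k := if k is j.+1 then za j * [~ S j.+1, c] ^+ j else 1.
Let Fixpoint zd k := if k is j.+1 then zd j * [~ Qd j.+1, c] else 1.

Let RC u t : M u -> commute [~ u, c] t. Proof. by move=> Mu; apply: MC. Qed.

Let zaC k t : commute (za k) t.
Proof.
elim: k => [|k IHk] /=; apply: commute_sym; first exact: commute1.
by apply: commuteM; [|apply: commuteX]; apply: commute_sym; [|apply: RC].
Qed.

Let zdC k t : commute (zd k) t.
Proof.
elim: k => [|k IHk] /=; apply: commute_sym; first exact: commute1.
by apply: commuteM; apply: commute_sym; [|apply: RC].
Qed.

Let zan k : za k ^+ (p * m) = 1.
Proof.
elim: k => [|k IHk] /=; first by rewrite expg1n.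
rewrite expgMn; last exact: zaC.
rewrite IHk mul1g -expgnA mulnC expgnA commgXl // (commg_eq1 (Mn _ _)) //.
by rewrite expg1n.
Qed.

Let RXC u k t : M u -> commute ([~ u, c] ^+ k) t.
Proof. by move=> Mu; rewrite commgXl //; apply: RC; apply: sub_X. Qed.

Let za_zd k : za k.+1 * zd k.+1 = [~ Qd k.+2, c] ^+ k.
Proof.
elim: k => [|k IHk].
  have Qd0 : Qd 0 = 1 by rewrite /Qd big_nil.
  by rewrite /= QdS S0 Qd0 !mul1g comm1g !expg0.
have -> : za k.+2 * zd k.+2 =
    za k.+1 * zd k.+1 * ([~ S k.+2, c] ^+ k.+1 * [~ Qd k.+2, c]).
  rewrite -[za k.+2]/(za k.+1 * [~ S k.+2, c] ^+ k.+1).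
  rewrite -[zd k.+2]/(zd k.+1 * [~ Qd k.+2, c]).
  move: (za k.+1) (zaC k.+1) (zd k.+1) (zdC k.+1) => a aC d dC.
  by rewrite !mulgA -(mulgA a _ d) -(dC ([~ S k.+2, c] ^+ k.+1)) mulgA.
rewrite IHk (QdS k.+2) commg_mulL (conjg_id (RC _ _)) // [in RHS]expgMn; last exact: RC.
rewrite (expgSr [~ Qd k.+2, c]).
have alg (A' B A : E) : (forall t, commute B t) -> A' * (B * A) = B * (A' * A).
  by move=> BC; rewrite mulgA -(BC A') mulgA.
by apply: alg => t; exact: RXC.
Qed.

Let swap u k : M u -> c ^- k * u = u * c ^- k * [~ u, c] ^+ k.
Proof.
move=> Mu; rewrite commgXr //; have uC := MC Mu (sub_X k sM Mc).
rewrite -(mulgA u) -(uC (c ^- k)) mulgA -[u * [~ u, _]]conjg_mulR.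
by rewrite /conjg !gnorm.
Qed.

Let QaJ k : Qa k ^ x = Qa k.+1 * c ^- k * za k.
Proof.
elim: k => [|k IHk].
  by rewrite QaS S0 /Qa big_nil conj1g /= expg0 invg1 !mulg1.
have alg (Q a d s w : E) : (forall t, commute a t) -> (forall t, commute w t) ->
    d * s = s * d * w -> Q * d * a * (s * c^-1) = Q * s * (d * c^-1) * (a * w).
  move=> aC wC ds; rewrite -(mulgA _ a) (aC (s * _)) !mulgA -(mulgA Q) ds.
  by rewrite -!mulgA (wC (c^-1 * a)) !mulgA.
rewrite QaS conjMg IHk SJ (QaS k.+1) expgS invgM /=.
by apply: alg => // [t|]; [exact: RXC|exact: swap].
Qed.

Let QdJ k : Qd k ^ x = Qd k.+1 * c ^- k * zd k.
Proof.
elim: k => [|k IHk].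
  by rewrite QdS S0 /Qd big_nil conj1g /= expg0 invg1 !mulg1.
have alg (Q a d s w : E) : (forall t, commute a t) -> (forall t, commute w t) ->
    c^-1 * Q = Q * c^-1 * w -> s * c^-1 * (Q * d * a) = s * Q * (c^-1 * d) * (a * w).
  move=> aC wC dQ; rewrite -!mulgA (mulgA c^-1) dQ -!mulgA.
  by rewrite (wC (d * a)) !mulgA.
rewrite QdS conjMg IHk SJ (QdS k.+1) expgSr invgM /=.
apply: alg => // [t|]; first exact: RC.
by have := swap 1 (MQd k.+1); rewrite !expg1.
Qed.

(** Take [m]-th powers in the formula for [Q ^ x]: the central [Q ^+ m] is unchanged and [S p]
    contributes nothing, so only powers of [c] and [z] remain. *)
Let main Q z : M Q -> (forall t, commute (Q ^+ m) t) -> (forall t, commute z t) ->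
  Q ^ x = Q * S p * c ^- p * z \/ Q ^ x = S p * Q * c ^- p * z -> c ^+ (p * m) = z ^+ m.
Proof.
move=> MQ Qm zC; have [_ MM MV] := sM; have MX k : M (c ^- k) := MV _ (sub_X k sM Mc).
have mS : (Q * S p) ^+ m = Q ^+ m by rewrite expM // Spm mulg1.
have mS' : (S p * Q) ^+ m = Q ^+ m.
  by rewrite expM // Spm ?mul1g // => t; apply: commute_sym; exact: commute1.
suff key Q' : M Q' -> Q' ^+ m = Q ^+ m -> Q ^ x = Q' * c ^- p * z -> c ^+ (p * m) = z ^+ m.
  by case=> /key; apply=> //; apply: MM.
move=> MQ' Q'm QE; have := conjXg Q x m; rewrite (conjg_id (Qm x)) QE.
rewrite expgMn; last by apply: commute_sym.
have Q'C t : commute (Q' ^+ m) t by rewrite Q'm; exact: Qm.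
rewrite expM // Q'm -mulgA expVgn -expgnA => Qz.
apply: (mulgI (c ^- (p * m))); rewrite mulVg; apply: (mulgI (Q ^+ m)).
by rewrite mulg1.
Qed.

(** By [main], [c ^+ (p * m)] equals both [za p ^+ m] and [zd p ^+ m], so its square is a power of
    [[~ Qd p.+1, c] ^+ m = 1]. It is also killed by the odd number [p], because
    [za p ^+ (p * m) = 1]. *)
Lemma shift_exp : c ^+ (p * m) = 1.
Proof.
have [p' pE] : exists p', p = p'.+1.
  by case: (p) odd_n => // p' _; exists p'.
have Ea : c ^+ (p * m) = za p ^+ m.
  by apply: (main (MQa p) Qam (zaC p)); left; rewrite -QaS.
have Ed : c ^+ (p * m) = zd p ^+ m.
  by apply: (main (MQd p) Qdm (zdC p)); right; rewrite -QdS.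
have c2 : c ^+ (p * m) * c ^+ (p * m) = 1.
  rewrite {1}Ea Ed -expgMn; last exact: zaC.
  rewrite pE za_zd -pE -expgnA mulnC expgnA commgXl // QdS.
  have -> : (S p * Qd p) ^+ m = Qd p ^+ m.
    by rewrite expM // Spm ?mul1g // => t; apply: commute_sym; exact: commute1.
  by rewrite (commg_eq1 (Qdm c)) expg1n.
have cp : (c ^+ (p * m)) ^+ p = 1 by rewrite Ea -expgnA mulnC zan.
have odd_p : odd p by move: odd_n; rewrite oddM => /andP[].
move: (c ^+ (p * m)) c2 cp => g g2; rewrite -(odd_double_half p) odd_p add1n.
by rewrite expgS -mul2n expgnA expg2 g2 expg1n mulg1.
Qed.
End AlmostAbelian.

Section FrattiniExtension.
Variables (E : groupType) (gT : finGroupType) (f : E -> gT) (p : nat).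
Hypothesis fM : {morph f : x y / x * y}.
Hypothesis kerC : forall x, f x = 1 -> forall y, commute x y.
Hypotheses (pr_p : prime p) (odd_p : odd p) (pG : p.-group [set: gT]).
Hypothesis abPhi : abelian 'Phi([set: gT]).

Lemma derived_expPhi n (g : E) : (0 < n)%N -> (forall h : gT, h ^+ n = 1) ->
  n %| #|gT| -> derived g -> g ^+ n = 1.
Proof.
move=> n0 Gn nG Dg.
have : p.-nat n by apply: pnat_dvd nG _; rewrite -cardsT.
case/p_natP=> e nE; case: e nE => [|e] nE.
  have Gn1 (h : gT) : h = 1 by rewrite -(expg1 h) -[1%N]/(p ^ 0)%N -nE.
  by apply: (derived_exp_abelian fM Gn kerC) Dg => a b; rewrite (Gn1 a) (Gn1 b).
have odd_n : odd n by rewrite nE oddX odd_p orbT.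
rewrite expnS in nE; move: (p ^ e)%N nE => m nE.
have UR (h k : gT) : [~ h, k] \in 'Phi([set: gT]).
  by rewrite (Phi_joing pG) (subsetP (joing_subl _ _)) // mem_commg ?inE.
have UX (h : gT) : h ^+ p \in 'Phi([set: gT]).
  rewrite (Phi_joing pG) (subsetP (joing_subr _ _)) // -[p]expn1.
  by apply: Mho_p_elt; rewrite ?inE //; apply: mem_p_elt pG _; rewrite inE.
pose M x := f x \in 'Phi([set: gT]).
have sM : is_sub M.
  rewrite /M; split=> [|x y|x]; first by rewrite (mor1 fM) group1.
    by rewrite fM; exact: groupM.
  by rewrite (morV fM) groupV.
have MC u v : M u -> M v -> forall t, commute [~ u, v] t.
  move=> Mu Mv; apply: (kerC); rewrite (morR fM); apply: commg_eq1.
  exact: (centsP abPhi).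
have DM d : derived d -> M d.
  apply: (@gen_min _ _ M) => // _ [x [y ->]]; rewrite /M (morR fM); exact: UR.
have nC (x t : E) : commute (x ^+ n) t by apply: (kerC); rewrite (morX fM) Gn.
apply: derived_exp Dg => [c d Dc Dd|c d Dc Dd|x y].
- by apply: commute_sym; apply: MC; exact: DM.
- have /dvdnP[k ->] := odd_dvd_bin2 odd_n (dvdnn n).
  rewrite mulnC expgnA -commgX; last by apply: commute_sym; apply: MC; exact: DM.
  by rewrite (commg_eq1 (nC _ _)) expg1n.
have gE r : f [~ x ^+ r, y] = [~ f x ^+ r, f y] by rewrite (morR fM) (morX fM).
have prodm (l : seq nat) : perm_eq l (iota 0 p) ->
    forall t, commute ((\prod_(r <- l) [~ x ^+ r, y]) ^+ m) t.
  move=> pl; apply: (kerC); rewrite (morX fM) (big_morph f fM (mor1 fM)).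
  under eq_bigr => r _ do rewrite gE.
  have odd_m : odd m by move: odd_n; rewrite nE oddM => /andP[].
  apply: (prod_commgX abPhi pr_p odd_m) pl => // [|h]; last by rewrite -nE Gn.
  exact: gFnorm.
have MR r : M [~ x ^+ r, y] by rewrite /M gE UR.
rewrite nE; apply: (@shift_exp _ M p m sM MC _ _ x _ (fun r => [~ x ^+ r, y])) => //.
- by rewrite -nE.
- by move=> u _; rewrite -nE; exact: nC.
- by rewrite expg0 comm1g.
- by move=> k; rewrite expgSr commg_mulL mulgK.
(* Expanding [[~ v ^+ m, y] = 1] for [v = x ^+ p] gives [w ^+ m] times a power of [[~ w, v]] whose
   exponent ['C(m, 2)] is a multiple of [m]; that power is trivial since [v ^+ m] is central. *)
- have Mu : M (x ^+ p) by rewrite /M (morX fM) UX.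
  set v := x ^+ p in Mu *; set w := [~ v, y]; have Mw : M w by exact: MR.
  have vm : v ^+ m = x ^+ n by rewrite nE expgnA.
  have odd_m : odd m by move: odd_n; rewrite nE oddM => /andP[].
  have : [~ v ^+ m, y] = 1 by rewrite vm; apply: commg_eq1; exact: nC.
  rewrite commgEl conjXg conjg_mulR expMg_class2; try by apply: commute_sym; apply: MC.
  have /dvdnP[k ->] := odd_dvd_bin2 odd_m (dvdnn m).
  have wvm : [~ w, v] ^+ m = 1.
    rewrite -(invgR v w) expVgn -commgX; last by apply: commute_sym; apply: MC.
    by rewrite vm (commg_eq1 (nC x w)) invg1.
  by rewrite mulnC expgnA wvm expg1n mulg1 mulKg.
- by apply: prodm.
- by apply: prodm; rewrite perm_rev.
Qed.
End FrattiniExtension.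

(** * Cyclic commutator subgroup *)

Local Close Scope group_scope.

Section GeometricSums.
Variable l : nat.

(** Geometric sums of ratio [l] and their partial sums: the exponents of [d] in [c ^ (u ^+ k)] and
    in [(u * c) ^+ k]. *)
Fixpoint geom k := if k is j.+1 then 1 + l * geom j else 0.
Fixpoint geom2 k := if k is j.+1 then geom2 j + geom j else 0.

Lemma geomD m k : geom (m + k) = geom m + l ^ m * geom k.
Proof.
elim: m => [|m IHm]; first by rewrite mul1n.
by rewrite addSn /= IHm mulnDr mulnA -expnS addnA.
Qed.

Lemma geom2D m k : geom2 (m + k) = geom2 m + k * geom m + l ^ m * geom2 k.
Proof.
elim: k => [|k IHk]; first by rewrite addn0 mul0n muln0 !addn0.
by rewrite addnS /= IHk geomD mulnDr; lia.
Qed.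

Variable p : nat.
Hypothesis l1 : l = 1 %[mod p].

Lemma expn_mod1 k : l ^ k = 1 %[mod p].
Proof. by rewrite -modnXm l1 modnXm exp1n. Qed.

Lemma geom_mod k : geom k = k %[mod p].
Proof.
elim: k => [//|k IHk] /=.
by rewrite -modnDmr -modnMm l1 IHk modnMm mul1n modnDmr.
Qed.

(** Made for [j = p] odd: both coefficients are then divisible by [p], which is the induction step
    of [dvd_geom2]. *)
Lemma dvd_geom2_mul m j : exists a b,
  [/\ geom2 (j * m) = m * a + b * geom2 m, a = m * 'C(j, 2) %[mod p] & b = j %[mod p]].
Proof.
elim: j => [|j [a [b [E aE bE]]]]; first by exists 0, 0; rewrite mul0n muln0.
exists (a + geom (j * m)), (b + l ^ (j * m)); split.
- by rewrite mulSn addnC geom2D E; lia.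
- rewrite -modnDm aE geom_mod modnDm (binS j 1) bin1.
  by congr (_ %% _); lia.
- by rewrite -modnDm bE expn_mod1 modnDm addn1.
Qed.

Lemma dvd_geom2 e : prime p -> odd p -> p ^ e %| geom2 (p ^ e).
Proof.
move=> pr_p odd_p; elim: e => [|e IHe]; first by rewrite expn0 dvd1n.
have [a [b [E aE bE]]] := dvd_geom2_mul (p ^ e) p.
have pa : p %| a.
  by rewrite /dvdn aE -/(dvdn _ _) dvdn_mull // odd_dvd_bin2.
have pb : p %| b by rewrite /dvdn bE modnn.
rewrite expnS E (mulnC p) dvdn_add //; first by rewrite dvdn_pmul2l // expn_gt0 prime_gt0.
by rewrite (mulnC b) dvdn_mul.
Qed.
End GeometricSums.

(* Unlike for odd primes, [2 ^ e.+1] does not divide [geom2 l (2 ^ e.+1)]. *)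
Lemma geom2_pow2 l e : odd l -> exists2 o, odd o & geom2 l (2 ^ e.+1) = 2 ^ e * o.
Proof.
move=> odd_l; elim: e => [|e [o odd_o E]]; first by exists 1; rewrite //= muln0.
have Em : geom l (2 ^ e.+1) = 2 * (geom l (2 ^ e.+1))./2.
  have := @geom_mod l 2 _ (2 ^ e.+1); rewrite !modn2 odd_l => /(_ erefl).
  by rewrite oddX /=; lia.
(* Odd squares are 1 modulo 4. So in [geom2D] for the doubled argument the factor
   [1 + l ^ (2 ^ e.+1)] is twice an odd number, while the middle term has one more factor 2. *)
have [r lE] : exists r, l ^ (2 ^ e.+1) = 4 * r + 1.
  rewrite expnS expnM; have [s sE] : exists s, l = 2 * s + 1 by exists l./2; lia.
  have -> : l ^ 2 = 4 * (s * s + s) + 1 by rewrite sE; lia.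
  exists (((4 * (s * s + s) + 1) ^ 2 ^ e) %/ 4).
  rewrite {1}(divn_eq (_ ^ _) 4) mulnC; congr (_ + _).
  by rewrite -modnXm mulnC modnMDl modnXm exp1n.
have -> : 2 ^ e.+2 = 2 ^ e.+1 + 2 ^ e.+1 by rewrite (expnS _ e.+1); lia.
exists ((2 * r + 1) * o + 2 * (geom l (2 ^ e.+1))./2).
  by rewrite oddD oddM odd_o; lia.
by rewrite geom2D lE E {1}Em (expnS 2 e); lia.
Qed.

Local Open Scope group_scope.

Section CyclicDerived.
Variables (E : groupType) (gT : finGroupType) (f : E -> gT) (p n : nat).
Hypotheses (fM : {morph f : x y / x * y}) (fS : forall g, exists x, g = f x).
Hypothesis kerC : forall x, f x = 1 -> forall y, commute x y.
Hypotheses (pr_p : prime p) (pG : p.-group [set: gT]).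
Hypothesis cycG' : cyclic [~: [set: gT], [set: gT]].
Hypotheses (Gn : forall g : gT, g ^+ n = 1) (nG : n %| #|gT|).
Implicit Types x y u v : E.

Let R u := f u \in [~: [set: gT], [set: gT]].

Let R_commg u v : R [~ u, v].
Proof. by rewrite /R (morR fM) mem_commg ?inE. Qed.

(** A central extension of a cyclic group is abelian: both elements are powers of one lift [w] times
    central elements. *)
Let RC u v : R u -> R v -> commute u v.
Proof.
case/cyclicP: cycG' => g gE; rewrite /R gE => /cycleP[i ui] /cycleP[j vj].
have [w wg] := fS g.
have lift k t : f t = g ^+ k -> exists2 z, (forall y, commute z y) & t = w ^+ k * z.
  move=> tk; exists (w ^- k * t); last by rewrite mulKVg.
  by apply: kerC; rewrite fM (morV fM) (morX fM) tk -wg mulVg.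
have [z zC ->] := lift _ _ ui; have [z' zC' ->] := lift _ _ vj.
apply: commute_sym; apply: commuteM; apply: commute_sym; last exact: zC.
apply: commuteM; last by apply: commute_sym; exact: zC'.
by apply: commuteX; apply: commute_sym; apply: commuteX.
Qed.

Let nC x y : commute (x ^+ n) y.
Proof. by apply: kerC; rewrite (morX fM) Gn. Qed.

Let n_pnat : exists e, n = (p ^ e)%N.
Proof. by have : p.-nat n by [apply: pnat_dvd nG _; rewrite -cardsT]; case/p_natP=> e;
  exists e. Qed.

(** Conjugation acts on a cyclic group as a power map. Since [n] is a power of [p], Fermat gives
    [l = l ^ n] modulo [p], and [l ^ n = 1] because [f x ^+ n = 1]. *)
Let conj_exp x : exists2 l, l = 1 %[mod p] & forall u, R u -> f u ^ f x = f u ^+ l.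
Proof.
case/cyclicP: cycG' => g gE; rewrite /R gE.
have nrm : f x \in 'N(<[g]>).
  by rewrite -gE; apply: (subsetP (der_norm 1 [set: gT])); rewrite inE.
have /cycleP[l lE] : g ^ f x \in <[g]> by rewrite memJ_norm ?cycle_id.
have uJ k u : f u = g ^+ k -> f u ^ f x = f u ^+ l.
  by move=> ->; rewrite conjXg lE -!expgnA mulnC.
(* For [g = 1] the order of [g] says nothing modulo [p], so [l] is chosen to be 1. *)
have [g1|g1] := eqVneq g 1.
  exists 1%N => // u; rewrite g1 cycle1 inE => /eqP->.
  by rewrite conj1g expg1.
exists l => [|u /cycleP[k]]; last exact: uJ.
have p_g : p %| #[g].
  have : p.-elt g by apply: mem_p_elt pG _; rewrite inE.
  case/p_natP=> -[/eqP|k ->]; last by rewrite expnS dvdn_mulr.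
  by rewrite expn0 order_eq1 (negPf g1).
have gX k : g ^ (f x ^+ k) = g ^+ (l ^ k).
  elim: k => [|k IHk]; first by rewrite conjg1.
  by rewrite expgSr conjgM IHk conjXg lE -expgnA expnS.
have ln : l ^ n = 1 %[mod p].
  have : g ^+ (l ^ n) == g ^+ 1 by rewrite -gX Gn conjg1.
  by rewrite eq_expg_mod_order => /eqP lg; rewrite -(modn_dvdm _ p_g) lg modn_dvdm.
have [e nE] := n_pnat; rewrite -ln nE.
elim: e {nE} => [|e IHe]; first by rewrite expn0 expn1.
by rewrite expnS expnM -modnXm fermat_little // modnXm.
Qed.

Let power_commg u v : exists2 l, l = 1 %[mod p] &
  [~ [~ u, v], u] ^+ n = 1 /\ [~ u, v] ^+ n * [~ [~ u, v], u] ^+ geom2 l n = 1.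
Proof.
set c := [~ u, v]; set d := [~ c, u]; have [l l1 lE] := conj_exp u.
have Rc : R c := R_commg u v; have Rd : R d := R_commg c u.
have cd : commute c d by exact: RC.
have dn : d ^+ n = 1.
  by rewrite /d -commgX //; apply: commg_eq1; exact: nC.
exists l => //; split=> //.
have cu : c ^ u = c * d by rewrite (conjg_mulR c u).
have ucn : (u * c) ^+ n = u ^+ n by exact: (conj_power_n fM Gn kerC).
clearbody d; clearbody c.
(* The power relation is known only in [G]. In [E] it reads [c ^ u = c ^+ l * a] with [a] central,
   and conjugating once more by [u] cancels [a]. *)
have dJ : d ^ u = d ^+ l.
  have [a aC cdE] : exists2 a, (forall y, commute a y) & c * d = c ^+ l * a.
    exists (c ^- l * (c * d)); last by rewrite (mulKVg (c ^+ l)).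
    apply: (kerC); rewrite fM (morV fM) (morX fM) -cu -lE //.
    by rewrite /conjg !fM (morV fM) mulVg.
  apply: (mulgI (c * d)); rewrite -{1}cu -conjMg {1}cdE conjMg conjXg cu.
  rewrite (conjg_id (aC u)) (expgMn _ cd) {1}cdE -!mulgA; congr (_ * _).
  exact: commute_sym (aC _).
have cJ k : c ^ (u ^+ k) = c * d ^+ geom l k.
  elim: k => [|k IHk] /=; first by rewrite conjg1 expg0 mulg1.
  by rewrite expgSr conjgM IHk conjMg conjXg dJ -expgnA expgnDr expg1 mulgA cu.
have ucX k : (u * c) ^+ k = u ^+ k * c ^+ k * d ^+ geom2 l k.
  elim: k => [|k IHk]; first by rewrite !expg0 !mulg1.
  have alg a b : u * c * (u ^+ k * a * b) = u ^+ k.+1 * (c ^ (u ^+ k) * (a * b)).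
    by rewrite expgS /conjg !gnorm.
  rewrite expgS IHk alg cJ (expgS c) /= addnC expgnDr -!mulgA.
  have := commuteX (geom l k) (commute_sym (commuteX k (commute_sym cd))).
  by rewrite (mulgA (d ^+ _)) => <-; rewrite -!mulgA.
by apply: (mulgI (u ^+ n)); rewrite mulgA -ucX mulg1.
Qed.

Lemma derived_exp_cyclic (g : E) : derived g -> g ^+ n = 1.
Proof.
have DR (d : E) : derived d -> R d.
  apply: (@gen_min _ _ R) => [|_ [x [y ->]]]; last exact: R_commg.
  split=> [|x y|x]; rewrite /R; first by rewrite (mor1 fM) group1.
    by rewrite fM; exact: groupM.
  by rewrite (morV fM) groupV.
apply: derived_exp => [c d /DR Rc /DR Rd|c d /DR Rc /DR Rd|x y].
- by rewrite (commg_eq1 (RC Rd Rc)); apply: commute1.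
- by rewrite (commg_eq1 (RC Rd Rc)) expg1n.
have [e nE] := n_pnat.
have [odd_p|] := boolP (odd p).
  have [l l1 [dn]] := power_commg x y.
  have /dvdnP[k ->] : n %| geom2 l n by rewrite nE dvd_geom2.
  by rewrite mulnC expgnA dn expg1n mulg1.
move=> even_p; have p2 : p = 2 by case: (even_prime pr_p) even_p => // ->.
case: e => [|e] in nE.
  have Gn1 (h : gT) : h = 1 by rewrite -(expg1 h) -[1%N]/(p ^ 0)%N -nE.
  apply: (derived_exp_abelian fM Gn kerC); last exact: derivedR.
  by move=> a b; rewrite (Gn1 a) (Gn1 b).
have key u v : [~ u, v] ^+ n * [~ [~ u, v], u] ^+ (2 ^ e) = 1.
  have [l l1 [dn <-]] := power_commg u v; congr (_ * _).
  have odd_l : odd l by move: l1; rewrite p2 !modn2; case: (odd l).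
  have [o odd_o ->] : exists2 o, odd o & geom2 l n = (2 ^ e * o)%N.
    by rewrite nE p2; exact: geom2_pow2.
  have -> : (2 ^ e * o = 2 ^ e + n * o./2)%N.
    by rewrite nE p2 expnSr -{1}(odd_double_half o) odd_o -mul2n mulnDr muln1 mulnA.
  by rewrite expgnDr expgnA dn expg1n mulg1.
set c := [~ x, y]; have Rc : R c := R_commg x y; have cn : commute (c ^+ n) y by [].
have ex : [~ c, x] ^+ (2 ^ e) = c ^- n.
  by apply: (mulgI (c ^+ n)); rewrite key mulgV.
have keyV w : c^-1 ^+ n * [~ c^-1, w] ^+ (2 ^ e) = 1 -> [~ c, w] ^+ (2 ^ e) = c ^- n.
  rewrite commVg; last by apply: commute_sym; exact: RC (R_commg c w) Rc.
  rewrite !expVgn => cw; apply: (mulgI (c ^+ n)); rewrite mulgV.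
  apply: invg_inj; rewrite invgM invg1.
  by apply: (mulgI (c ^- n)); rewrite mulgA cw mul1g mulg1.
have ey : [~ c, y] ^+ (2 ^ e) = c ^- n by apply: keyV; rewrite invgR; exact: key.
have exy : [~ c, x * y] ^+ (2 ^ e) = c ^- n.
  apply: keyV; have -> : c^-1 = [~ x * y, x]; last exact: key.
  by rewrite commg_mulL (commg_eq1 (commute_refl x)) conj1g mul1g invgR.
have Rcy : R ([~ c, x] ^ y) by rewrite conjRg; exact: R_commg.
(* [[~ c, x * y] = [~ c, y] * [~ c, x] ^ y], and all three commutators have the same power [c ^- n]
   with exponent [2 ^ e]. *)
have : c ^- n = c ^- n * c ^- n.
  rewrite -{1}exy commg_mulR (expgMn _ (RC (R_commg c y) Rcy)) ey -conjXg ex.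
  by rewrite (conjg_id (commute_sym (commuteV (commute_sym cn)))).
by rewrite -{1}(mulg1 (c ^- n)) => /mulgI/esym/eqP; rewrite invg_eq1 => /eqP.
Qed.
End CyclicDerived.

(** * The bar complex and its universal central extension *)

Local Close Scope group_scope.
Local Open Scope ring_scope.

Section CocycleExtension.
Variables (G : groupType) (A : zmodType).
Implicit Types (g h k : G) (a b : A).

Definition cocycle (f : G -> G -> A) :=
  forall g h k, f g h + f (g * h)%g k = f h k + f g (h * k)%g.

Variables (f : G -> G -> A) (cf : cocycle f).

Lemma cocycle1l k : f 1%g k = f 1%g 1%g.
Proof. by have := cf 1%g 1%g k; rewrite !mul1g => /addIr. Qed.

Lemma cocycle1r g : f g 1%g = f 1%g 1%g.
Proof. by have := cf g 1%g 1%g; rewrite !mulg1 => /addIr. Qed.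

Lemma cocycleV g : f g g^-1%g = f g^-1%g g.
Proof. by have := cf g g^-1%g g; rewrite mulgV mulVg cocycle1l cocycle1r => /addIr. Qed.

Definition ext of cocycle f : Type := (A * G)%type.
Local Notation E := (ext cf).
Implicit Types x y : E.

HB.instance Definition _ := Choice.on E.

(* The cocycle need not be normalised, whence the shift by [f 1 1]. *)
Let ext_one : E := (- f 1%g 1%g, 1%g).
Let ext_mul x y : E := (x.1 + y.1 + f x.2 y.2, (x.2 * y.2)%g).
Let ext_inv x : E := (- x.1 - f x.2^-1%g x.2 - f 1%g 1%g, x.2^-1%g).

Let ext_mulA : associative ext_mul.
Proof.
move=> [a g] [b h] [c k]; congr pair; last exact: mulgA.
rewrite /=.
by rewrite -!addrA -cf !addrA (addrAC (a + b) (f g h) c).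
Qed.
Let ext_mul1 : left_id ext_one ext_mul.
Proof. by case=> a g; rewrite /ext_mul /= mul1g cocycle1l addrAC addNr add0r. Qed.
Let ext_mulr1 : right_id ext_one ext_mul.
Proof. by case=> a g; rewrite /ext_mul /= mulg1 cocycle1r addrNK. Qed.
Let ext_mulV : left_inverse ext_one ext_inv ext_mul.
Proof.
case=> a g; congr pair; last exact: mulVg.
by rewrite /= (ACl ((1*4)*(2*5)*3)%AC) /= !addNr !add0r.
Qed.
Let ext_mulrV : right_inverse ext_one ext_inv ext_mul.
Proof.
case=> a g; congr pair; last exact: mulgV.
by rewrite /= cocycleV !addrA (ACl ((1*2)*(3*5)*4)%AC) /= subrr addNr !add0r.
Qed.

HB.instance Definition _ :=
  isGroup.Build E ext_mulA ext_mul1 ext_mulr1 ext_mulV ext_mulrV.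

Definition ext_proj x : G := x.2.
Definition ext_in a : E := (a - f 1%g 1%g, 1%g).
Definition ext_sec g : E := (0, g).

Lemma ext_projM : {morph ext_proj : x y / (x * y)%g}. Proof. by []. Qed.

Lemma ext_proj_surj g : exists x, g = ext_proj x.
Proof. by exists (ext_sec g). Qed.

Lemma ext_ker_central x : ext_proj x = 1%g -> forall y, commute x y.
Proof.
case: x => a g /= -> [b h]; congr pair; last by rewrite /= mul1g mulg1.
by rewrite /= cocycle1l cocycle1r (addrC a).
Qed.

Lemma ext_inD a b : ext_in (a + b) = (ext_in a * ext_in b)%g.
Proof.
congr pair; last by rewrite mul1g.
by rewrite /= !addrA addrNK addrAC.
Qed.

Lemma ext_in_central a y : commute (ext_in a) y.
Proof. exact: ext_ker_central. Qed.

Lemma ext_inMn a n : ext_in (a *+ n) = (ext_in a ^+ n)%g.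
Proof.
elim: n => [|n IHn]; last by rewrite mulrS ext_inD IHn expgS.
by rewrite mulr0n /ext_in sub0r.
Qed.

Lemma ext_in_eq1 a : ext_in a = 1%g -> a = 0.
Proof. by case=> /(congr1 (+%R^~ (f 1%g 1%g))); rewrite subrK addNr. Qed.

Lemma ext_secM g h : (ext_sec g * ext_sec h)%g = (ext_in (f g h) * ext_sec (g * h))%g.
Proof. by congr pair; rewrite /= ?mul1g // cocycle1l !add0r addr0 subrK. Qed.

End CocycleExtension.

Section AbelianGroup.
Variables (Q : groupType) (cQ : forall x y : Q, commute x y).

Definition additive_of of (forall x y : Q, commute x y) : Type := Q.
Local Notation B := (additive_of cQ).

HB.instance Definition _ := Choice.on B.

Let addB (x y : B) : B := ((x : Q) * (y : Q))%g.

HB.instance Definition _ := @GRing.isZmodule.Build B 1%g (fun x => x^-1)%g addB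
  (@mulgA Q) cQ (@mul1g Q) (@mulVg Q).

End AbelianGroup.

Lemma abelianization (E : groupType) : exists (B : zmodType) (q : E -> B),
  {morph q : x y / (x * y)%g >-> x + y} /\ forall x, q x = 0 <-> derived x.
Proof.
have nD x h : derived x -> @derived E (x ^ h)%g.
  have [_ DM _] := @derived_sub E.
  by move=> Dx; rewrite conjg_mulR; apply: DM => //; exact: derivedR.
have [Q [q [qM qS q1]]] := exists_quotient (NormalSub (@derived_sub E) nD).
have cQ (x y : Q) : commute x y.
  have [x' ->] := qS x; have [y' ->] := qS y; apply/commgP/eqP.
  by rewrite -(morR qM); apply/q1; exact: derivedR.
by exists (additive_of cQ), q; split=> [x y|x]; [exact: qM|exact: q1].
Qed.

Lemma freeg_additive_eq (T : choiceType) (B : zmodType)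
    (u v : {additive {freeg T} -> B}) :
  (forall x, u << x >> = v << x >>) -> u =1 v.
Proof.
move=> uv z; rewrite -[z]freeg_sumE !raddf_sum; apply: eq_bigr => x _.
by rewrite -[coeff x z]intz -freegU_mulz !raddfMz /= uv.
Qed.

Lemma quot_additive (V : zmodType) (I : zmodClosed V) :
  exists r : {additive V -> Quotient.quot I},
    (forall w, (r w == 0) = (w \in I)) /\ forall c, exists w, c = r w.
Proof.
pose Q := Quotient.quot I; pose r0 := (\pi_Q)%qT.
have rB : zmod_morphism (r0 : V -> Q) by move=> x y; rewrite /r0 !piE.
pose r := HB.pack_for {additive V -> Q} r0 (GRing.isZmodMorphism.Build _ _ _ rB).
exists r; split=> [w|c]; last by exists (repr c); rewrite -[LHS]reprK.
by rewrite -[w in RHS]subr0 Quotient.idealrBE -(raddf0 r).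
Qed.

Section BarQuotient.
Local Open Scope quotient_scope.
Variable G : groupType.

Definition boundary : {pred {freeg (G * G)}} := [pred z | `[< exists w, z = d3 w >]].

Lemma boundary_closed : zmod_closed boundary.
Proof.
split=> [|x y]; rewrite !inE; first by apply/asboolP; exists 0; rewrite raddf0.
move=> /asboolP[u xu] /asboolP[v yv]; apply/asboolP; exists (u - v).
by rewrite raddfB /= -xu -yv.
Qed.

HB.instance Definition _ :=
  GRing.isZmodClosed.Build {freeg (G * G)} boundary boundary_closed.

Lemma bar_quotient : exists (A : zmodType) (r : {additive {freeg (G * G)} -> A}),
  forall w, r w = 0 <-> exists v, w = d3 v.
Proof.
have [r [r0 _]] := quot_additive boundary.
exists (Quotient.quot boundary), r => w.
split=> [/eqP|wd]; first by rewrite r0 inE => /asboolP.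
by apply/eqP; rewrite r0 inE; apply/asboolP.
Qed.

End BarQuotient.

Section CycleDerived.
Variables (G : groupType) (A : zmodType) (r : {additive {freeg (G * G)} -> A}).
Hypothesis rd3 : forall v, r (d3 v) = 0.

Definition bar_cocycle g h := r << (g, h) >>.

Lemma bar_cocycleP : cocycle bar_cocycle.
Proof.
move=> g h k; have := rd3 << (g, h, k) >>.
rewrite d3U scale1r /= raddfB raddfD raddfB /= => /eqP.
by rewrite subr_eq0 -/(bar_cocycle _ _) addrAC subr_eq => /eqP.
Qed.

(** In the abelianisation, [ext_secM] says that the class of the symbol [[g|h]] is the sum of the
    classes of the sections at [g] and [h] minus that at [g * h], which is the shape of [d2
    [g|h]]. *)
Lemma cycle_derived z : d2 z = 0 -> derived (ext_in bar_cocycleP (r z)).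
Proof.
have [B [q [qM q0]]] := abelianization (ext bar_cocycleP).
move=> z0; apply/q0.
have q1 : q 1%g = 0 by apply/q0; have [] := derived_sub (ext bar_cocycleP).
pose u1 w := q (ext_in bar_cocycleP (r w)).
have u1B : zmod_morphism u1.
  move=> x y; apply/eqP; rewrite eq_sym subr_eq -qM -ext_inD -raddfD subrK //.
pose v1 (w : {freeg G}) : zmodule B := fglift (fun g => q (ext_sec bar_cocycleP g) : zmodule B) w.
have v1B : zmod_morphism v1 by exact: lift_is_additive.
pose u2 w : B := v1 (d2 w).
have u2B : zmod_morphism u2.
  by move=> x y; rewrite /u2 raddfB [LHS]v1B.
pose U1 := HB.pack_for {additive {freeg (G * G)} -> B} u1 (GRing.isZmodMorphism.Build _ _ _ u1B).
pose U2 := HB.pack_for {additive {freeg (G * G)} -> B} u2 (GRing.isZmodMorphism.Build _ _ _ u2B).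
have U12 : U1 =1 U2.
  apply: freeg_additive_eq => -[g h].
  rewrite -[LHS]/(u1 _) -[RHS]/(v1 (d2 _)) /u1 d2U scale1r /=.
  pose V1 := HB.pack_for {additive {freeg G} -> zmodule B} v1 (GRing.isZmodMorphism.Build _ _ _
    v1B).
  have v1D : {morph v1 : x y / x + y} := raddfD V1.
  have v1U k : v1 << k >> = q (ext_sec bar_cocycleP k).
    by rewrite /v1 liftU scale1r.
  rewrite v1D v1B !v1U -/(bar_cocycle g h).
  apply/eqP; rewrite addrAC eq_sym subr_eq addrC -!qM; apply/eqP; congr q.
  exact: ext_secM.
have -> : q (ext_in bar_cocycleP (r z)) = u2 z := U12 z.
by rewrite /u2 z0; have := v1B 0 0; rewrite !subrr.
Qed.
End CycleDerived.

(** The hypothesis is applied to the bar cocycle with values in chains modulo boundaries, where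
    [a *+ n = 0] says that [n] times the cycle is a boundary. *)
Lemma H2_exp (G : groupType) n :
  (forall (A : zmodType) (f : G -> G -> A) (cf : cocycle f) a,
     derived (ext_in cf a) -> a *+ n = 0) ->
  forall c : H2 G, c *+ n = 0.
Proof.
move=> An; have [A [r rK]] := bar_quotient G.
have rd3 v : r (d3 v) = 0 by apply/rK; exists v.
have [s [s0 sS]] := quot_additive (@B2 G) => c; have [z ->] := sS c.
have /rK[v zn] : r (z2val z *+ n) = 0.
  rewrite raddfMn; apply: (An _ _ (bar_cocycleP rd3)); apply: cycle_derived.
  by have := valP z; rewrite inE => /eqP.
rewrite -raddfMn; apply/eqP; rewrite s0 inE; apply/asboolP; exists v.
by rewrite -zn; elim: (n) => // k IHk; rewrite !mulrS -IHk.
Qed.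

(** * Exponents, divisibility and the criterion for cocycles *)

Lemma least_posP P : (0 < least_pos P)%N -> P (least_pos P).
Proof.
rewrite /least_pos; case: pselect => // exP; case: ex_minnP => n /andP[_].
by move=> /asboolP.
Qed.

Lemma least_pos_dvd (P : nat -> Prop) n :
  (forall a b c, P b -> P (a * b + c)%N -> P c) -> P n -> (least_pos P %| n)%N.
Proof.
move=> Pmod Pn; rewrite /least_pos; case: pselect => [exP|nexP]; last first.
  case: n Pn => // n Pn; case: nexP; exists n.+1; exact/asboolP.
case: ex_minnP => k /andP[k0 /asboolP Pk] kmin.
have Pr : P (n %% k)%N by apply: (Pmod (n %/ k)%N k) => //; rewrite -divn_eq.
rewrite /dvdn -leqn0 leqNgt; apply/negP => nk.
have /kmin : (0 < n %% k)%N && `[< P (n %% k)%N >] by rewrite nk; apply/asboolP.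
by rewrite leqNgt ltn_pmod.
Qed.

Lemma group_expP (G : groupType) : (0 < group_exp G)%N ->
  forall x : G, (x ^+ group_exp G = 1)%g.
Proof. exact: least_posP. Qed.

Lemma group_exp_dvd (G : groupType) n :
  (forall x : G, (x ^+ n = 1)%g) -> (group_exp G %| n)%N.
Proof.
apply: least_pos_dvd => a b c xb xc x.
by rewrite -(xc x) expgnDr mulnC expgnA xb expg1n mul1g.
Qed.

Lemma zmod_exp_dvd (V : zmodType) n :
  (forall v : V, v *+ n = 0) -> (zmod_exp V %| n)%N.
Proof.
apply: least_pos_dvd => a b c vb vc v.
by rewrite -(vc v) mulrnDr mulnC mulrnA vb mul0rn add0r.
Qed.

Lemma schur_dvd (G : groupType) :
  (forall n, (0 < n)%N -> n = group_exp G -> (forall x : G, (x ^+ n = 1)%g) ->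
     forall (A : zmodType) (f : G -> G -> A) (cf : cocycle f) a,
     derived (ext_in cf a) -> a *+ n = 0) ->
  (zmod_exp (H2 G) %| group_exp G)%N.
Proof.
move=> crit; have [->|n0] := posnP (group_exp G); first exact: dvdn0.
by apply: zmod_exp_dvd; apply: H2_exp; apply: crit => //; exact: group_expP.
Qed.

Local Close Scope ring_scope.
Local Open Scope group_scope.

Lemma central_quot_exp (G : groupType) k (x y : G) : (0 < k)%N ->
  group_exp (central_quot G) = k -> commute (x ^+ k) y.
Proof.
move=> k0 kE; have := @group_expP (central_quot G); rewrite kE => /(_ k0) Qk.
have piX j : (\pi_(central_quot G) (x ^+ j) = (\pi_(central_quot G) x) ^+ j)%qT.
  elim: j => [|j IHj]; first by rewrite expg0 -[RHS]/(cq_one G) piE.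
  by rewrite expgS pi_cq_mul IHj expgS.
have : (\pi_(central_quot G) (x ^+ k) = \pi_(central_quot G) 1)%qT.
  by rewrite piX Qk -[LHS]/(cq_one G) piE.
move/esym/eqP; rewrite centerg_eqE invg1 mul1g => /centergP; exact.
Qed.

Lemma ext_derived (G : groupType) (A : zmodType) (f : G -> G -> A) (cf : cocycle f) n a :
  (forall g : ext cf, derived g -> g ^+ n = 1) -> derived (ext_in cf a) -> (a *+ n = 0)%R.
Proof. by move=> En /En; rewrite -ext_inMn => /ext_in_eq1. Qed.

Lemma schur_central23 (G : groupType) (p : nat) :
  p \in [:: 2; 3] -> group_exp (central_quot G) = p ->
  zmod_exp (H2 G) %| group_exp G.
Proof.
move=> p23 pE; apply: schur_dvd => n n0 _ Gn A f cf a; apply: ext_derived => g.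
have p0 : (0 < p)%N by case: p p23 {pE}.
have pC (x y : G) : commute (x ^+ p) y by exact: central_quot_exp.
move: p23 pC; rewrite !inE => /orP[]/eqP-> pC.
  exact: (derived_exp2 (@ext_projM _ _ _ cf) n0 Gn (@ext_ker_central _ _ _ cf) pC).
exact: (derived_exp3 (@ext_projM _ _ _ cf) n0 Gn (@ext_ker_central _ _ _ cf) pC).
Qed.

Lemma group_exp_card (gT : finGroupType) : group_exp gT %| #|gT|.
Proof. by apply: group_exp_dvd => x; rewrite -cardsT expg_cardG ?inE. Qed.

Lemma schur_abelian_Phi (gT : finGroupType) (p : nat) :
  prime p -> odd p -> p.-group [set: gT] -> abelian 'Phi([set: gT]) ->
  zmod_exp (H2 gT) %| group_exp gT.
Proof.
move=> pr_p odd_p pG abPhi; apply: schur_dvd => n n0 nE Gn A f cf a; apply: ext_derived => g.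
have nG : n %| #|gT| by rewrite nE group_exp_card.
exact: (derived_expPhi (@ext_projM _ _ _ cf) (@ext_ker_central _ _ _ cf) pr_p odd_p pG abPhi n0
  Gn nG).
Qed.

Lemma schur_cyclic_derived (gT : finGroupType) (p : nat) :
  prime p -> p.-group [set: gT] -> cyclic [~: [set: gT], [set: gT]] ->
  zmod_exp (H2 gT) %| group_exp gT.
Proof.
move=> pr_p pG cycG'; apply: schur_dvd => n n0 nE Gn A f cf a; apply: ext_derived => g.
have nG : n %| #|gT| by rewrite nE group_exp_card.
exact: (derived_exp_cyclic (@ext_projM _ _ _ cf) (@ext_proj_surj _ _ _ cf) (@ext_ker_central _
  _ _ cf) pr_p pG cycG' Gn nG).
Qed.

(** * Transfer and Sylow subgroups *)

Section Transfer.
Variables (gT : finGroupType) (A : zmodType) (f : gT -> gT -> A) (cf : cocycle f).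
Variable P : {group gT}.
Local Notation E := (ext cf).

Definition sub_cocycle (u v : subg_of P) := f (sgval u) (sgval v).

Lemma sub_cocycleP : cocycle sub_cocycle.
Proof. by move=> u v w; rewrite /sub_cocycle; exact: cf. Qed.
Local Notation EP := (ext sub_cocycleP).

(** Multiplicative only on the preimage of [P]: elsewhere [subg P] returns the default value 1. *)
Let theta (x : E) : EP := (x.1, subg P x.2).

Let thetaM (x y : E) : ext_proj x \in P -> ext_proj y \in P -> theta (x * y) = theta x * theta y.
Proof.
move=> Px Py; congr pair; last by rewrite /= subgM.
by rewrite /= /sub_cocycle !subgK.
Qed.

Let theta_in a : theta (ext_in cf a) = ext_in sub_cocycleP a.
Proof.
congr pair; last by apply: val_inj; rewrite /= subgK.
Qed.

(* The transfer [V] from [E] to the abelianisation of the preimage of [P]: it kills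
   [derived] and multiplies the central element [ext_in cf a] by the index of [P]. *)
Lemma transfer_derived (a : A) : derived (ext_in cf a) ->
  derived (ext_in sub_cocycleP (a *+ #|rcosets P [set: gT]|)).
Proof.
have [B [q [qM q0]]] := abelianization EP.
pose t (C : {set gT}) (x : E) : E :=
  ext_sec cf (fingroup.repr C) * x * (ext_sec cf (fingroup.repr (C :* ext_proj x)))^-1.
pose V (x : E) : B := (\sum_(C in rcosets P [set: gT]) q (theta (t C x)))%R.
have repC (C : {set gT}) : C \in rcosets P [set: gT] -> C = P :* fingroup.repr C.
  by case/rcosetsP=> h _ ->; rewrite rcoset_repr.
have RM (C : {set gT}) g : C \in rcosets P [set: gT] -> C :* g \in rcosets P [set: gT].
  by case/rcosetsP=> h _ ->; rewrite -rcosetM mem_rcosets mulSGid ?inE ?subsetT.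
have tP C x : C \in rcosets P [set: gT] -> ext_proj (t C x) \in P.
  move=> RC; have -> : ext_proj (t C x) = fingroup.repr C * ext_proj x * (fingroup.repr (C :*
    ext_proj x))^-1.
    by [].
  move: (ext_proj x) => g; rewrite -mem_rcoset -(repC _ (RM _ g RC)) mem_rcoset mulgK.
  by have := rcoset_refl P (fingroup.repr C); rewrite -(repC _ RC).
have tM C (x y : E) : t C (x * y) = t C x * t (C :* ext_proj x) y.
  by rewrite /t ext_projM rcosetM; rewrite !mulgA mulgKV.
have VM (x y : E) : V (x * y) = (V x + V y)%R.
  have -> : (V y = \sum_(C in rcosets P [set: gT]) q (theta (t (C :* ext_proj x) y)))%R.
    rewrite {1}/V (reindex_acts 'Rs (actsRs_rcosets P [set: gT]) (in_setT (ext_proj x))); 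
    by apply: eq_bigr => C _; rewrite /= rcosetE.
  rewrite /V -big_split; apply: eq_bigr => C RC; rewrite /= tM thetaM ?qM //; first exact: tP.
  by apply: tP; apply: RM.
have V1 : V 1 = 0%R by apply: (addrI (V 1)); rewrite -VM mulg1 addr0.
have V0 (x : E) : derived x -> V x = 0%R.
  apply: (@gen_min _ _ (fun x => V x = 0%R)) => [|_ [u [v ->]]].
    split=> // [u v u0 v0|u u0]; first by rewrite VM u0 v0 addr0.
    by apply: (addrI (V u)); rewrite -VM mulgV V1 u0 addr0.
  by apply: (addrI (V (v * u))); rewrite -VM -commgC addr0 !VM addrC.
move=> /V0; rewrite /V (eq_bigr (fun=> q (ext_in sub_cocycleP a))) => [|C RC].
  rewrite sumr_const => qa; apply/q0; rewrite -{}qa.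
  elim: #|_| => [|k IHk]; last by rewrite !mulrS ext_inD qM IHk.
  by apply/q0; rewrite mulr0n -(mulr0n a) ext_inMn; have [] := derived_sub EP.
rewrite -theta_in /t mulg1; congr (q (theta _)).
by rewrite -mulgA ext_in_central mulKVg.
Qed.
End Transfer.

(** By transfer, the order [k] of [a *+ n] divides the index of a Sylow [p]-subgroup for each prime
    [p], so no prime divides [k]. *)
Lemma schur_sylow (gT : finGroupType) n (A : zmodType) (f : gT -> gT -> A)
    (cf : cocycle f) (a : A) :
  (forall p (P : {group gT}), prime p -> p.-group P ->
     forall g : ext (@sub_cocycleP _ _ _ cf P), derived g -> g ^+ n = 1) ->
  derived (ext_in cf a) -> (a *+ n = 0)%R.
Proof.
move=> sylE Da; pose k := least_pos (fun k => (a *+ n *+ k = 0)%R).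
have mp p : prime p -> exists2 m, (0 < m)%N /\ ~~ (p %| m) & (a *+ n *+ m = 0)%R.
  move=> pr_p; have [P sylP] := Sylow_exists p [set: gT].
  have [_ pP p'i] := and3P sylP.
  exists #|[set: gT] : P|; last first.
    rewrite -mulrnA mulnC mulrnA; have := @transfer_derived _ _ _ cf P a Da.
    by apply: ext_derived; exact: (sylE p).
  by split; [exact: indexg_gt0|rewrite -p'natE].
have k_dvd m : (a *+ n *+ m = 0)%R -> k %| m.
  apply: least_pos_dvd => i b c xb xc.
  by rewrite -[LHS]add0r -{1}(mul0rn _ i) -{1}xb -(mulrnA _ b) mulnC -mulrnDr.
(* Any prime shows that the order is finite; 2 is an arbitrary choice. *)
have k0 : (0 < k)%N.
  have [m [m0 _] /k_dvd/dvdn_gt0] := mp 2 isT; exact.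
have ak : (a *+ n *+ k = 0)%R by exact: (least_posP k0).
have [k1|k1] := leqP k 1.
  by move: ak; rewrite (_ : k = 1%N) //; apply/eqP; rewrite eqn_leq k1.
have [m [_ /negP pm] /k_dvd km] := mp _ (pdiv_prime k1).
by case: pm; apply: dvdn_trans km; exact: pdiv_dvd.
Qed.

Lemma schur_central6_fin (gT : finGroupType) : (forall x y : gT, commute (x ^+ 6) y) ->
  zmod_exp (H2 gT) %| group_exp gT.
Proof.
move=> G6; apply: schur_dvd => n n0 _ Gn A f cf a; apply: schur_sylow => p P pr_p pP.
have PM := @ext_projM _ _ _ (@sub_cocycleP _ _ _ cf P).
have PC := @ext_ker_central _ _ _ (@sub_cocycleP _ _ _ cf P).
have sX (u : subg_of P) j : sgval (u ^+ j) = sgval u ^+ j.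
  by elim: j => [|j IHj]; rewrite ?expgS ?sgvalM ?IHj.
have Pn (u : subg_of P) : u ^+ n = 1 by apply: val_inj; rewrite [LHS]sX Gn.
have [k PE] := p_natP pP.
have Pq (u : subg_of P) : u ^+ (p ^ k) = 1.
  by apply: val_inj; rewrite [LHS]sX -PE expg_cardG // subgP.
have P6 (u v : subg_of P) : commute (u ^+ 6) v.
  by apply: val_inj; have := G6 (sgval u) (sgval v); rewrite -sX; exact.
(* [l] is invertible modulo the exponent of [P], so centrality of sixth powers descends to [j]-th
   powers: [j] is 2 or 3 for these two primes and 1 for all others. *)
have reduce j l : (j * l = 6)%N -> coprime l p -> forall u v : subg_of P, commute (u ^+ j) v.
  move=> jl co u; apply: (coprime_central Pq (coprimeXr k co)) => v.
  by rewrite -expgnA jl.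
have [p2|p2] := eqVneq p 2.
  by apply: (derived_exp2 PM n0 Pn PC); apply: (reduce 2 3); rewrite ?p2.
have [p3|p3] := eqVneq p 3.
  by apply: (derived_exp3 PM n0 Pn PC); apply: (reduce 3 2); rewrite ?p3.
apply: (derived_exp_abelian PM Pn PC); apply: (reduce 1%N 6) => //.
rewrite -[6]/(2 * 3)%N coprimeMl !prime_coprime ?dvdn_prime2 //.
by rewrite (eq_sym 2) (eq_sym 3) p2 p3.
Qed.

(** An equality of group structures rather than an isomorphism, so that the result for finite groups
    transfers by rewriting. *)
Lemma enumerated_finGroup (G : groupType) (t : seq G) : (forall g, g \in t) ->
  exists gT : finGroupType, (gT : groupType) = G.
Proof.
case: G t => T0 [? ? ? ? ? ? ? ? ?] t; set G := Group.Pack _ => tP; pose T : Type := G.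
have idxK : cancel (fun g : G => index g t) (nth 1 t) by move=> g; exact: nth_index.
have enumP : Finite.axiom (undup t).
  by move=> g; rewrite count_uniq_mem ?undup_uniq // mem_undup tP.
pose C := CanIsCountable idxK.
pose cT : countType := HB.pack T (Group.class G) C.
pose F := isFinite.Build cT enumP.
pose gT : finGroupType := HB.pack T (Group.class G) C F.
exists gT. reflexivity.
Qed.

(** If the exponent is finite, the centre is locally finite, being abelian of finite exponent.
    Hall's theorem gives finitely many cosets of the centre, and [loc_finite_cover] then lists all
    of [G]. *)
Lemma schur_central6 (G : groupType) : finitely_generated G -> group_exp (central_quot G) = 6 ->
  zmod_exp (H2 G) %| group_exp G.
Proof.
move=> [s sP] E6; have [->|n0] := posnP (group_exp G); first exact: dvdn0.
have Gn := group_expP n0.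
have G6 (x y : G) : commute (x ^+ 6) y by exact: central_quot_exp.
pose Z (z : G) := forall t, commute z t.
have [Q [f [fM fS /= fZ]]] := exists_quotient (NormalSub (@center_sub G) (@center_normed G)).
have Q6 (q : Q) : q ^+ 6 = 1.
  by have [x ->] := fS q; rewrite -(morX fM); apply/fZ; exact: G6.
have [tQ tQP] := exp6_finite Q6 (s := map f s) (fun _ _ => I).
have fZl : loc_finite Z.
  apply: (@loc_finite_ext _ (fun z => z = 1) Z (group_exp G)) => //.
  - by split=> // [x y ->->|x ->]; rewrite ?mulg1 ?invg1.
  - exact: center_sub.
  - by move=> x h -> _; rewrite conj1g.
  - exact: loc_finite1.
  - by move=> x y Zx _; apply: commg_eq1; exact: Zx.
have [r rP] := choice fS.
have gens g : gen (fun x => x \in s) g.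
  suff : g \in [pred x | `[< gen (fun x => x \in s) x >]] by rewrite inE => /asboolP.
  have [g1 gM gV] := gen_sub (fun x : G => x \in s).
  apply: sP => [|x xs]; last by rewrite inE; apply/asboolP; exact: gen_in.
  split=> [|x y]; rewrite !inE; first exact/asboolP.
  by move=> /asboolP gx /asboolP gy; apply/asboolP; exact: gM gx (gV _ gy).
have fgen g : gen (fun q => q \in map f s) (f g).
  have [q1 qM qV] := gen_sub (fun q : Q => q \in map f s).
  apply: (gen_min (H := fun g => gen (fun q => q \in map f s) (f g))) (gens g) => [|x xs].
    split=> [|x y gx gy|x gx]; [rewrite (mor1 fM)|rewrite fM|rewrite (morV fM)] => //.
    - exact: qM gx gy.
    - exact: qV gx.
  by apply: gen_in; exact: map_f.
have [|t tP] := @loc_finite_cover _ Z s (map r tQ) (@center_sub G) fZl.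
  move=> g _; exists (r (f g)); first by apply: map_f; apply: tQP; exact: fgen.
  by apply/fZ; rewrite fM (morV fM) -rP mulgV.
have [gT gE] := enumerated_finGroup (fun g => tP g (gens g)).
move: G6; rewrite -gE; exact: schur_central6_fin.
Qed.

Theorem theoremA :
  [/\ (forall (G : groupType) (p : nat),
         p \in [:: 2; 3] -> group_exp (central_quot G) = p ->
         zmod_exp (H2 G) %| group_exp G),
      (forall G : groupType,
         finitely_generated G -> group_exp (central_quot G) = 6 ->
         zmod_exp (H2 G) %| group_exp G),
      (forall (gT : finGroupType) (p : nat),
         prime p -> odd p -> p.-group [set: gT] ->
         abelian 'Phi([set: gT]) ->
         zmod_exp (H2 gT) %| group_exp gT)
    & (forall (gT : finGroupType) (p : nat),
         prime p -> p.-group [set: gT] ->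
         cyclic [~: [set: gT], [set: gT]] ->
         zmod_exp (H2 gT) %| group_exp gT)].
Proof.
split; [exact: schur_central23|exact: schur_central6|exact: schur_abelian_Phi|].
exact: schur_cyclic_derived.
Qed.
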